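(* Let $0\le s\le r$, and let $\lambda\in\widehat A_{r-s}$, $\mu\in\widehat A_s$ and $\nu\in\widehat A_r$. Then there is an isomorphism of $\mathbb F$-vector spaces $$\mathrm{Hom}_{A^{\mathbb F}_{r-s}\times A^{\mathbb F}_s}\big(\Delta^{\mathbb F}_{r-s}(\lambda)\boxtimes\Delta^{\mathbb F}_s(\mu),\ \mathrm{Res}^{A_r^{\mathbb F}}_{A^{\mathbb F}_{r-s}\times A^{\mathbb F}_s}(\Delta^{\mathbb F}_r(\nu))\big)\;\cong\;\mathrm{Hom}_{A_s^{\mathbb F}}\big(\Delta_s^{\mathbb F}(\mu),\Delta_s^{\mathbb F}(\nu\setminus\lambda)\big).$$
   Context: **Cellular algebras.** Let $R$ be an integral domain with field of fractions $\mathbb F$. A cellular algebra over $R$ is a tuple $(A,*,\widehat A,\trianglerighteq,\mathscr A)$ where $A$ is a unital $R$-algebra with an algebra involution $*$ (an $R$-linear anti-automorphism with $(x^* )^*=x$); $(\widehat A,\trianglerighteq)$ is a finite poset and for each $\lambda\in\widehat A$ there is a finite set $\mathrm{Std}(\lambda)$; $\mathscr A=\{c^\lambda_{\mathsf s\mathsf t}\mid\lambda\in\widehat A,\ \mathsf s,\mathsf t\in\mathrm{Std}(\lambda)\}$ is an $R$-basis of $A$ such that (a) for $\lambda\in\widehat A$, $\mathsf t\in\mathrm{Std}(\lambda)$, $a\in A$ there are $r(a;\mathsf t,\mathsf v)\in R$ with $c^\lambda_{\mathsf s\mathsf t}a\equiv\sum_{\mathsf v}r(a;\mathsf t,\mathsf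 v)c^\lambda_{\mathsf s\mathsf v}\bmod A^{\rhd\lambda}$ for all $\mathsf s\in\mathrm{Std}(\lambda)$, where $A^{\rhd\lambda}$ is the $R$-span of all $c^\mu_{\mathsf p\mathsf q}$ with $\mu\rhd\lambda$; (b) $(c^\lambda_{\mathsf s\mathsf t})^*=c^\lambda_{\mathsf t\mathsf s}$. The cell module $\Delta^R(\lambda)$ is the right $A$-module with $R$-basis $\{c^\lambda_{\mathsf s\mathsf t}+A^{\rhd\lambda}\mid\mathsf t\in\mathrm{Std}(\lambda)\}$ for any fixed $\mathsf s$; $\Delta^{\mathbb F}(\lambda)=\Delta^R(\lambda)\otimes_R\mathbb F$. $A$ is cyclic cellular if every cell module is cyclic, and generically semisimple if $A^{\mathbb F}=A\otimes_R\mathbb F$ is semisimple. **Strongly coherent towers.** Let $(A_k)_{k\ge0}$ be an increasing sequence $R=A_0\subseteq A_1\subseteq\cdots$ of cyclic cellular algebras over $R$ with unital inclusions and compatible involutions; cell modules of $A_k$ are $\Delta^R_k(\lambda)$, $\lambda\in\widehat A_k$. An order preserving cell-filtration of a right module $M$ is a filtration $0=M_0\subseteq\cdots\subseteq M_p=M$ with $M_i/M_{i-1}$ isomorphic to a cell module labelled by $\lambda^{(i)}$ and $\lambda^{(i)}\rhd\lambda^{(i+1)}$ for all $i$. The tower is strongly coherent if all modules induced from cell modules of $A_k$ to $A_{k+1}$, and all restrictions of cell modules of $A_{k+1}$ to $A_k$, have order preserving cell-filtrations. The branching graph $\widehat A$ has vertex set $\widehat A_k$ on level $k$, and an edge $\lambda\to\mu$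 ($\lambda\in\widehat A_k$, $\mu\in\widehat A_{k+1}$) iff $\Delta_k^R(\lambda)$ appears in the cell-filtration of the restriction of $\Delta^R_{k+1}(\mu)$ to $A_k$. **Towers of diagram algebras.** Let $(A_k)_{k\ge0}$ and $(H_k)_{k\ge0}$ be two increasing towers of $R$-algebras with common multiplicative identity. $(A_k)$ is a tower of diagram algebras (obtained by reflections from $(H_k)$) if: (1) there are algebra involutions $*$ on $\bigcup_kA_k$ and $\bigcup_kH_k$ preserving each $A_k$, resp. $H_k$; (2) $A_0=H_0=R$ and $A_1=H_1$ as algebras with involution; (3) for $k\ge2$, $A_k$ contains an element $e_{k-1}=e_{k-1}^*$ with $e_{k-1}^2=\delta e_{k-1}$ for some nonzero $\delta\in R$, and $A_k/(A_ke_{k-1}A_k)\cong H_k$ as algebras with involution; (4) for $k\ge1$, $e_k$ commutes with $A_{k-1}$ and $e_kA_ke_k\subseteq A_{k-1}e_k$; (5) for $k\ge1$, $A_{k+1}e_k=A_ke_k$ and $x\mapsto xe_k$ is injective from $A_k$ to $A_ke_k$; (6) for $k\ge2$, $e_{k-1}\in A_{k+1}e_kA_{k+1}$; (7) $(H_k)$ is a strongly coherent tower of cellular algebras; (8) for $k\ge2$, $e_{k-1}A_ke_{k-1}A_k=e_{k-1}A_k$; (9) each $H_k$ is cyclic cellular; (10) each $A_k^{\mathbb F}=A_k\otimes_R\mathbb F$ is split semisimple. It is known that then $(A_k)$ is a strongly coherent tower of generically semisimple cyclic cellular algebras. **Standing assumptions.** $(A_k)_{k\ge0}$ is a tower of diagram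 algebras, equipped with a family of (additive or multiplicative) Jucys–Murphy elements: elements $L_k\in A_k$ ($k\ge1$), $*$-invariant, with $L_k$ commuting with $A_{k-1}$, such that for every $\lambda\in\widehat A_k$ the element $L_1+\cdots+L_k$ (additive case), respectively $L_1\cdots L_k$ with all $L_i$ invertible (multiplicative case), acts on $\Delta_k^R(\lambda)$ by a scalar $d(\lambda)\in R$. For $0\le s\le r$ there is a fixed injective unital algebra homomorphism $A_{r-s}\otimes_RA_s\to A_r$ restricting on $A_{r-s}\otimes1$ to the tower inclusion; its image is written $A_{s,r}=A_{r-s}\times A_s\subseteq A_r$, $1\times A_s$ is the image of $1\otimes A_s$, and $A^{\mathbb F}_{r-s}\times A^{\mathbb F}_s=A_{s,r}\otimes_R\mathbb F$. **Tableaux.** For $\lambda\in\widehat A_{r-s}$, $\nu\in\widehat A_r$, $\mathrm{Std}_s(\nu\setminus\lambda)$ is the set of paths of length $s$ from $\lambda$ to $\nu$ in $\widehat A$; $\mathrm{Std}_r(\nu)$ is the set of paths $\mathsf t=(\mathsf t(0)\to\cdots\to\mathsf t(r)=\nu)$ starting on level $0$. Dominance order on paths between the same levels: $\mathsf s\trianglerighteq\mathsf t$ iff $\mathsf s(k)\trianglerighteq\mathsf t(k)$ on every level $k$. **Murphy basis (known).** There are elements (branching coefficients) $d_{\lambda\to\mu},u_{\lambda\to\mu}\in A_{k+1}$, one pair for each edge $\lambda\to\mu$ from level $k$ to level $k+1$, such that for each $r$, with $d_{\mathsf s}=d_{\mathsf s(0)\to\mathsf s(1)}\cdots d_{\mathsf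 s(r-1)\to\mathsf s(r)}$ and $u_{\mathsf t}=u_{\mathsf t(r-1)\to\mathsf t(r)}\cdots u_{\mathsf t(0)\to\mathsf t(1)}$, the set $\{d_{\mathsf s}u_{\mathsf t}\mid\mathsf s,\mathsf t\in\mathrm{Std}_r(\nu),\nu\in\widehat A_r\}$ is a cellular basis of $A_r$; moreover $u_{\mathsf t}\in A_r^{\trianglerighteq\nu}$ for $\mathsf t\in\mathrm{Std}_r(\nu)$ (the $R$-span of the cellular basis elements labelled by $\mu\trianglerighteq\nu$), and $\Delta^R_r(\nu)$ is identified with the right $A_r$-module with $R$-basis $\{u_{\mathsf t}+A_r^{\rhd\nu}\mid\mathsf t\in\mathrm{Std}_r(\nu)\}$. Such a choice is fixed. For a skew path $\mathsf u\in\mathrm{Std}_s(\nu\setminus\lambda)$, $u_{\mathsf u}$ is the analogous product of the $u$-coefficients along its edges, last edge leftmost, so $u_{\mathsf u}u_{\mathsf t}$ is the $u$-element of the concatenated path. **Skew cell modules.** $A^{\rhd\nu\setminus\lambda}_{s,r}$ is the $R$-span in $A_r$ of $\{d_{\mathsf s}u_{\mathsf t}\mid\mathsf s,\mathsf t\in\mathrm{Std}_r(\mu),\ \mu\rhd\nu\}\cup\{u_{\mathsf t}\mid\mathsf t\in\mathrm{Std}_r(\nu),\ \mathsf t(r-s)\rhd\lambda\}$. The skew cell module is $\Delta^R_s(\nu\setminus\lambda)=\mathrm{Span}_R\{u_{\mathsf u}u_{\mathsf t^\lambda}+A^{\rhd\nu\setminus\lambda}_{s,r}\mid\mathsf u\in\mathrm{Std}_s(\nu\setminus\lambda)\}$,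 where $\mathsf t^\lambda$ is any maximal element of $\mathrm{Std}_{r-s}(\lambda)$ in the dominance order; it is a right $A_s$-module via right multiplication by $1\times A_s\subseteq A_r$. Put $\Delta^{\mathbb F}_s(\nu\setminus\lambda)=\Delta^R_s(\nu\setminus\lambda)\otimes_R\mathbb F$. *)

(* Defs.v *)
From HB Require Import structures.
From mathcomp Require Import all_boot all_order all_algebra.
From mathcomp Require Import boolp classical_sets functions.

Set Implicit Arguments.
Unset Strict Implicit.
Unset Printing Implicit Defensive.

Import Order.TTheory GRing.Theory.

Local Open Scope classical_set_scope.
Local Open Scope quotient_scope.
Local Open Scope ring_scope.

(* Unital associative K-algebras. MathComp's algType imposes 1 != 0, which is  *)
(* not stable under tensor products, and HB does not allow a weaker join of    *)
(* PzRing and Lmodule below LSemiAlgebra; hence the separate operations.      *)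
HB.mixin Record Lmodule_isUAlg (K : comNzRingType) A of GRing.Lmodule K A := {
  aone : A;
  amul : A -> A -> A;
  amulA : associative amul;
  amul1l : left_id aone amul;
  amul1r : right_id aone amul;
  amul_linl : forall y : A, linear (amul^~ y);
  amul_linr : forall x : A, linear (amul x);
}.

#[short(type="ualgType")]
HB.structure Definition UAlg (K : comNzRingType) :=
  {A of GRing.Lmodule K A & Lmodule_isUAlg K A}.

Arguments aone {K} A : rename.
Infix "*a" := amul (at level 40, left associativity).

Record algHom (K : comNzRingType) (B C : ualgType K) := AlgHom {
  ah_fun :> B -> C;
  ah_lin : linear ah_fun;
  ah_one : ah_fun (aone B) = aone C;
  ah_mul : {morph ah_fun : x y / x *a y}
}.

Section LinearLemmas.
Variables (K : comNzRingType) (V W : lmodType K).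

Lemma lin0 (f : V -> W) : linear f -> f 0 = 0.
Proof. by move=> h; have := h (-1) 0 0; rewrite scaler0 addr0 scaleN1r addNr. Qed.

Lemma linD (f : V -> W) : linear f -> {morph f : x y / x + y}.
Proof. by move=> h x y; have := h 1 x y; rewrite !scale1r. Qed.

Lemma linZ (f : V -> W) : linear f -> forall a, {morph f : x / a *: x}.
Proof. by move=> h a x; have := h a x 0; rewrite (lin0 h) !addr0. Qed.

Lemma linN (f : V -> W) : linear f -> {morph f : x / - x}.
Proof. by move=> h x; rewrite -!scaleN1r (linZ h). Qed.

Lemma lin_sum (f : V -> W) I r (F : I -> V) :
  linear f -> f (\sum_(i <- r) F i) = \sum_(i <- r) f (F i).
Proof. move=> h; apply: (big_morph f); [exact: linD|exact: lin0]. Qed.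
End LinearLemmas.

(******************************************************************************)
(* Tensor product of two modules over a commutative ring. The elements are    *)
(* classes of finite formal sums of pairs; two sums are identified when every *)
(* bilinear map takes the same value on them.                                 *)
(******************************************************************************)

Definition bilin (K : comNzRingType) (M N G : lmodType K) (phi : M -> N -> G) :=
  (forall n, linear (phi^~ n)) /\ (forall m, linear (phi m)).

Section Tensor.
Variables (K : comNzRingType) (M N : lmodType K).

Definition tsum (G : lmodType K) (phi : M -> N -> G) (s : seq (M * N)) : G :=
  \sum_(p <- s) phi p.1 p.2.

Definition tens_rel : rel (seq (M * N)) := fun s t =>
  `[< forall (G : lmodType K) (phi : M -> N -> G), bilin phi ->
        tsum phi s = tsum phi t >].

Lemma tens_rel_equiv : equiv_class_of tens_rel.
Proof.
split.
- by move=> s; apply/asboolP.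
- by move=> s t; apply/asboolP/asboolP => h G phi /h.
- move=> t s u /asboolP h1 /asboolP h2; apply/asboolP => G phi hp.
  by rewrite h1 // h2.
Qed.

Canonical tens_equiv := EquivRelPack tens_rel_equiv.

Definition tens := {eq_quot tens_equiv}.
HB.instance Definition _ : EqQuotient _ tens_equiv tens := EqQuotient.on tens.
HB.instance Definition _ := Choice.on tens.

Definition pure (m : M) (n : N) : tens := \pi_tens [:: (m, n)].

(* The map induced on the tensor product; meaningful for bilinear phi. *)
Definition tens_lift (G : lmodType K) (phi : M -> N -> G) (x : tens) : G :=
  tsum phi (repr x).

Lemma tens_lift_pi (G : lmodType K) (phi : M -> N -> G) s :
  bilin phi -> tens_lift phi (\pi_tens s) = tsum phi s.
Proof.
move=> hp; rewrite /tens_lift.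
have /eqmodP /asboolP h : repr (\pi_tens s) = s %[mod tens] by rewrite reprK.
exact: h.
Qed.

Lemma tens_ext (x y : tens) :
  (forall (G : lmodType K) (phi : M -> N -> G), bilin phi ->
     tens_lift phi x = tens_lift phi y) -> x = y.
Proof.
move=> h; rewrite -[x]reprK -[y]reprK; apply/eqmodP/asboolP => G phi hp.
exact: h.
Qed.

Definition tens0 : tens := \pi_tens [::].
Definition tens_add (x y : tens) : tens := \pi_tens (repr x ++ repr y).
Definition tens_scale (a : K) (x : tens) : tens :=
  \pi_tens [seq (a *: p.1, p.2) | p <- repr x].
Definition tens_opp (x : tens) : tens := tens_scale (-1) x.

Section Lift.
Variables (G : lmodType K) (phi : M -> N -> G).
Hypothesis hphi : bilin phi.

Lemma tens_lift0 : tens_lift phi tens0 = 0.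
Proof. by rewrite tens_lift_pi // /tsum big_nil. Qed.
Lemma tens_liftD x y :
  tens_lift phi (tens_add x y) = tens_lift phi x + tens_lift phi y.
Proof. by rewrite tens_lift_pi // /tsum big_cat. Qed.
Lemma tens_liftZ a x : tens_lift phi (tens_scale a x) = a *: tens_lift phi x.
Proof.
rewrite tens_lift_pi // /tsum big_map scaler_sumr; apply: eq_bigr => p _ /=.
by case: hphi => h _; rewrite (linZ (h _)).
Qed.
Lemma tens_liftN x : tens_lift phi (tens_opp x) = - tens_lift phi x.
Proof. by rewrite tens_liftZ scaleN1r. Qed.
End Lift.

Fact tens_addA : associative tens_add.
Proof. by move=> x y z; apply: tens_ext => G phi h; rewrite !tens_liftD // addrA. Qed.
Fact tens_addC : commutative tens_add.
Proof. by move=> x y; apply: tens_ext => G phi h; rewrite !tens_liftD // addrC. Qed.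
Fact tens_add0 : left_id tens0 tens_add.
Proof. by move=> x; apply: tens_ext => G phi h; rewrite tens_liftD // tens_lift0 // add0r. Qed.
Fact tens_addN : left_inverse tens0 tens_opp tens_add.
Proof.
by move=> x; apply: tens_ext => G phi h; rewrite tens_liftD // tens_liftN // tens_lift0 // addNr.
Qed.

HB.instance Definition _ :=
  GRing.isZmodule.Build tens tens_addA tens_addC tens_add0 tens_addN.

Fact tens_scaleA a b x : tens_scale a (tens_scale b x) = tens_scale (a * b) x.
Proof. by apply: tens_ext => G phi h; rewrite !tens_liftZ // scalerA. Qed.
Fact tens_scale1 : left_id 1 tens_scale.
Proof. by move=> x; apply: tens_ext => G phi h; rewrite !tens_liftZ // scale1r. Qed.
Fact tens_scaleDr : right_distributive tens_scale +%R.
Proof.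
move=> a x y; apply: tens_ext => G phi h.
by rewrite tens_liftZ // !tens_liftD // !tens_liftZ // scalerDr.
Qed.
Fact tens_scaleDl x : {morph tens_scale^~ x : a b / a + b}.
Proof.
move=> a b; apply: tens_ext => G phi h.
by rewrite tens_liftD // !tens_liftZ // scalerDl.
Qed.

HB.instance Definition _ := GRing.Zmodule_isLmodule.Build K tens
  tens_scaleA tens_scale1 tens_scaleDr tens_scaleDl.

Lemma tens_lift_linear (G : lmodType K) (phi : M -> N -> G) :
  bilin phi -> linear (tens_lift phi).
Proof. by move=> h a x y; rewrite tens_liftD // tens_liftZ. Qed.

Lemma tens_lift_pure (G : lmodType K) (phi : M -> N -> G) m n :
  bilin phi -> tens_lift phi (pure m n) = phi m n.
Proof. by move=> h; rewrite tens_lift_pi // /tsum big_seq1. Qed.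

Lemma pure_bilin : bilin pure.
Proof.
split=> [n a x y|m a x y]; apply: tens_ext => G phi h;
  rewrite tens_lift_linear // !tens_lift_pure //; case: h => h1 h2; first exact: h1.
exact: h2.
Qed.

Lemma tens_ind (P : tens -> Prop) :
  P 0 -> (forall x y, P x -> P y -> P (x + y)) -> (forall m n, P (pure m n)) ->
  forall x, P x.
Proof.
move=> h0 hD hp x; rewrite -[x]reprK; elim: (repr x) => [|[m n] s ih]; first exact: h0.
have -> : \pi_tens ((m, n) :: s) = pure m n + \pi_tens s.
  apply: tens_ext => G phi h; rewrite (linD (tens_lift_linear h)).
  by rewrite tens_lift_pure // !tens_lift_pi // /tsum big_cons.
exact: hD.
Qed.

End Tensor.

Section TensOp.
Variables (K : comNzRingType) (M N B C M' N' : lmodType K).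
Variables (al : M -> B -> M') (be : N -> C -> N').

(* (m (x) n, b (x) c) |-> al m b (x) be n c *)
Definition tens_op (x : tens M N) (y : tens B C) : tens M' N' :=
  tens_lift (fun m n => tens_lift (fun b c => pure (al m b) (be n c)) y) x.

Hypotheses (hal : bilin al) (hbe : bilin be).

Lemma tens_op_inner m n : bilin (fun b c => pure (al m b) (be n c)).
Proof.
case: (pure_bilin M' N') => h1 h2; case: hal => _ a2; case: hbe => _ b2.
by split=> [c a x y|b a x y] /=; rewrite ?a2 ?b2 ?h1 ?h2.
Qed.

Lemma tens_op_outer y :
  bilin (fun m n => tens_lift (fun b c => pure (al m b) (be n c)) y).
Proof.
case: (pure_bilin M' N') => h1 h2; case: hal => a1 _; case: hbe => b1 _.
split=> [n a x x'|m a x x'] /=; rewrite /tens_lift /tsum scaler_sumr -big_split /=;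
  by apply: eq_bigr => p _; rewrite ?a1 ?b1 ?h1 ?h2.
Qed.

Lemma tens_op_pure m n b c :
  tens_op (pure m n) (pure b c) = pure (al m b) (be n c).
Proof. by rewrite /tens_op (tens_lift_pure _ _ (tens_op_outer _)) (tens_lift_pure _ _ (tens_op_inner _ _)). Qed.

Lemma tens_op_bilin : bilin tens_op.
Proof.
split=> [y|x]; first exact: tens_lift_linear (tens_op_outer y).
move=> a y y'; rewrite /tens_op /(tens_lift _ x) /tsum scaler_sumr -big_split /=.
by apply: eq_bigr => p _; apply: (tens_lift_linear (tens_op_inner p.1 p.2)).
Qed.
End TensOp.

Lemma amul_bilin (K : comNzRingType) (B : ualgType K) : bilin (@amul K B).
Proof. by split; [exact: amul_linl|exact: amul_linr]. Qed.

Section TensAlg.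
Variables (K : comNzRingType) (B C : ualgType K).
Local Notation T := (tens B C).

Definition tens_mul : T -> T -> T := tens_op amul amul.
Definition tens_one : T := pure (aone B) (aone C).

Lemma tens_mul_bilin : bilin tens_mul.
Proof. exact: tens_op_bilin (amul_bilin B) (amul_bilin C). Qed.
Lemma tens_mul_pure b c b' c' :
  tens_mul (pure b c) (pure b' c') = pure (b *a b') (c *a c').
Proof. exact: tens_op_pure (amul_bilin B) (amul_bilin C) _ _ _ _. Qed.

Let mDl : left_distributive tens_mul +%R.
Proof. by move=> x y z; apply: (linD (tens_mul_bilin.1 z)). Qed.
Let mDr : right_distributive tens_mul +%R.
Proof. by move=> x y z; apply: (linD (tens_mul_bilin.2 x)). Qed.
Let m0l y : tens_mul 0 y = 0.
Proof. exact: (lin0 (tens_mul_bilin.1 y)). Qed.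
Let m0r y : tens_mul y 0 = 0.
Proof. exact: (lin0 (tens_mul_bilin.2 y)). Qed.
Fact tens_mulA : associative tens_mul.
Proof.
elim/tens_ind => [y z|x x' ih ih' y z|b c]; first by rewrite !m0l.
  by rewrite !mDl ih ih'.
elim/tens_ind => [z|x x' ih ih' z|b' c']; first by rewrite !m0l m0r m0l.
  by rewrite !(mDl, mDr) ih ih'.
elim/tens_ind => [|x x' ih ih'|b'' c'']; first by rewrite !m0r.
  by rewrite !mDr ih ih'.
by rewrite !tens_mul_pure !amulA.
Qed.
Fact tens_mul1l : left_id tens_one tens_mul.
Proof.
elim/tens_ind => [|x x' ih ih'|b c]; first by rewrite m0r.
  by rewrite mDr ih ih'.
by rewrite tens_mul_pure !amul1l.
Qed.
Fact tens_mul1r : right_id tens_one tens_mul.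
Proof.
elim/tens_ind => [|x x' ih ih'|b c]; first by rewrite m0l.
  by rewrite mDl ih ih'.
by rewrite tens_mul_pure !amul1r.
Qed.

HB.instance Definition _ := Lmodule_isUAlg.Build K T tens_mulA tens_mul1l
  tens_mul1r tens_mul_bilin.1 tens_mul_bilin.2.

Lemma tens_mulE b c b' c' :
  (pure b c : T) *a (pure b' c' : T) = pure (b *a b') (c *a c').
Proof. exact: tens_mul_pure. Qed.
End TensAlg.

Definition tens_map (K : comNzRingType) (M N M' N' : lmodType K)
    (f : M -> M') (g : N -> N') : tens M N -> tens M' N' :=
  tens_lift (fun m n => pure (f m) (g n)).

Section TensMap.
Variables (K : comNzRingType) (M N M' N' : lmodType K).
Variables (f : M -> M') (g : N -> N').
Hypotheses (hf : linear f) (hg : linear g).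

Lemma tens_map_bilin : bilin (fun m n => pure (f m) (g n)).
Proof.
case: (pure_bilin M' N') => h1 h2.
by split=> [n a x y|m a x y] /=; rewrite ?hf ?hg ?h1 ?h2.
Qed.
Lemma tens_map_linear : linear (tens_map f g).
Proof. exact: tens_lift_linear tens_map_bilin. Qed.
Lemma tens_map_pure m n : tens_map f g (pure m n) = pure (f m) (g n).
Proof. exact: tens_lift_pure tens_map_bilin. Qed.
End TensMap.

Section TensHom.
Variables (K : comNzRingType) (B C D : ualgType K).

Definition algHom_comp (g : algHom C D) (f : algHom B C) : algHom B D.
Proof.
apply: (@AlgHom _ _ _ (fun x => g (f x))) => [a x y||x y].
- by rewrite !ah_lin.
- by rewrite !ah_one.
- by rewrite !ah_mul.
Defined.

Definition tens_inl : algHom B (tens B C).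
Proof.
apply: (@AlgHom _ B (tens B C) (fun b : B => pure b (aone C))).
- exact: (pure_bilin B C).1.
- by [].
- by move=> x y; rewrite tens_mulE amul1l.
Defined.

Definition tens_inr : algHom C (tens B C).
Proof.
apply: (@AlgHom _ C (tens B C) (fun c : C => pure (aone B) c)).
- exact: (pure_bilin B C).2.
- by [].
- by move=> x y; rewrite tens_mulE amul1l.
Defined.

Section Prod.
Variables (f : algHom B D) (g : algHom C D).
Hypothesis fgC : forall b c, f b *a g c = g c *a f b.

Fact tens_prod_bilin : bilin (fun (b : B) (c : C) => f b *a g c).
Proof.
by split=> [c a x y|b a x y] /=; rewrite ah_lin ?amul_linl ?amul_linr.
Qed.

(* b (x) c |-> f b * g c *)
Definition tens_prod_fun : tens B C -> D :=
  tens_lift (fun (b : B) (c : C) => f b *a g c).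

Fact tens_prod_linear : linear tens_prod_fun.
Proof. exact: tens_lift_linear tens_prod_bilin. Qed.
Lemma tens_prod_pure b c : tens_prod_fun (pure b c) = f b *a g c.
Proof. exact: tens_lift_pure tens_prod_bilin. Qed.
Fact tens_prod_one : tens_prod_fun (aone (tens B C)) = aone D.
Proof. by rewrite [LHS]tens_prod_pure !ah_one amul1l. Qed.
Fact tens_prod_mul : {morph tens_prod_fun : x y / x *a y}.
Proof.
have L := tens_prod_linear.
have T := amul_bilin (tens B C); have U := amul_bilin D.
elim/tens_ind => [y|x x' ih ih' y|b c].
- by rewrite (lin0 (T.1 y)) (lin0 L) (lin0 (U.1 _)).
- by rewrite (linD (T.1 y)) !(linD L) (linD (U.1 _)) /= ih ih'.
elim/tens_ind => [|y y' ih ih'|b' c'].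
- by rewrite (lin0 (T.2 _)) (lin0 L) (lin0 (U.2 _)).
- by rewrite (linD (T.2 _)) !(linD L) (linD (U.2 _)) /= ih ih'.
rewrite tens_mulE !tens_prod_pure !ah_mul -!amulA; congr (_ *a _).
by rewrite !amulA fgC.
Qed.

Definition tens_prod : algHom (tens B C) D :=
  AlgHom tens_prod_linear tens_prod_one tens_prod_mul.
End Prod.
End TensHom.

(******************************************************************************)
(* Extension of scalars from a domain R to its field of fractions.            *)
(******************************************************************************)

Section Ext.
Variable R : idomainType.
Notation F := {fraction R}.

(* The fraction field seen as an R-algebra. *)
Definition fracR : Type := F.
HB.instance Definition _ := GRing.Field.copy fracR F.

Definition fracR_scale (a : R) (x : fracR) : fracR := (tofrac a : fracR) * x.
Fact fracR_scaleA a b x : fracR_scale a (fracR_scale b x) = fracR_scale (a * b) x.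
Proof. by rewrite /fracR_scale mulrA -tofracM. Qed.
Fact fracR_scale1 : left_id 1 fracR_scale.
Proof. by move=> x; rewrite /fracR_scale tofrac1 mul1r. Qed.
Fact fracR_scaleDr : right_distributive fracR_scale +%R.
Proof. by move=> a x y; rewrite /fracR_scale mulrDr. Qed.
Fact fracR_scaleDl x : {morph fracR_scale^~ x : a b / a + b}.
Proof. by move=> a b; rewrite /fracR_scale tofracD mulrDl. Qed.
HB.instance Definition _ := GRing.Zmodule_isLmodule.Build R fracR
  fracR_scaleA fracR_scale1 fracR_scaleDr fracR_scaleDl.

Fact fracR_linl (y : fracR) : linear ( *%R^~ y : fracR -> fracR).
Proof. by move=> a x x'; rewrite mulrDl -mulrA. Qed.
Fact fracR_linr (x : fracR) : linear ( *%R x : fracR -> fracR).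
Proof. by move=> a y y'; rewrite mulrDr mulrCA. Qed.
HB.instance Definition _ := Lmodule_isUAlg.Build R fracR
  (@mulrA _) (@mul1r _) (@mulr1 _) fracR_linl fracR_linr.

(* M (x)_R F as an F-vector space *)
Definition ext (M : lmodType R) : Type := tens M fracR.

Section ExtModule.
Variable M : lmodType R.
HB.instance Definition _ := GRing.Zmodule.copy (ext M) (tens M fracR).

Definition ext_scale (a : F) : ext M -> ext M :=
  @tens_map R M fracR M fracR idfun ( *%R (a : fracR)).

Let L a : linear (ext_scale a).
Proof. exact: tens_map_linear (fun _ _ _ => erefl) (fracR_linr a). Qed.
Let P a m x : ext_scale a (pure m x) = pure m ((a : fracR) * x).
Proof. exact: tens_map_pure (fun _ _ _ => erefl) (fracR_linr a) _ _. Qed.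

Fact ext_scaleA a b x : ext_scale a (ext_scale b x) = ext_scale (a * b) x.
Proof.
elim/tens_ind: x => [|x y ihx ihy|m n]; first by rewrite !(lin0 (L _)).
  by rewrite !(linD (L _)) ihx ihy.
by rewrite !P mulrA.
Qed.
Fact ext_scale1 : left_id 1 ext_scale.
Proof.
elim/tens_ind => [|x y ihx ihy|m n]; first by rewrite !(lin0 (L _)).
  by rewrite !(linD (L _)) ihx ihy.
by rewrite !P mul1r.
Qed.
Fact ext_scaleDr : right_distributive ext_scale +%R.
Proof. by move=> a x y; apply: (linD (L a)). Qed.
Fact ext_scaleDl x : {morph ext_scale^~ x : a b / a + b}.
Proof.
move=> a b; elim/tens_ind: x => [|x y ihx ihy|m n].
- by rewrite !(lin0 (L _)) [RHS]addr0.
- by rewrite !(linD (L _)) ihx ihy [LHS]addrACA.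
by rewrite !P mulrDl; apply: (linD ((pure_bilin M fracR).2 m)).
Qed.
HB.instance Definition _ := GRing.Zmodule_isLmodule.Build F (ext M)
  ext_scaleA ext_scale1 ext_scaleDr ext_scaleDl.

Definition epure (m : M) (a : F) : ext M := pure m (a : fracR).
Lemma ext_scale_pure (a b : F) m : a *: epure m b = epure m (a * b).
Proof. exact: P. Qed.
Lemma ext_ind (Q : ext M -> Prop) :
  Q 0 -> (forall x y, Q x -> Q y -> Q (x + y)) -> (forall m a, Q (epure m a)) ->
  forall x, Q x.
Proof. exact: tens_ind. Qed.
End ExtModule.

Section ExtOp.
Variables (M N P : lmodType R) (al : M -> N -> P).
Hypothesis hal : bilin al.

(* (m (x) a, n (x) b) |-> al m n (x) a b *)
Definition ext_op (x : ext M) (y : ext N) : ext P := 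
  @tens_op R M fracR N fracR P fracR al *%R x y.

Let B := tens_op_bilin hal (amul_bilin fracR).
Lemma ext_op_pure m a n b : ext_op (epure m a) (epure n b) = epure (al m n) (a * b).
Proof. exact: tens_op_pure hal (amul_bilin fracR) _ _ _ _. Qed.
Let opDl y : {morph ext_op^~ y : x x' / x + x'}.
Proof. exact: linD (B.1 y). Qed.
Let opDr x : {morph ext_op x : y y' / y + y'}.
Proof. exact: linD (B.2 x). Qed.
Let op0l y : ext_op 0 y = 0.
Proof. exact: lin0 (B.1 y). Qed.
Let op0r y : ext_op y 0 = 0.
Proof. exact: lin0 (B.2 y). Qed.

Lemma ext_op_bilin : bilin ext_op.
Proof.
have Zl a x y : ext_op (a *: x) y = a *: ext_op x y.
  elim/ext_ind: x => [|x x' ih ih'|m b].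
  - by rewrite scaler0 op0l scaler0.
  - by rewrite scalerDr !opDl ih ih' scalerDr.
  elim/ext_ind: y => [|y y' ih ih'|n c].
  - by rewrite !op0r scaler0.
  - by rewrite !opDr ih ih' scalerDr.
  by rewrite ext_scale_pure !ext_op_pure ext_scale_pure mulrA.
have Zr a x y : ext_op x (a *: y) = a *: ext_op x y.
  elim/ext_ind: x => [|x x' ih ih'|m b].
  - by rewrite !op0l scaler0.
  - by rewrite !opDl ih ih' scalerDr.
  elim/ext_ind: y => [|y y' ih ih'|n c].
  - by rewrite scaler0 op0r scaler0.
  - by rewrite scalerDr !opDr ih ih' scalerDr.
  by rewrite ext_scale_pure !ext_op_pure ext_scale_pure mulrCA.
by split=> [y a x x'|x a y y'] /=; rewrite ?opDl ?opDr ?Zl ?Zr.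
Qed.
End ExtOp.

Section ExtAlg.
Variables B : ualgType R.
Fact ext_mulA : associative (ext_op (@amul R B)).
Proof. exact: (@amulA R (tens B fracR)). Qed.
Fact ext_mul1l : left_id (epure (aone B) 1) (ext_op (@amul R B)).
Proof. exact: (@amul1l R (tens B fracR)). Qed.
Fact ext_mul1r : right_id (epure (aone B) 1) (ext_op (@amul R B)).
Proof. exact: (@amul1r R (tens B fracR)). Qed.
HB.instance Definition _ := Lmodule_isUAlg.Build F (ext B)
  ext_mulA ext_mul1l ext_mul1r
  (ext_op_bilin (amul_bilin B)).1 (ext_op_bilin (amul_bilin B)).2.
Lemma ext_mulE (b c : B) (x y : F) :
  epure b x *a epure c y = epure (b *a c) (x * y).
Proof. exact: ext_op_pure (amul_bilin B) _ _ _ _. Qed.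
End ExtAlg.

Section ExtMap.
Variables (M N : lmodType R) (f : M -> N).
Definition ext_map : ext M -> ext N := @tens_map R M fracR N fracR f idfun.
Hypothesis hf : linear f.
Lemma ext_map_pure m a : ext_map (epure m a) = epure (f m) a.
Proof. exact: tens_map_pure hf (fun _ _ _ => erefl) _ _. Qed.
Lemma ext_map_linear : linear ext_map.
Proof.
have L : linear (ext_map : tens M fracR -> tens N fracR).
  exact: tens_map_linear hf (fun _ _ _ => erefl).
have D : {morph ext_map : x y / x + y} := linD L.
have Z : ext_map 0 = 0 := lin0 L.
move=> a x y; rewrite D; congr (_ + _).
elim/ext_ind: x => [|x x' ih ih'|m b].
- by rewrite scaler0 Z scaler0.
- by rewrite scalerDr !D scalerDr ih ih'.
by rewrite ext_scale_pure !ext_map_pure ext_scale_pure.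
Qed.
End ExtMap.

Section ExtHom.
Variables (B C : ualgType R) (f : algHom B C).
Fact ext_hom_one : ext_map f (aone (ext B)) = aone (ext C).
Proof. by have := ext_map_pure (ah_lin f) (aone B) 1; rewrite ah_one. Qed.
Fact ext_hom_mul : {morph ext_map f : x y / x *a y}.
Proof.
have L := ext_map_linear (ah_lin f).
have T := amul_bilin (ext B); have U := amul_bilin (ext C).
elim/ext_ind => [y|x x' ih ih' y|b c].
- by rewrite (lin0 (T.1 y)) (lin0 L) (lin0 (U.1 _)).
- by rewrite (linD (T.1 y)) !(linD L) (linD (U.1 _)) /= ih ih'.
elim/ext_ind => [|y y' ih ih'|b' c'].
- by rewrite (lin0 (T.2 _)) (lin0 L) (lin0 (U.2 _)).
- by rewrite (linD (T.2 _)) !(linD L) (linD (U.2 _)) /= ih ih'.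
by rewrite ext_mulE !(ext_map_pure (ah_lin f)) ext_mulE ah_mul.
Qed.
Definition ext_hom : algHom (ext B) (ext C) :=
  AlgHom (ext_map_linear (ah_lin f)) ext_hom_one ext_hom_mul.
Lemma ext_hom_pure b a : ext_hom (epure b a) = epure (f b) a.
Proof. exact: ext_map_pure (ah_lin f) _ _. Qed.
End ExtHom.

Lemma ext_hom_comm (B C D : ualgType R) (f : algHom B D) (g : algHom C D) :
  (forall b c, f b *a g c = g c *a f b) ->
  forall x y, ext_hom f x *a ext_hom g y = ext_hom g y *a ext_hom f x.
Proof.
move=> h; have U := amul_bilin (ext D).
have L := ah_lin (ext_hom f); have L' := ah_lin (ext_hom g).
elim/ext_ind => [y|x x' ih ih' y|b c].
- by rewrite (lin0 L) (lin0 (U.1 _)) (lin0 (U.2 _)).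
- by rewrite (linD L) (linD (U.1 _)) (linD (U.2 _)) /= ih ih'.
elim/ext_ind => [|y y' ih ih'|b' c'].
- by rewrite (lin0 L') (lin0 (U.1 _)) (lin0 (U.2 _)).
- by rewrite (linD L') (linD (U.1 _)) (linD (U.2 _)) /= ih ih'.
by rewrite !ext_hom_pure !ext_mulE h mulrC.
Qed.
End Ext.

(******************************************************************************)
(* Subspaces, spans and quotients of modules over a commutative ring.         *)
(******************************************************************************)

Section Subspaces.
Variables (K : comNzRingType) (V : lmodType K).

Definition is_lsubspace (X : set V) : Prop :=
  X 0 /\ forall (a : K) x y, X x -> X y -> X (a *: x + y).

Record lsubspace := LSubspace { ss_set :> V -> Prop; ss_P : is_lsubspace ss_set }.

Definition lspan_set (S : set V) : set V := fun x =>
  exists (n : nat) (a : 'I_n -> K) (v : 'I_n -> V),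
    (forall i, S (v i)) /\ x = \sum_(i < n) a i *: v i.

Fact lspan_is_lsubspace S : is_lsubspace (lspan_set S).
Proof.
split=> [|a _ _ [n [c [v [hv ->]]]] [m [d [w [hw ->]]]]].
  by exists 0%N, (fun=> 0), (fun=> 0); split=> [[]//|]; rewrite big_ord0.
exists (n + m)%N,
  (fun i => match fintype.split i with inl j => a * c j | inr j => d j end),
  (fun i => match fintype.split i with inl j => v j | inr j => w j end).
split=> [i|]; first by case: (fintype.split i).
rewrite big_split_ord scaler_sumr /=; congr (_ + _); apply: eq_bigr => i _.
  by rewrite (unsplitK (inl i)) scalerA.
by rewrite (unsplitK (inr i)).
Qed.

Definition lspan (S : set V) : lsubspace := LSubspace (lspan_is_lsubspace S).

Variable X : lsubspace.

Definition ss_pred : {pred V} := fun x => `[< X x >].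
Fact ss_pred_closed : submod_closed ss_pred.
Proof.
case: (ss_P X) => h0 hX; split; first exact/asboolP.
by move=> a x y /asboolP hx /asboolP hy; apply/asboolP/hX.
Qed.
HB.instance Definition _ := GRing.isSubmodClosed.Build K V ss_pred ss_pred_closed.

Definition sub_lmod : Type := {x : V | x \in ss_pred}.
HB.instance Definition _ := SubChoice.on sub_lmod.
HB.instance Definition _ := [SubChoice_isSubLmodule of sub_lmod by <:].

Definition quo_lmod : Type := Quotient.quot ss_pred.
HB.instance Definition _ := GRing.Zmodule.on quo_lmod.
HB.instance Definition _ := EqQuotient.on quo_lmod.

Definition quo_pi (x : V) : quo_lmod := \pi_(Quotient.quot ss_pred) x.

Lemma quo_piD : {morph quo_pi : x y / x + y}.
Proof. by move=> x y; rewrite /quo_pi -[RHS]Quotient.pi_add. Qed.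

Lemma quo_pi_eq x y : quo_pi x = quo_pi y <-> X (x - y).
Proof.
split=> [/eqP|h]; first by rewrite -Quotient.idealrBE => /asboolP.
by apply/eqP; rewrite -Quotient.idealrBE; apply/asboolP.
Qed.

Lemma quo_piK (q : quo_lmod) : quo_pi (repr q) = q.
Proof. exact: reprK. Qed.

Definition quo_scale (a : K) (q : quo_lmod) : quo_lmod := quo_pi (a *: repr q).

Lemma quo_scale_pi a x : quo_scale a (quo_pi x) = quo_pi (a *: x).
Proof.
apply/quo_pi_eq; rewrite -scalerBr.
have /quo_pi_eq h : quo_pi (repr (quo_pi x)) = quo_pi x by rewrite quo_piK.
by case: (ss_P X) => h0 hX; rewrite -[_ *: _]addr0; apply: hX.
Qed.

Fact quo_scaleA a b q : quo_scale a (quo_scale b q) = quo_scale (a * b) q.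
Proof. by rewrite -[q]quo_piK !quo_scale_pi scalerA. Qed.
Fact quo_scale1 : left_id 1 quo_scale.
Proof. by move=> q; rewrite -[q]quo_piK quo_scale_pi scale1r. Qed.
Fact quo_scaleDr : right_distributive quo_scale +%R.
Proof.
move=> a p q; rewrite -[p]quo_piK -[q]quo_piK -quo_piD !quo_scale_pi.
by rewrite scalerDr quo_piD.
Qed.
Fact quo_scaleDl q : {morph quo_scale^~ q : a b / a + b}.
Proof. by move=> a b; rewrite -[q]quo_piK !quo_scale_pi scalerDl quo_piD. Qed.
HB.instance Definition _ := GRing.Zmodule_isLmodule.Build K quo_lmod
  quo_scaleA quo_scale1 quo_scaleDr quo_scaleDl.

Lemma quo_pi_linear : linear quo_pi.
Proof. by move=> a x y; rewrite quo_piD -quo_scale_pi. Qed.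
End Subspaces.

(******************************************************************************)
(* Right modules over a K-algebra. Bilinearity of the action makes the        *)
(* K-module structure of the carrier the one induced by the algebra.          *)
(******************************************************************************)

Record rmod (K : comNzRingType) (B : ualgType K) := RMod {
  rm_car :> lmodType K;
  ract : rm_car -> B -> rm_car;
  ract_bilin : bilin ract;
  ract1 : forall x, ract x (aone B) = x;
  ractM : forall x b c, ract x (b *a c) = ract (ract x b) c
}.
Infix "*r" := ract (at level 40, left associativity).

Section RMod.
Variables (K : comNzRingType) (B : ualgType K).

Definition reg_rmod : rmod B :=
  @RMod K B B amul (amul_bilin B) (@amul1r K B) (@amulA K B).

Section Res.
Variables (C : ualgType K) (f : algHom C B) (M : rmod B).
Let act (x : M) (c : C) : M := x *r f c.
Fact res_bilin : bilin act.
Proof.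
case: (ract_bilin M) => h1 h2.
by split=> [c a x y|x a c c']; rewrite /act ?ah_lin ?h1 ?h2.
Qed.
Fact res1 x : act x (aone C) = x.
Proof. by rewrite /act ah_one ract1. Qed.
Fact resM x b c : act x (b *a c) = act (act x b) c.
Proof. by rewrite /act ah_mul ractM. Qed.
Definition res_rmod : rmod C := RMod res_bilin res1 resM.
End Res.

Definition is_submod (M : rmod B) (X : set M) : Prop :=
  is_lsubspace X /\ forall x b, X x -> X (x *r b).

Record submod (M : rmod B) := Submod { sm_set :> M -> Prop; sm_P : is_submod sm_set }.
Definition sm_space (M : rmod B) (X : submod M) : lsubspace M := LSubspace (sm_P X).1.

Section SubMod.
Variables (M : rmod B) (X : submod M).
Local Notation S := (sub_lmod (sm_space X)).

Fact sub_act_subproof (x : S) b : val x *r b \in ss_pred (sm_space X).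
Proof.
apply/asboolP; apply: (sm_P X).2.
by case: x => x /= /asboolP.
Qed.
Definition sub_act (x : S) (b : B) : S := Sub (val x *r b) (sub_act_subproof x b).
Fact sub_act_bilin : bilin sub_act.
Proof.
case: (ract_bilin M) => h1 h2.
by split=> [b a x y|x a b c]; apply: val_inj => /=; rewrite ?h1 ?h2.
Qed.
Fact sub_act1 x : sub_act x (aone B) = x.
Proof. by apply: val_inj; rewrite /= ract1. Qed.
Fact sub_actM x b c : sub_act x (b *a c) = sub_act (sub_act x b) c.
Proof. by apply: val_inj; rewrite /= ractM. Qed.
Definition sub_rmod : rmod B := RMod sub_act_bilin sub_act1 sub_actM.

Local Notation Q := (quo_lmod (sm_space X)).
Local Notation pi := (@quo_pi K M (sm_space X)).
Definition quo_act (q : Q) (b : B) : Q := pi (repr q *r b).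
Lemma quo_act_pi x b : quo_act (pi x) b = pi (x *r b).
Proof.
apply/quo_pi_eq.
have /quo_pi_eq h : pi (repr (pi x)) = pi x by rewrite quo_piK.
rewrite -(linN ((ract_bilin M).1 b)) -(linD ((ract_bilin M).1 b)).
exact: (sm_P X).2.
Qed.
Fact quo_act_bilin : bilin quo_act.
Proof.
case: (ract_bilin M) => h1 h2.
split=> [b a x y|x a b c].
  rewrite -[x]quo_piK -[y]quo_piK; set x' := repr x; set y' := repr y.
  have -> : a *: pi x' + pi y' = pi (a *: x' + y') by rewrite quo_pi_linear.
  by rewrite !quo_act_pi -quo_pi_linear -[in RHS]h1.
rewrite -[x]quo_piK; set x' := repr x.
by rewrite !quo_act_pi -quo_pi_linear -h2.
Qed.
Fact quo_act1 x : quo_act x (aone B) = x.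
Proof. by rewrite -[x]quo_piK quo_act_pi ract1. Qed.
Fact quo_actM x b c : quo_act x (b *a c) = quo_act (quo_act x b) c.
Proof. by rewrite -[x]quo_piK !quo_act_pi ractM. Qed.
Definition quo_rmod : rmod B := RMod quo_act_bilin quo_act1 quo_actM.
End SubMod.

(* X / (X n Y) *)
Fact meet_is_submod (M : rmod B) (X Y : submod M) :
  @is_submod (sub_rmod X) (fun x => Y (val x)).
Proof.
case: (sm_P Y) => [[h0 h1] h2].
by split; [split=> [|a x y]; [exact: h0|exact: h1]|move=> x b; exact: h2].
Qed.
Definition subquo (M : rmod B) (X Y : submod M) : rmod B :=
  quo_rmod (Submod (meet_is_submod X Y)).

Fact zero_is_submod (M : rmod B) : @is_submod M (fun x => x = 0).
Proof.
split; first by split=> // a _ _ -> ->; rewrite scaler0 addr0.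
by move=> _ b ->; exact: (lin0 ((ract_bilin M).1 b)).
Qed.
Definition zero_rmod : rmod B := sub_rmod (Submod (zero_is_submod reg_rmod)).

(* The submodule generated by a set *)
Fact gen_is_submod (M : rmod B) (S : set M) :
  is_submod (fun x => forall X : submod M, S `<=` X -> X x).
Proof.
split; first split.
- by move=> X _; case: (sm_P X) => -[].
- by move=> a x y hx hy X hS; case: (sm_P X) => -[_ h] _; apply: h; [apply: hx|apply: hy].
- by move=> x b hx X hS; apply: (sm_P X).2; apply: hx.
Qed.
Definition gen_submod (M : rmod B) (S : set M) : submod M :=
  Submod (gen_is_submod S).

(* The image of span(S) in M / span(T), with the action of B inherited from M. *)
(* The action exists when span(T) and span(S u T) are stable under B; the zero *)
(* module is a default value for the other cases.                             *)
Definition spans_stable (M : rmod B) (S T : set M) : Prop :=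
  is_submod (lspan (S `|` T)) /\ is_submod (lspan T).
Definition span_quo (M : rmod B) (S T : set M) : rmod B :=
  match pselect (spans_stable S T) with
  | left h => subquo (Submod h.1) (Submod h.2)
  | right _ => zero_rmod
  end.

Definition is_rhom (M N : rmod B) (f : M -> N) : Prop :=
  linear f /\ forall x b, f (x *r b) = f x *r b.

Definition rmod_iso (M N : rmod B) : Prop :=
  exists2 f : M -> N, is_rhom f & bijective f.

Definition cyclic_rmod (M : rmod B) : Prop :=
  exists x : M, forall y : M, exists b : B, y = x *r b.

(* Hom_B(M, N) as a K-module *)
Section Hom.
Variables M N : rmod B.
Definition rhom_pred : {pred M -> N} := fun f => `[< is_rhom f >].
Fact rhom_closed : submod_closed rhom_pred.
Proof.
split.
  have E z : (0 : M -> N) z = 0 by [].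
  apply/asboolP; split=> [a x y|x b]; rewrite !E ?scaler0 ?addr0 //.
  by rewrite (lin0 ((ract_bilin N).1 b)).
move=> c f g /asboolP[f1 f2] /asboolP[g1 g2].
have E z : (c *: f + g) z = c *: f z + g z by [].
apply/asboolP; split=> [a x y|x b]; rewrite !E.
  rewrite f1 g1 !scalerDr !scalerA -!addrA [c * a]mulrC; congr (_ + _).
  by rewrite addrCA.
by rewrite f2 g2 (ract_bilin N).1.
Qed.
HB.instance Definition _ := GRing.isSubmodClosed.Build K _ rhom_pred rhom_closed.
Definition rhom : Type := {f : M -> N | f \in rhom_pred}.
HB.instance Definition _ := SubChoice.on rhom.
HB.instance Definition _ := [SubChoice_isSubLmodule of rhom by <:].
End Hom.

End RMod.

(******************************************************************************)
(* Extension of scalars, outer tensor products and induction of right modules *)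
(******************************************************************************)

Section ExtRMod.
Variables (R : idomainType) (B : ualgType R) (M : rmod B).
Let act : ext M -> ext B -> ext M := ext_op (@ract R B M).
Let P m a b c : act (epure m a) (epure b c) = epure (m *r b) (a * c).
Proof. exact: ext_op_pure (ract_bilin M) _ _ _ _. Qed.
Fact ext_rmod_bilin : bilin act.
Proof. exact: ext_op_bilin (ract_bilin M). Qed.
Fact ext_rmod1 x : act x (aone (ext B)) = x.
Proof.
have [L _] := ext_rmod_bilin.
elim/ext_ind: x => [|x y hx hy|m a]; first exact: (lin0 (L _)).
  by rewrite (linD (L _)) hx hy.
by rewrite P ract1 mulr1.
Qed.
Fact ext_rmodM x b c : act x (b *a c) = act (act x b) c.
Proof.
have [L1 L2] := ext_rmod_bilin; have [A1 A2] := amul_bilin (ext B).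
elim/ext_ind: x b c => [b c|x y hx hy b c|m a]; first by rewrite !(lin0 (L1 _)).
  by rewrite !(linD (L1 _)) hx hy.
elim/ext_ind => [c|x y hx hy c|b a'].
- by rewrite (lin0 (A1 _)) !(lin0 (L2 _)) (lin0 (L1 _)).
- by rewrite (linD (A1 _)) !(linD (L2 _)) (linD (L1 _)) hx hy.
elim/ext_ind => [|x y hx hy|c a''].
- by rewrite (lin0 (A2 _)) !(lin0 (L2 _)).
- by rewrite (linD (A2 _)) !(linD (L2 _)) hx hy.
by rewrite ext_mulE !P ractM mulrA.
Qed.
Definition ext_rmod : rmod (ext B) := RMod ext_rmod_bilin ext_rmod1 ext_rmodM.
End ExtRMod.

Section Box.
Variables (K : comNzRingType) (B C : ualgType K) (M : rmod B) (N : rmod C).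
Let act : tens M N -> tens B C -> tens M N := tens_op (@ract K B M) (@ract K C N).
Let P m n b c : act (pure m n) (pure b c) = pure (m *r b) (n *r c).
Proof. exact: tens_op_pure (ract_bilin M) (ract_bilin N) _ _ _ _. Qed.
Fact box_bilin : bilin act.
Proof. exact: tens_op_bilin (ract_bilin M) (ract_bilin N). Qed.
Fact box1 x : act x (aone (tens B C)) = x.
Proof.
have [L _] := box_bilin.
elim/tens_ind: x => [|x y hx hy|m a]; first exact: (lin0 (L _)).
  by rewrite (linD (L _)) hx hy.
by rewrite P !ract1.
Qed.
Fact boxM x b c : act x (b *a c) = act (act x b) c.
Proof.
have [L1 L2] := box_bilin; have [A1 A2] := amul_bilin (tens B C).
elim/tens_ind: x b c => [b c|x y hx hy b c|m a]; first by rewrite !(lin0 (L1 _)).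
  by rewrite !(linD (L1 _)) hx hy.
elim/tens_ind => [c|x y hx hy c|b a'].
- by rewrite (lin0 (A1 _)) !(lin0 (L2 _)) (lin0 (L1 _)).
- by rewrite (linD (A1 _)) !(linD (L2 _)) (linD (L1 _)) hx hy.
elim/tens_ind => [|x y hx hy|c a''].
- by rewrite (lin0 (A2 _)) !(lin0 (L2 _)).
- by rewrite (linD (A2 _)) !(linD (L2 _)) hx hy.
by rewrite tens_mulE !P !ractM.
Qed.
Definition box_rmod : rmod (tens B C) := RMod box_bilin box1 boxM.
End Box.

Section Ind.
Variables (K : comNzRingType) (B C : ualgType K) (f : algHom B C) (M : rmod B).

(* M (x)_K C as a right C-module *)
Let act (x : tens M C) (c : C) : tens M C := tens_map idfun (amul^~ c) x.
Let L c : linear (act^~ c).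
Proof. exact: tens_map_linear (fun _ _ _ => erefl) (amul_linl c). Qed.
Let P m c c' : act (pure m c) c' = pure m (c *a c').
Proof. exact: tens_map_pure (fun _ _ _ => erefl) (amul_linl c') _ _. Qed.
Fact tensr_bilin : bilin act.
Proof.
split=> [|x a b c]; first exact: L.
elim/tens_ind: x => [|x y hx hy|m d]; first by rewrite !(lin0 (L _)) scaler0 addr0.
  by rewrite !(linD (L _)) hx hy scalerDr addrACA.
by rewrite !P amul_linr (pure_bilin M C).2.
Qed.
Fact tensr1 x : act x (aone C) = x.
Proof.
elim/tens_ind: x => [|x y hx hy|m d]; first by rewrite !(lin0 (L _)).
  by rewrite !(linD (L _)) hx hy.
by rewrite P amul1r.
Qed.
Fact tensrM x b c : act x (b *a c) = act (act x b) c.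
Proof.
elim/tens_ind: x => [|x y hx hy|m d]; first by rewrite !(lin0 (L _)).
  by rewrite !(linD (L _)) hx hy.
by rewrite !P amulA.
Qed.
Definition tensr : rmod C := RMod tensr_bilin tensr1 tensrM.

(* M (x)_B C *)
Definition ind_rmod : rmod C :=
  quo_rmod (gen_submod (fun x : tensr =>
    exists m b c, x = pure (m *r b) c - pure m (f b *a c))).
End Ind.

(******************************************************************************)
(* Cellular algebras                                                          *)
(******************************************************************************)

Definition is_basis (K : comNzRingType) (V : lmodType K) (I : finType)
    (v : I -> V) : Prop :=
  forall x, exists! a : {ffun I -> K}, x = \sum_i a i *: v i.

(* B is a finite product of matrix algebras over K *)
Definition split_semisimple (K : fieldType) (B : ualgType K) : Prop :=
  exists (n : nat) (d : 'I_n -> nat) (f : forall i, B -> 'M[K]_((d i).+1)),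
    [/\ forall i, linear (f i),
        forall i, f i (aone B) = 1,
        forall i x y, f i (x *a y) = f i x * f i y
      & forall y : (forall i, 'M[K]_((d i).+1)), exists! x, forall i, f i x = y i].

Record cell_datum (K : comNzRingType) (B : ualgType K) := CellDatum {
  cd_disp : Order.disp_t;
  cd_lam : finPOrderType cd_disp;
  cd_std : cd_lam -> finType;
  cd_c : forall l, cd_std l -> cd_std l -> B
}.

Section Cellular.
Variables (K : comNzRingType) (B : ualgType K) (C : cell_datum B).

Definition cd_gt (l : cd_lam C) : set B := fun x =>
  exists m (p q : cd_std m), (l < m)%O /\ x = cd_c p q.
Definition cd_ge (l : cd_lam C) : set B := fun x =>
  exists m (p q : cd_std m), (l <= m)%O /\ x = cd_c p q.

Definition is_cellular (star : B -> B) : Prop :=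
  [/\ is_basis (fun i : {l : cd_lam C & (cd_std l * cd_std l)%type} =>
                  cd_c (tagged i).1 (tagged i).2),
      forall (l : cd_lam C) (t : cd_std l) (a : B), exists r : cd_std l -> K,
        forall s : cd_std l,
          lspan (cd_gt l) (cd_c s t *a a - \sum_v r v *: cd_c s v)
    & forall (l : cd_lam C) (s t : cd_std l), star (cd_c s t) = cd_c t s].

(* Right module with basis c_st + A^(> l), for t in Std(l); the fixed first   *)
(* index s is the one returned by [pick].                                     *)
Definition cell_mod (l : cd_lam C) : rmod B :=
  @span_quo K B (reg_rmod B)
    (fun x => exists s t : cd_std l, [pick s : cd_std l] = Some s /\ x = cd_c s t)
    (cd_gt l).

(* Order preserving cell-filtrations; ls lists the labels of the subquotients *)
(* X 1 / X 0, X 2 / X 1, etc *)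
Definition cell_filtration (M : rmod B) (ls : seq (cd_lam C)) : Prop :=
  exists X : nat -> submod M,
    [/\ forall x, X 0%N x <-> x = 0,
        forall x, X (size ls) x,
        forall i, (i < size ls)%N -> forall x, X i x -> X i.+1 x,
        forall i : 'I_(size ls),
          rmod_iso (subquo (X i.+1) (X i)) (cell_mod (tnth (in_tuple ls) i))
      & sorted (fun l m => (m < l)%O) ls].
End Cellular.

(******************************************************************************)
(* Towers: an algebra with involution that is the union of an increasing      *)
(* sequence of subalgebras stable under the involution, the first one being R *)
(******************************************************************************)

Record tower (R : idomainType) := Tower {
  tw_amb :> algType R;
  tw_lev : nat -> set tw_amb;
  tw_1 : forall k, tw_lev k 1;
  tw_lin : forall k (a : R) x y, tw_lev k x -> tw_lev k y -> tw_lev k (a *: x + y);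
  tw_mul : forall k x y, tw_lev k x -> tw_lev k y -> tw_lev k (x * y);
  tw_inc : forall k x, tw_lev k x -> tw_lev k.+1 x;
  tw_union : forall x, exists k, tw_lev k x;
  tw_0 : forall x, tw_lev 0%N x <-> exists a : R, x = a%:A;
  tw_0inj : injective (fun a : R => a%:A : tw_amb);
  tw_star : tw_amb -> tw_amb;
  tw_star_linear : linear tw_star;
  tw_starM : forall x y, tw_star (x * y) = tw_star y * tw_star x;
  tw_starK : involutive tw_star;
  tw_star_lev : forall k x, tw_lev k x -> tw_lev k (tw_star x)
}.

Section Levels.
Variables (R : idomainType) (T : tower R).

Section Level.
Variable k : nat.
Definition lev_pred : {pred T} := fun x => `[< tw_lev k x >].
Fact lev_pred_closed : subalg_closed lev_pred.
Proof.
split; first exact/asboolP/tw_1.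
  by move=> a x y /asboolP hx /asboolP hy; apply/asboolP/tw_lin.
by move=> x y /asboolP hx /asboolP hy; apply/asboolP/tw_mul.
Qed.
HB.instance Definition _ := GRing.isSubalgClosed.Build R T lev_pred lev_pred_closed.

Definition lev : Type := {x : T | x \in lev_pred}.
HB.instance Definition _ := SubChoice.on lev.
HB.instance Definition _ := [SubChoice_isSubAlgebra of lev by <:].

Fact lev_linl (y : lev) : linear (fun x : lev => x * y).
Proof. by move=> a x x'; rewrite mulrDl scalerAl. Qed.
Fact lev_linr (x : lev) : linear (fun y : lev => x * y).
Proof. by move=> a y y'; rewrite mulrDr scalerAr. Qed.
HB.instance Definition _ := Lmodule_isUAlg.Build R lev
  (@mulrA _) (@mul1r _) (@mulr1 _) lev_linl lev_linr.

(* x as an element of the k-th algebra, for x in that algebra *)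
Definition to_lev (x : T) : lev := insubd (0 : lev) x.

Definition lev_star (x : lev) : lev := to_lev (tw_star (val x)).
End Level.

Fact lev_incl_subproof k (x : lev k) : val x \in lev_pred k.+1.
Proof. by case: x => x /= /asboolP hx; apply/asboolP/tw_inc. Qed.
Definition lev_incl_fun k (x : lev k) : lev k.+1 :=
  Sub (val x) (lev_incl_subproof x).
Fact lev_incl_linear k : linear (@lev_incl_fun k).
Proof. by move=> a x y; apply: val_inj. Qed.
Fact lev_incl_one k : lev_incl_fun (aone (lev k)) = aone (lev k.+1).
Proof. exact: val_inj. Qed.
Fact lev_incl_mul k : {morph @lev_incl_fun k : x y / x *a y}.
Proof. by move=> x y; apply: val_inj. Qed.
Definition lev_incl k : algHom (lev k) (lev k.+1) :=
  AlgHom (@lev_incl_linear k) (lev_incl_one k) (@lev_incl_mul k).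

Definition strongly_coherent (C : forall k, cell_datum (lev k)) : Prop :=
  [/\ forall k, is_cellular (C k) (@lev_star k),
      forall k (l : cd_lam (C k)), cyclic_rmod (cell_mod l),
      forall k (l : cd_lam (C k)), exists ls : seq (cd_lam (C k.+1)),
        cell_filtration (ind_rmod (lev_incl k) (cell_mod l)) ls
    & forall k (m : cd_lam (C k.+1)), exists ls : seq (cd_lam (C k)),
        cell_filtration (res_rmod (lev_incl k) (cell_mod m)) ls].

(* Edges of the branching graph *)
Definition branch (C : forall k, cell_datum (lev k)) k
    (l : cd_lam (C k)) (m : cd_lam (C k.+1)) : bool :=
  `[< exists2 ls : seq (cd_lam (C k)),
        cell_filtration (res_rmod (lev_incl k) (cell_mod m)) ls & l \in ls >].
End Levels.

(******************************************************************************)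
(* Towers of diagram algebras. The element e k is meaningful for k > 0, so    *)
(* conditions on levels k >= 1 (k >= 2) are stated with k.+1 (k.+2) for k.    *)
(* A 0 = H 0 = R is part of the definition of a tower.                        *)
(******************************************************************************)

Section DiagramTower.
Variables (R : idomainType) (A H : tower R) (e : nat -> A).

(* The ideal A_(k+2) e_(k+1) A_(k+2) of A_(k+2) *)
Definition e_ideal k : lsubspace (lev A k.+2) :=
  lspan (fun x => exists a b : lev A k.+2, val x = val a * e k.+1 * val b).

Record diagram_tower : Prop := DiagramTower {
  dt_A1 : exists f : algHom (lev A 1) (lev H 1),
    bijective f /\ forall x, f (lev_star x) = lev_star (f x);
  dt_e_lev : forall k, tw_lev k.+2 (e k.+1);
  dt_e_star : forall k, tw_star (e k.+1) = e k.+1;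
  dt_e_sq : forall k, exists2 delta : R, delta != 0 &
    e k.+1 * e k.+1 = delta *: e k.+1;
  (* the quotient algebra by the ideal is H_(k+2), as algebra with involution *)
  dt_quo : forall k, exists f : quo_lmod (e_ideal k) -> lev H k.+2,
    [/\ linear f, bijective f,
        f (quo_pi (e_ideal k) 1) = 1,
        forall x y, f (quo_pi (e_ideal k) (x * y)) =
          f (quo_pi (e_ideal k) x) * f (quo_pi (e_ideal k) y)
      & forall x, f (quo_pi (e_ideal k) (lev_star x)) =
          lev_star (f (quo_pi (e_ideal k) x))];
  dt_e_comm : forall k x, tw_lev k x -> e k.+1 * x = x * e k.+1;
  dt_eAe : forall k x, tw_lev k.+1 x ->
    exists2 y, tw_lev k y & e k.+1 * x * e k.+1 = y * e k.+1;
  dt_Ae : forall k,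
    [set x * e k.+1 | x in @tw_lev R A k.+2] = [set x * e k.+1 | x in @tw_lev R A k.+1];
  dt_Ae_inj : forall k x y, tw_lev k.+1 x -> tw_lev k.+1 y ->
    x * e k.+1 = y * e k.+1 -> x = y;
  dt_AeA : forall k, lspan (fun x => exists a b,
    [/\ tw_lev k.+3 a, tw_lev k.+3 b & x = a * e k.+2 * b]) (e k.+1);
  dt_H : exists C : (forall k, cell_datum (lev H k)), strongly_coherent C;
  dt_eAeA : forall k x,
    lspan (fun y => exists a b, [/\ tw_lev k.+2 a, tw_lev k.+2 b &
                                   y = e k.+1 * a * e k.+1 * b]) x <->
    exists2 a, tw_lev k.+2 a & x = e k.+1 * a;
  dt_split : forall k, split_semisimple (ext (lev A k))
}.
End DiagramTower.

Section JucysMurphy.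
Variables (R : idomainType) (A : tower R) (C : forall k, cell_datum (lev A k)).

Definition acts_by_scalar k (x : A) (l : cd_lam (C k)) : Prop :=
  exists d : R, forall v : cell_mod l, v *r to_lev k x = d *: v.

(* L k is meaningful for k > 0 *)
Definition additive_JM (L : nat -> A) : Prop :=
  forall k (l : cd_lam (C k)), acts_by_scalar (\sum_(1 <= i < k.+1) L i) l.

Definition multiplicative_JM (L : nat -> A) : Prop :=
  (forall k, exists2 y, tw_lev k.+1 y & L k.+1 * y = 1 /\ y * L k.+1 = 1) /\
  forall k (l : cd_lam (C k)), acts_by_scalar (\prod_(1 <= i < k.+1) L i) l.

Definition JM_family (L : nat -> A) : Prop :=
  [/\ forall k, tw_lev k.+1 (L k.+1),
      forall k, tw_star (L k.+1) = L k.+1,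
      forall k x, tw_lev k x -> L k.+1 * x = x * L k.+1
    & additive_JM L \/ multiplicative_JM L].
End JucysMurphy.

(* The inclusions A_m x A_s = A_(s, s + m) in A_(s + m) *)
Record tensor_embedding (R : idomainType) (A : tower R) := TensorEmbedding {
  te_hom : forall m s, algHom (tens (lev A m) (lev A s)) (lev A (s + m)%N);
  te_inj : forall m s, injective (te_hom m s);
  te_incl : forall m s (a : lev A m), val (te_hom m s (pure a (aone _))) = val a
}.

(******************************************************************************)
(* Paths in a graded graph with vertex set X k on level k                     *)
(******************************************************************************)

Section Paths.
Variables (dX : nat -> Order.disp_t) (X : forall k, finPOrderType (dX k)).
Variables (E : forall k, X k -> X k.+1 -> bool) (n : nat).

Definition vseq := {dffun forall i : 'I_n.+1, X i}.

Definition vsrc (t : vseq) (i : 'I_n) : X i := t (widen_ord (leqnSn n) i).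
Definition vtgt (t : vseq) (i : 'I_n) : X i.+1 := t (lift ord0 i).

Definition is_path (t : vseq) : bool := [forall i : 'I_n, E (vsrc t i) (vtgt t i)].

Definition dominates (s t : vseq) : Prop := forall i, (t i <= s i)%O.

(* products of edge weights along a path, first edge leftmost resp. rightmost *)
Section Weights.
Variables (S : pzRingType) (w : forall k, X k -> X k.+1 -> S).
Definition prod_up (t : vseq) : S := \prod_(i < n) w (vsrc t i) (vtgt t i).
Definition prod_down (t : vseq) : S :=
  \prod_(i <- rev (enum 'I_n)) w (vsrc t i) (vtgt t i).
End Weights.
End Paths.
Arguments dominates {dX} X {n} s t.
Arguments prod_up {dX} X {n S} w t.
Arguments prod_down {dX} X {n S} w t.

Section Tableaux.
Variables (R : idomainType) (A : tower R) (C : forall k, cell_datum (lev A k)).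

Definition Std r (nu : cd_lam (C r)) : finType :=
  {t : vseq (fun k => cd_lam (C k)) r |
    is_path (@branch R A C) t && (t ord_max == nu)}.

(* paths of length s from level m to level s + m *)
Definition sStd m s (la : cd_lam (C m)) (nu : cd_lam (C (s + m)%N)) : finType :=
  {t : vseq (fun k => cd_lam (C (k + m)%N)) s |
    [&& is_path (fun k => @branch R A C (k + m)%N) t, t ord0 == la & t ord_max == nu]}.

Definition maximal_path r (nu : cd_lam (C r)) (t : Std nu) : Prop :=
  forall s : Std nu, dominates (fun k => cd_lam (C k)) (val s) (val t) -> s = t.

Fact level_lt m s : (m < (s + m)%N.+1)%N.
Proof. by rewrite ltnS leq_addl. Qed.
Definition at_level m s (nu : cd_lam (C (s + m)%N)) (t : Std nu) : cd_lam (C m) :=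
  val t (Ordinal (level_lt m s)).

(* branching coefficients; only their values on edges matter *)
Definition coeffs := forall k, cd_lam (C k) -> cd_lam (C k.+1) -> lev A k.+1.
Variables d u : coeffs.

Definition d_path r (nu : cd_lam (C r)) (t : Std nu) : A :=
  prod_up (fun k => cd_lam (C k)) (fun k l l' => val (@d k l l')) (val t).
Definition u_path r (nu : cd_lam (C r)) (t : Std nu) : A :=
  prod_down (fun k => cd_lam (C k)) (fun k l l' => val (@u k l l')) (val t).
Definition u_skew m s (la : cd_lam (C m)) (nu : cd_lam (C (s + m)%N))
    (t : sStd la nu) : A :=
  prod_down (fun k => cd_lam (C (k + m)%N)) (fun k l l' => val (@u (k + m)%N l l')) (val t).

Definition murphy_datum r : cell_datum (lev A r) :=
  @CellDatum R (lev A r) (cd_disp (C r)) (cd_lam (C r)) (@Std r)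
    (fun nu s t => to_lev r (d_path s * u_path t)).

Definition u_set r (nu : cd_lam (C r)) : set (lev A r) := fun x =>
  exists t : Std nu, x = to_lev r (u_path t).

Definition murphy_gt r (nu : cd_lam (C r)) : set (lev A r) :=
  @cd_gt R (lev A r) (murphy_datum r) nu.

Record is_murphy : Prop := IsMurphy {
  mu_cellular : forall r, is_cellular (murphy_datum r) (@lev_star R A r);
  mu_ge : forall r (nu : cd_lam (C r)) (t : Std nu),
    lspan (@cd_ge R (lev A r) (murphy_datum r) nu) (to_lev r (u_path t));
  (* the u_t + A^(> nu) form a basis of a right module isomorphic to the cell *)
  (* module labelled by nu                                                    *)
  mu_stable : forall r (nu : cd_lam (C r)),
    @spans_stable R (lev A r) (reg_rmod (lev A r)) (u_set nu) (murphy_gt nu);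
  mu_free : forall r (nu : cd_lam (C r)) (a : Std nu -> R),
    lspan (murphy_gt nu) (\sum_t a t *: to_lev r (u_path t)) -> forall t, a t = 0;
  mu_iso : forall r (nu : cd_lam (C r)),
    rmod_iso (cell_mod nu)
      (@span_quo R (lev A r) (reg_rmod (lev A r)) (u_set nu) (murphy_gt nu))
}.

Variable rho : tensor_embedding A.

(* The generators of A^(> nu \ la) *)
Definition skew_gt m s (la : cd_lam (C m)) (nu : cd_lam (C (s + m)%N)) :
    set (lev A (s + m)%N) := fun x =>
  murphy_gt nu x \/
  exists t : Std nu, (la < at_level t)%O /\ x = to_lev (s + m)%N (u_path t).

(* te_right is b |-> 1 x b, te_left is a |-> a x 1 *)
Definition te_right m s : algHom (lev A s) (lev A (s + m)%N) :=
  algHom_comp (te_hom rho m s) (tens_inr (lev A m) (lev A s)).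
Definition te_left m s : algHom (lev A m) (lev A (s + m)%N) :=
  algHom_comp (te_hom rho m s) (tens_inl (lev A m) (lev A s)).

Definition skew_mod m s (la : cd_lam (C m)) (nu : cd_lam (C (s + m)%N))
    (tla : Std la) : rmod (lev A s) :=
  @span_quo R (lev A s) (res_rmod (te_right m s) (reg_rmod (lev A (s + m)%N)))
    (fun x => exists t : sStd la nu, x = to_lev (s + m)%N (u_skew t * u_path tla))
    (skew_gt la nu).

Lemma te_comm m s (a : lev A m) (b : lev A s) :
  te_left m s a *a te_right m s b = te_right m s b *a te_left m s a.
Proof. by rewrite /= -!ah_mul !tens_mulE !amul1l !amul1r. Qed.

(* The extension of scalars A_m^F (x) A_s^F -> A_(s + m)^F of rho, by which      *)
(* A_(s + m)^F-modules are restricted to A_m^F x A_s^F                        *)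
Definition te_ext m s :
    algHom (tens (ext (lev A m)) (ext (lev A s))) (ext (lev A (s + m)%N)) :=
  tens_prod (ext_hom_comm (@te_comm m s)).
End Tableaux.

(* Main.v *)
From HB Require Import structures.
Require Import Defs.
From mathcomp Require Import all_boot all_order all_algebra.
From mathcomp Require Import ring.
From mathcomp Require Import boolp classical_sets.

(** Write r = s + m. The idea is to compare both sides with the space of
    A_m-homomorphisms from the cell module of la to the cell module V of nu, on
    which A_s acts through its commuting embedding in A_r. A homomorphism from an
    outer tensor product is a homomorphism from the second factor into the
    homomorphisms from the first one (hom_box_iso), so it suffices to identify the
    extended skew cell module with this space.

    Let U be the span, modulo the ideal of the labels above nu, of the u_t such
    that t passes on level m through a vertex above la, and let W be the span of U
    and of the u_t such that t starts with the fixed path tla to la. The skew cell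
    module is W / U. A homomorphism from the cell module of la to V is determined
    by the image of the generator u_(tla). In the other direction, an element y of
    W is projected onto a complement of U and prescribed as the image of u_(tla);
    this respects the relations of u_(tla), because y is a left multiple of
    u_(tla) modulo U, and because the element of A_m obtained by applying a
    relation to u_(tla) lies in the ideal of the labels above la, which the
    projection kills (cut_annihilated).

    Three facts make this work. First, the extension of A_m is split semisimple,
    so every cell ideal has a unit after extension of scalars (cell_ideal_unit);
    the unit of the ideal above la provides the projection. Second, as a
    consequence the bilinear form on the cell module of la is nondegenerate, so
    A_m acts on it by all matrix units (cell_matrix_units); the one at tla maps V
    into W. Third, U is exactly the part of V where the unit of the ideal above la
    acts as the identity (ideal_image). One inclusion holds because u_t, for a
    path t through kappa on level m, is a left multiple of an element of the ideal
    of the labels greater than or equal to kappa. The other one is a count: going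
    down one level at a time, the cell filtrations of restricted cell modules
    bound the rank of the image by the number of paths that reach nu through a
    vertex above la (rank_cell), and U already has this rank.

    All of this is carried out over R with denominators cleared: units are
    replaced by elements that act as a nonzero scalar, and the lattices spanned by
    parts of the basis u_t are saturated (pspan_sat). Hence U and W are stable
    under A_s over R itself, as the definition of the skew cell module requires.
    Only the final passage from a pairing over R to an isomorphism of spaces of
    homomorphisms uses the field of fractions. *)

Set Implicit Arguments.
Unset Strict Implicit.
Unset Printing Implicit Defensive.

Import Order.TTheory GRing.Theory.

Local Open Scope ring_scope.

(** * Linear algebra over a commutative ring *)

Section AlgebraLemmas.
Variables (K : comNzRingType) (B : ualgType K).
Implicit Types (x y z : B) (a : K).

Lemma amulDl x y z : (x + y) *a z = x *a z + y *a z.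
Proof. exact: (linD (amul_linl z)). Qed.
Lemma amulDr x y z : x *a (y + z) = x *a y + x *a z.
Proof. exact: (linD (amul_linr x)). Qed.
Lemma amulNl x y : (- x) *a y = - (x *a y).
Proof. exact: (linN (amul_linl y)). Qed.
Lemma amulNr x y : x *a (- y) = - (x *a y).
Proof. exact: (linN (amul_linr x)). Qed.
Lemma amulBl x y z : (x - y) *a z = x *a z - y *a z.
Proof. by rewrite amulDl amulNl. Qed.
Lemma amulBr x y z : x *a (y - z) = x *a y - x *a z.
Proof. by rewrite amulDr amulNr. Qed.
Lemma amulZl a x y : (a *: x) *a y = a *: (x *a y).
Proof. exact: (linZ (amul_linl y)). Qed.
Lemma amulZr a x y : x *a (a *: y) = a *: (x *a y).
Proof. exact: (linZ (amul_linr x)). Qed.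
Lemma amul0l x : 0 *a x = 0.
Proof. exact: (lin0 (amul_linl x)). Qed.
Lemma amul0r x : x *a 0 = 0.
Proof. exact: (lin0 (amul_linr x)). Qed.
Lemma amul_suml I (r : seq I) P (F : I -> B) y :
  (\sum_(i <- r | P i) F i) *a y = \sum_(i <- r | P i) F i *a y.
Proof.
by apply: (big_morph (fun x => x *a y)) => [x z|]; rewrite ?amulDl ?amul0l.
Qed.
Lemma amul_sumr I (r : seq I) P (F : I -> B) y :
  y *a (\sum_(i <- r | P i) F i) = \sum_(i <- r | P i) y *a F i.
Proof. by apply: (big_morph (amul y)) => [x z|]; rewrite ?amulDr ?amul0r. Qed.

Variable M : rmod B.
Implicit Types (m n : M) (b c : B).
Lemma ractDl m n b : (m + n) *r b = m *r b + n *r b.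
Proof. exact: (linD ((ract_bilin M).1 b)). Qed.
Lemma ractDr m b c : m *r (b + c) = m *r b + m *r c.
Proof. exact: (linD ((ract_bilin M).2 m)). Qed.
Lemma ractZl a m b : (a *: m) *r b = a *: (m *r b).
Proof. exact: (linZ ((ract_bilin M).1 b)). Qed.
Lemma ractZr a m b : m *r (a *: b) = a *: (m *r b).
Proof. exact: (linZ ((ract_bilin M).2 m)). Qed.
Lemma ract0l b : (0 : M) *r b = 0.
Proof. exact: (lin0 ((ract_bilin M).1 b)). Qed.
Lemma ract_suml I (r : seq I) P (F : I -> M) b :
  (\sum_(i <- r | P i) F i) *r b = \sum_(i <- r | P i) F i *r b.
Proof.
by elim/big_rec2: _ => [|i y x _ <-]; rewrite ?ract0l ?ractDl.
Qed.
End AlgebraLemmas.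

Arguments lspan : simpl never.
Arguments ss_set : simpl never.

Section SpanLemmas.
Variables (K : comNzRingType) (V : lmodType K).
Implicit Types (X : lsubspace V) (S T : set V).

Lemma ss0 X : X 0.
Proof. exact: (ss_P X).1. Qed.
Lemma ssZ X a x : X x -> X (a *: x).
Proof. by move=> h; have := (ss_P X).2 a x 0 h (ss0 X); rewrite addr0. Qed.
Lemma ssD X x y : X x -> X y -> X (x + y).
Proof. by move=> hx hy; have := (ss_P X).2 1 x y hx hy; rewrite scale1r. Qed.
Lemma ssN X x : X x -> X (- x).
Proof. by rewrite -scaleN1r; apply: ssZ. Qed.
Lemma ssB X x y : X x -> X y -> X (x - y).
Proof. by move=> hx hy; apply: ssD => //; apply: ssN. Qed.
Lemma ss_sum X I (r : seq I) (P : pred I) (F : I -> V) :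
  (forall i, P i -> X (F i)) -> X (\sum_(i <- r | P i) F i).
Proof. by move=> h; apply: big_ind => //; [exact: ss0|exact: ssD]. Qed.

Lemma lspan_gen S x : S x -> lspan S x.
Proof.
move=> h; exists 1%N, (fun=> 1), (fun=> x); split=> //.
by rewrite big_ord1 scale1r.
Qed.

Lemma lspan_min S X : (forall x, S x -> X x) -> forall x, lspan S x -> X x.
Proof.
by move=> h x [n [a [v [hv ->]]]]; apply: ss_sum => i _; apply/ssZ/h.
Qed.

Lemma lspan_elim S (P : V -> Prop) : P 0 ->
  (forall a x y, P x -> P y -> P (a *: x + y)) -> (forall x, S x -> P x) ->
  forall x, lspan S x -> P x.
Proof.
by move=> P0 PD; apply: (@lspan_min S (LSubspace (conj P0 PD))).
Qed.

Lemma lspan_sub S T : (forall x, S x -> lspan T x) ->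
  forall x, lspan S x -> lspan T x.
Proof. exact: lspan_min. Qed.

End SpanLemmas.

Lemma lspan_morph (K : comNzRingType) (V W : lmodType K) (f : V -> W)
    (S : set V) (Y : lsubspace W) :
  linear f -> (forall x, S x -> Y (f x)) -> forall x, lspan S x -> Y (f x).
Proof.
move=> hf h x [n [a [v [hv ->]]]]; rewrite (lin_sum _ _ hf).
by apply: ss_sum => i _; rewrite (linZ hf); apply/ssZ/h.
Qed.

(** * Presentations of subquotients *)

Section Presentation.
Variables (K : comNzRingType) (B : ualgType K).

(** Modules given as subquotients X / Y of an ambient module M are only ever
    used through the projection X -> X / Y. Taking it as a function on all of M
    avoids subtypes and makes the notion invariant under isomorphism of Q. *)
Definition presents (M Q : rmod B) (X Y : set M) (p : M -> Q) : Prop :=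
  [/\ forall a x y, X x -> X y -> p (a *: x + y) = a *: p x + p y,
      forall x b, X x -> p (x *r b) = p x *r b,
      forall q, exists2 x, X x & p x = q
    & forall x, X x -> (p x = 0 <-> Y x)].

Lemma subquo_presents (M : rmod B) (X Y : submod M) :
  exists p : M -> subquo X Y, presents X Y p.
Proof.
pose pr (x : M) : sub_rmod X := insubd (0 : sub_lmod (sm_space X)) x.
have prE x : X x -> val (pr x) = x.
  by move=> hx; apply: insubdK; apply/asboolP.
have XL : is_lsubspace X := (sm_P X).1.
exists (fun x => quo_pi (sm_space (Submod (meet_is_submod X Y))) (pr x)).
split.
- move=> a x y hx hy; rewrite -quo_pi_linear; congr (quo_pi _ _).
  apply: val_inj; transitivity (a *: val (pr x) + val (pr y)) => //.
  by rewrite !prE //; exact: XL.2.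
- move=> x b hx; rewrite [RHS]quo_act_pi; congr (quo_pi _ _).
  apply: val_inj; rewrite prE; last exact: (sm_P X).2.
  by rewrite /= prE.
- move=> q; exists (val (repr q)); first exact/asboolP/(valP (repr q)).
  rewrite -[RHS]quo_piK; congr (quo_pi _ _); apply: val_inj; rewrite prE //.
  exact/asboolP/(valP (repr q)).
- move=> x hx.
  have -> : (0 : subquo X Y) =
      quo_pi (sm_space (Submod (meet_is_submod X Y))) 0.
    by rewrite (lin0 (@quo_pi_linear _ _ _)).
  by rewrite quo_pi_eq subr0 /ss_set /= prE.
Qed.

Lemma span_quo_presents (M : rmod B) (S T : set M) : spans_stable S T ->
  exists p : M -> span_quo S T, presents (lspan (S `|` T)%classic) (lspan T) p.
Proof.
move=> h; rewrite /span_quo; case: pselect => // h'.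
exact: subquo_presents.
Qed.

Lemma presents_iso (M Q Q' : rmod B) (X Y : set M) (p : M -> Q) :
  presents X Y p -> rmod_iso Q Q' -> exists p' : M -> Q', presents X Y p'.
Proof.
case=> p1 p2 p3 p4 [f [f1 f2] [g fK gK]]; exists (fun x => f (p x)); split.
- by move=> a x y hx hy; rewrite p1 // f1.
- by move=> x b hx; rewrite p2 // f2.
- by move=> q; have [x hx e] := p3 (g q); exists x; rewrite // e.
- move=> x hx; rewrite -p4 //; split=> [e|->]; last exact: (lin0 f1).
  by apply: (can_inj fK); rewrite e (lin0 f1).
Qed.

Lemma rmod_iso_sym (M N : rmod B) : rmod_iso M N -> rmod_iso N M.
Proof.
case=> f [f1 f2] [g fK gK]; exists g; last by exists f.
split=> [a x y|x b]; apply: (can_inj fK).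
  by rewrite f1 !gK.
by rewrite f2 !gK.
Qed.

Section PresentsTheory.
Variables (M Q : rmod B) (X Y : lsubspace M) (p : M -> Q).
Hypothesis hp : presents X Y p.

Lemma presP a x y : X x -> X y -> p (a *: x + y) = a *: p x + p y.
Proof. by case: hp => h _ _ _; apply: h. Qed.
Lemma pres0 : p 0 = 0.
Proof.
have := presP (-1) (ss0 X) (ss0 X).
by rewrite scaler0 addr0 scaleN1r addNr.
Qed.
Lemma presZ a x : X x -> p (a *: x) = a *: p x.
Proof. by move=> hx; have := presP a hx (ss0 X); rewrite !addr0 pres0 addr0. Qed.
Lemma presD x y : X x -> X y -> p (x + y) = p x + p y.
Proof. by move=> hx hy; have := presP 1 hx hy; rewrite !scale1r. Qed.
Lemma presB x y : X x -> X y -> p (x - y) = p x - p y.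
Proof.
move=> hx hy; rewrite presD; [|done|exact: ssN].
by rewrite -!scaleN1r presZ.
Qed.
Lemma pres_sum I (r : seq I) (P : pred I) (F : I -> M) :
  (forall i, P i -> X (F i)) ->
  p (\sum_(i <- r | P i) F i) = \sum_(i <- r | P i) p (F i).
Proof.
move=> h; suff [] : X (\sum_(i <- r | P i) F i) /\
  p (\sum_(i <- r | P i) F i) = \sum_(i <- r | P i) p (F i) by [].
elim/big_rec2: _ => [|i x y hi [hy <-]]; first by rewrite pres0; split=> //; exact: ss0.
split; first exact: ssD (h _ hi) hy.
by rewrite presD //; exact: h.
Qed.
Lemma pres_act x b : X x -> p (x *r b) = p x *r b.
Proof. by case: hp => _ h _ _; apply: h. Qed.
Lemma pres_surj q : exists2 x, X x & p x = q.
Proof. by case: hp. Qed.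
Lemma pres_ker x : X x -> (p x = 0 <-> Y x).
Proof. by case: hp => _ _ _; apply. Qed.
Lemma pres_eq x y : X x -> X y -> (p x = p y <-> Y (x - y)).
Proof.
move=> hx hy; rewrite -pres_ker ?presB //; last exact: ssB.
by split=> [->|/eqP]; rewrite ?subrr // subr_eq0 => /eqP.
Qed.
End PresentsTheory.
End Presentation.

(** * Extension of scalars to the field of fractions *)

Lemma fraction_repr (R : idomainType) (x : {fraction R}) :
  exists n d : R, d != 0 /\ x = tofrac n / tofrac d.
Proof.
elim/quotW: x => x; exists (frac x).1, (frac x).2.
split; first exact: denom_ratioP.
apply: (@mulIf _ (tofrac (frac x).2)).
  by rewrite tofrac_eq0 denom_ratioP.
rewrite mulfVK ?tofrac_eq0 ?denom_ratioP //; unlock tofrac.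
rewrite -[LHS]FracField.pi_mul /FracField.mulf; apply/eqmodP => /=.
rewrite FracField.equivfE !numden_Ratio ?mulf_neq0 ?oner_neq0 ?denom_ratioP //.
by rewrite !mulr1 mulrC.
Qed.

Section ExtLemmas.
Variables (R : idomainType) (M : lmodType R).
Notation F := {fraction R}.

Lemma epureD (m m' : M) (a : F) : epure (m + m') a = epure m a + epure m' a.
Proof. exact: (linD ((pure_bilin M (fracR R)).1 a)). Qed.
Lemma epure0 (a : F) : epure (0 : M) a = 0.
Proof. exact: (lin0 ((pure_bilin M (fracR R)).1 a)). Qed.
Lemma epureZ (r : R) (m : M) (a : F) : epure (r *: m) a = epure m (tofrac r * a).
Proof.
rewrite [LHS](linZ ((pure_bilin M (fracR R)).1 a)).
by rewrite [RHS](linZ ((pure_bilin M (fracR R)).2 m)).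
Qed.

Lemma ext_common_denom (x : ext M) :
  exists (m : M) (c : R), c != 0 /\ x = epure m (tofrac c)^-1.
Proof.
elim/ext_ind: x => [|x y [m [c [c0 ->]]] [m' [c' [c0' ->]]]|m a].
- by exists 0, 1; rewrite oner_neq0 epure0.
- exists (c' *: m + c *: m'), (c * c'); split; first exact: mulf_neq0.
  rewrite epureD !epureZ tofracM invfM.
  rewrite [tofrac c' * _]mulrCA mulfV ?tofrac_eq0 // mulr1.
  by rewrite mulVKf ?tofrac_eq0.
have [n [d [d0 ->]]] := fraction_repr a.
by exists (n *: m), d; split=> //; rewrite epureZ.
Qed.

(** A functional over the domain extends to one over its field of fractions;
    this is what detects nonzero elements of ext M. *)
Lemma epure_eq0 (l : M -> R) (m : M) (a : F) : 
  linear (l : M -> R^o) -> a != 0 -> epure m a = 0 -> l m = 0.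
Proof.
move=> hl a0 h.
pose phi (m : M) (x : fracR R) : fracR R := l m *: x.
have hphi : bilin phi.
  split=> [x r m1 m2|m1 r x1 x2]; rewrite /phi.
    by rewrite hl scalerDl -scalerA.
  by rewrite scalerDr !scalerA mulrC.
have : tens_lift phi (pure m (a : fracR R)) = 0.
  by rewrite [pure _ _]h; exact: (lin0 (tens_lift_linear hphi)).
rewrite tens_lift_pure // => /eqP; rewrite [_ == _]mulf_eq0.
by rewrite (negPf a0) orbF tofrac_eq0 => /eqP.
Qed.
End ExtLemmas.

Lemma bij_linear_inv (F : fieldType) (U V : lmodType F) (psi : U -> V) :
  linear psi -> injective psi -> (forall v, exists u, psi u = v) ->
  exists f : {linear V -> U}, bijective f.
Proof.
move=> hl hi hs; have [f fK] := choice hs.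
have Kf : cancel psi f by move=> u; apply: hi; rewrite fK.
have fl : linear f by move=> a x y; apply: hi; rewrite hl !fK.
pose fm := GRing.isLinear.Build F V U *:%R f fl.
pose g : {linear V -> U} := HB.pack f fm.
by exists g; exists psi.
Qed.

(** * From a pairing over the domain to an isomorphism of Hom spaces *)

Section HomBox.
Variables (R : idomainType) (B1 B2 B3 : ualgType R).
Variables (f : algHom B1 B3) (g : algHom B2 B3).
Hypothesis fgC : forall b c, f b *a g c = g c *a f b.
Variables (M1 : rmod B1) (S : rmod B2) (M3 : rmod B3) (N : rmod (ext B2)).
Variables (z0 : M1) (theta : S -> M1 -> M3).
Notation F := {fraction R}.

(** What theta must satisfy in order to identify, after extension of scalars, S
    with the B1-homomorphisms from M1 to M3. The element z0 generates M1 up to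
    torsion (hp_gen), so a homomorphism is determined by its value at z0; that
    value satisfies all the relations of z0, and hp_surj says that up to a
    scalar theta takes all such values. Linear functionals separate the points
    of M3 (hp_sep), so M3 embeds in its extension of scalars. *)
Record hom_pairing : Prop := HomPairing {
  hp_bilin : bilin theta;
  hp_left : forall q x b, theta q (x *r b) = theta q x *r f b;
  hp_right : forall q x c, theta (q *r c) x = theta q x *r g c;
  hp_inj : forall q, theta q z0 = 0 -> q = 0;
  hp_gen : forall x, exists b c, c != 0 /\ z0 *r b = c *: x;
  hp_surj : forall y, (forall b, z0 *r b = 0 -> y *r f b = 0) ->
    exists q c, c != 0 /\ theta q z0 = c *: y;
  hp_sep : forall y : M3, (forall l : M3 -> R, linear (l : M3 -> R^o) -> l y = 0) -> y = 0
}.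
Hypothesis hp : hom_pairing.

Let thF : ext S -> ext M1 -> ext M3 := ext_op theta.
Let thB : bilin thF := ext_op_bilin (hp_bilin hp).
Let thP q a x b : thF (epure q a) (epure x b) = epure (theta q x) (a * b).
Proof. exact: ext_op_pure (hp_bilin hp) _ _ _ _. Qed.
Let z1 : ext M1 := epure z0 1.

Let actP (B : ualgType R) (M : rmod B) (m : M) a (b : B) c :
  (epure m a : ext_rmod M) *r epure b c = epure (m *r b) (a * c) :> ext M.
Proof. exact: ext_op_pure (ract_bilin M) _ _ _ _. Qed.

Let th0l x : thF 0 x = 0. Proof. exact: (lin0 (thB.1 x)). Qed.
Let th0r q : thF q 0 = 0. Proof. exact: (lin0 (thB.2 q)). Qed.
Let thDl q q' x : thF (q + q') x = thF q x + thF q' x.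
Proof. exact: (linD (thB.1 x)). Qed.
Let thDr q x x' : thF q (x + x') = thF q x + thF q x'.
Proof. exact: (linD (thB.2 q)). Qed.

Lemma thF_left q x b :
  thF q ((x : ext_rmod M1) *r b) = (thF q x : ext_rmod M3) *r ext_hom f b.
Proof.
elim/ext_ind: q => [|q q' ih ih'|q a].
- by rewrite !th0l ract0l.
- by rewrite !thDl ih ih' ractDl.
elim/ext_ind: x => [|x x' ih ih'|x c].
- by rewrite ract0l !th0r ract0l.
- by rewrite ractDl !thDr ih ih' ractDl.
elim/ext_ind: b => [|b b' ih ih'|b e].
- rewrite (lin0 (ah_lin _)) !(lin0 ((ract_bilin _).2 _)); exact: th0r.
- by rewrite (linD (ah_lin _)) !ractDr thDr ih ih'.
rewrite actP !thP ext_hom_pure [RHS]actP (hp_left hp) mulrA //.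
Qed.

Lemma thF_right q x c :
  thF ((q : ext_rmod S) *r c) x = (thF q x : ext_rmod M3) *r ext_hom g c.
Proof.
elim/ext_ind: q => [|q q' ih ih'|q a].
- by rewrite ract0l !th0l ract0l.
- by rewrite ractDl !thDl ih ih' ractDl.
elim/ext_ind: x => [|x x' ih ih'|x d].
- by rewrite !th0r ract0l.
- by rewrite !thDr ih ih' ractDl.
elim/ext_ind: c => [|b b' ih ih'|b e].
- rewrite (lin0 (ah_lin _)) !(lin0 ((ract_bilin _).2 _)); exact: th0l.
- by rewrite (linD (ah_lin _)) !ractDr thDl ih ih'.
rewrite actP !thP ext_hom_pure [RHS]actP (hp_right hp).
by rewrite mulrAC.
Qed.

Lemma thF_inj q : thF q z1 = 0 -> q = 0.
Proof.
have [q' [c [c0 ->]]] := ext_common_denom q.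
rewrite thP mulr1 => h; rewrite (_ : q' = 0) ?epure0 //.
apply: (hp_inj hp); apply: (hp_sep hp) => l hl.
by apply: (epure_eq0 hl _ h); rewrite invr_eq0 tofrac_eq0.
Qed.

Lemma gen_ext (x : ext M1) : exists b : ext B1, x = (z1 : ext_rmod M1) *r b.
Proof.
have [x' [c [c0 ->]]] := ext_common_denom x.
have [b [d [d0 e]]] := hp_gen hp x'.
exists (epure b ((tofrac d)^-1 / tofrac c)).
rewrite [RHS]actP mul1r e epureZ mulVKf // tofrac_eq0 //.
Qed.

(** The value of phi at the generator satisfies every relation of the
    generator, so up to a denominator it is a value of theta; a homomorphism
    is then determined by its value at the generator. *)
Lemma thF_surj (phi : ext M1 -> ext M3) : linear phi ->
  (forall x b, phi ((x : ext_rmod M1) *r b) = (phi x : ext_rmod M3) *r ext_hom f b) ->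
  exists q, forall x, phi x = thF q x.
Proof.
move=> hl ha.
have [y [c [c0 e]]] := ext_common_denom (phi z1).
have [q [d [d0 hq]]] : exists q d, d != 0 /\ theta q z0 = d *: y.
  apply: (hp_surj hp) => b hb; apply: (hp_sep hp) => l ll.
  apply: (@epure_eq0 _ _ l (y *r f b) (tofrac c)^-1) => //.
    by rewrite invr_eq0 tofrac_eq0.
  have := ha z1 (epure b 1); rewrite e ext_hom_pure !actP hb epure0.
  by rewrite (lin0 hl) mulr1 => <-.
exists (epure q ((tofrac d)^-1 / tofrac c)) => x.
have [b ->] := gen_ext x.
rewrite ha thF_left e thP mulr1 hq epureZ.
by rewrite [tofrac d * _]mulVKf // tofrac_eq0.
Qed.

Let te := tens_prod (ext_hom_comm fgC).
Let Big := rhom (box_rmod (ext_rmod M1) N) (res_rmod te (ext_rmod M3)).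
Let Small := rhom N (ext_rmod S).

Let smallP (h : Small) : is_rhom (val h).
Proof. exact/asboolP/(valP h). Qed.
Let bigP (h : Big) : is_rhom (val h).
Proof. exact/asboolP/(valP h). Qed.

Let pairing (h : Small) (x : ext_rmod M1) (y : N) : ext M3 := thF (val h y) x.
Let pairing_bilin h : bilin (pairing h).
Proof.
split=> [y|x] a u v; rewrite /pairing; first exact: thB.2.
by rewrite (smallP h).1; apply: thB.1.
Qed.

Let psi_fun (h : Small) :
  box_rmod (ext_rmod M1) N -> res_rmod te (ext_rmod M3) := tens_lift (pairing h).

Lemma te_pure (b : ext B1) (c : ext B2) :
  te (pure b c) = ext_hom f b *a ext_hom g c.
Proof. exact: tens_prod_pure. Qed.

Lemma psi_is_rhom h : is_rhom (psi_fun h).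
Proof.
split; first exact: tens_lift_linear (pairing_bilin h).
have L := tens_lift_linear (pairing_bilin h).
elim/tens_ind => [b|x x' ih ih' b|x y].
- by rewrite ract0l [psi_fun _ 0](lin0 L) ract0l.
- by rewrite ractDl [LHS](linD L) [psi_fun _ (x + x')](linD L) ractDl -ih -ih'.
elim/tens_ind => [|b b' ih ih'|b c].
- by rewrite !(lin0 ((ract_bilin _).2 _)) [LHS](lin0 L).
- by rewrite !ractDr -ih -ih'; exact: (linD L).
rewrite [X in psi_fun h X](_ : _ = pure (x *r b) (y *r c)); last first.
  exact: tens_op_pure (ract_bilin _) (ract_bilin _) _ _ _ _.
rewrite /psi_fun !tens_lift_pure // /pairing.
rewrite (smallP h).2 thF_left thF_right -!ractM -(ext_hom_comm fgC) -te_pure.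
by [].
Qed.

Let psi (h : Small) : Big := Sub (psi_fun h) (introT (asboolP _) (psi_is_rhom h)).

Lemma psi_pure h x y : val (psi h) (pure x y) = thF (val h y) x.
Proof. exact: tens_lift_pure (pairing_bilin h). Qed.

Lemma psi_linear : linear psi.
Proof.
move=> a h h'; apply: val_inj; apply: funext => z.
elim/tens_ind: z => [|z z' ih ih'|x y].
- by rewrite !(lin0 (bigP _).1).
- by rewrite !(linD (bigP _).1) ih ih'.
rewrite psi_pure [RHS](_ : _ = a *: val (psi h) (pure x y) + val (psi h') (pure x y)) //.
by rewrite !psi_pure; apply: thB.1.
Qed.

Lemma psi_inj : injective psi.
Proof.
move=> h h' e; apply: val_inj; apply: funext => y.
apply/eqP; rewrite -subr_eq0; apply/eqP; apply: thF_inj.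
rewrite thDl (linN (thB.1 _)) -!psi_pure e.
exact: subrr.
Qed.

Lemma psi_surj (H : Big) : exists h, psi h = H.
Proof.
have [H1 H2] := bigP H.
have ex y : exists q, forall x, val H (pure x y) = thF q x.
  apply: thF_surj; first by move=> a u v; rewrite (pure_bilin _ _).1 H1.
  move=> x b; have := H2 (pure x y) (pure b (aone (ext B2))).
  rewrite [X in val H X](_ : _ = pure (x *r b) (y *r aone (ext B2))); last first.
    exact: tens_op_pure (ract_bilin _) (ract_bilin _) _ _ _ _.
  by rewrite ract1 => ->; rewrite -[ext_hom f b]amul1r -(ah_one (ext_hom g)) -te_pure.
have [G GP] := choice ex.
have thE q q' : thF q z1 = thF q' z1 -> q = q'.
  move=> e; apply/eqP; rewrite -subr_eq0; apply/eqP; apply: thF_inj.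
  by rewrite thDl (linN (thB.1 _)) e subrr.
have Gh : is_rhom (G : N -> ext_rmod S).
  split=> [a y y'|y c]; apply: thE.
    rewrite -GP (pure_bilin _ _).2 H1 !GP; symmetry; exact: thB.1.
  rewrite -GP thF_right -GP.
  have := H2 (pure z1 y) (pure (aone (ext B1)) c).
  rewrite [X in val H X](_ : _ = pure ((z1 : ext_rmod M1) *r aone (ext B1)) (y *r c)); last first.
    exact: tens_op_pure (ract_bilin _) (ract_bilin _) _ _ _ _.
  by rewrite ract1 => ->; rewrite -[ext_hom g c]amul1l -(ah_one (ext_hom f)) -te_pure.
exists (Sub G (introT (asboolP _) Gh)); apply: val_inj; apply: funext => z.
elim/tens_ind: z => [|z z' ih ih'|x y].
- by rewrite !(lin0 (bigP _).1).
- by rewrite !(linD (bigP _).1) ih ih'.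
by rewrite psi_pure GP.
Qed.

(** Homomorphisms from an outer tensor product are homomorphisms from N to the
    B1-homomorphisms from M1 to M3, and theta identifies the latter with S. *)
Theorem hom_box_iso : exists h : {linear
    rhom (box_rmod (ext_rmod M1) N)
         (res_rmod (tens_prod (ext_hom_comm fgC)) (ext_rmod M3))
    -> rhom N (ext_rmod S)}, bijective h.
Proof. exact: (bij_linear_inv psi_linear psi_inj psi_surj). Qed.
End HomBox.

(** * Ideals of split semisimple algebras *)

(** A nonzero entry of X can be moved to any diagonal place, which is why the
    ideal generated by X is the full matrix algebra. *)
Lemma delta_mul_delta (F : fieldType) n (X : 'M[F]_n) (a b c : 'I_n) :
  delta_mx c a *m X *m delta_mx b c = X a b *: delta_mx c c.
Proof.
apply/matrixP=> p q; rewrite !mxE (bigD1 b) //= big1 ?addr0; last first.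
  by move=> j jb; rewrite !mxE (negPf jb) mulr0.
rewrite !mxE (bigD1 a) //= big1 ?addr0; last first.
  by move=> j ja; rewrite !mxE (negPf ja) andbF mul0r.
rewrite !mxE !eqxx /= andbT; case: (p == c); case: (q == c);
  by rewrite /= ?mul1r ?mul0r ?mulr1 ?mulr0.
Qed.

(** An ideal of a product of matrix algebras is a product of some of the
    factors, hence generated by a central idempotent. *)
Lemma split_semisimple_ideal (F : fieldType) (E : ualgType F)
    (J : lsubspace E) : split_semisimple E ->
  (forall x y, J x -> J (x *a y)) -> (forall x y, J x -> J (y *a x)) ->
  exists eps, [/\ J eps, forall x, eps *a x = x *a eps
                & forall x, J x -> x *a eps = x].
Proof.
case=> n [d [f [fl f1 fM fB]]] JR JL.
have finj x y : (forall i, f i x = f i y) -> x = y.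
  move=> e; have [z [_ hz]] := fB (fun i => f i y).
  by rewrite -(hz x) // (hz y).
have lift i (M : 'M[F]_((d i).+1)) :
    exists x, f i x = M /\ forall j, i != j -> f j x = 0.
  pose y j : 'M[F]_((d j).+1) := match i =P j with
    | ReflectT e => eq_rect i (fun k => 'M[F]_((d k).+1)) M j e
    | ReflectF _ => 0
    end.
  have [x [hx _]] := fB y; exists x; split.
    by rewrite hx /y; case: eqP => // e; rewrite (eq_axiomK e).
  by move=> j; rewrite hx /y; case: eqP.
pose I i := `[< exists2 x, J x & f i x != 0 >].
have unit_ex i : exists e, [/\ J e, f i e = (if I i then 1 else 0)
                           & forall j, i != j -> f j e = 0].
  have [|_] := boolP (I i); last first.
    by exists 0; split=> [||j _]; rewrite ?(lin0 (fl _)) //; exact: ss0.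
  move=> /asboolP [x Jx /eqP hx].
  have [a [b nz]] : exists a b, f i x a b != 0.
    apply: contrapT => h; apply: hx; apply/matrixP=> a b; rewrite mxE.
    by apply/eqP; apply: contrapT => /negP nz; apply: h; exists a, b.
  have [el elP] := choice (fun c => lift i (delta_mx c a)).
  have [er erP] := choice (fun c => lift i (delta_mx b c)).
  exists (\sum_c (f i x a b)^-1 *: (el c *a x *a er c)); split.
  - by apply: ss_sum => c _; apply/ssZ/JR/JL.
  - rewrite (lin_sum _ _ (fl i)).
    transitivity (1%:M : 'M[F]_((d i).+1)) => //.
    rewrite mx1_sum_delta; apply: eq_bigr => c _.
    rewrite (linZ (fl i)) !fM (elP c).1 (erP c).1 -!mulmxE delta_mul_delta.
    by rewrite scalerA mulVf // scale1r.
  - move=> j ij; rewrite (lin_sum _ _ (fl j)) big1 // => c _.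
    by rewrite (linZ (fl j)) !fM (elP c).2 // !mul0r scaler0.
have [e eP] := choice unit_ex.
have fe i : f i (\sum_j e j) = if I i then 1 else 0.
  rewrite (lin_sum _ _ (fl i)) (bigD1 i) //= big1 ?addr0.
    by have [_ ->] := eP i.
  by move=> j ji; have [_ _ ->] := eP j.
exists (\sum_j e j); split.
- by apply: ss_sum => j _; have [] := eP j.
- move=> x; apply: finj => i; rewrite !fM fe.
  by case: (I i); rewrite ?mul1r ?mulr1 ?mul0r ?mulr0.
move=> x Jx; apply: finj => i; rewrite fM fe.
have [_|/negP nI] := boolP (I i); first by rewrite mulr1.
rewrite mulr0; apply/eqP; rewrite eq_sym; apply: contrapT => /negP nz.
by apply: nI; apply/asboolP; exists x.
Qed.

(** * Cell ideals *)

(** Stated over an abstract field, where field arithmetic does not unfold the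
    construction of fractions. *)
Lemma common_denominator (F : fieldType) (n c d e : F) :
  c != 0 -> d != 0 -> e != 0 ->
  n / e * c^-1 = n * d / (c * e * d) /\ d^-1 = c * e / (c * e * d).
Proof. by move=> c0 d0 e0; split; field; rewrite c0 ?d0 e0. Qed.

Section CellIdeals.
Variables (R : idomainType) (B : ualgType R) (D : cell_datum B) (star : B -> B).
Hypothesis hD : is_cellular D star.
Hypothesis star_lin : linear star.
Hypothesis star_mul : forall x y, star (x *a y) = star y *a star x.
Hypothesis star_inv : involutive star.

Local Notation L := (cd_lam D).
Let I : finType := {l : L & (cd_std l * cd_std l)%type}.
Let bas (i : I) : B := cd_c (tagged i).1 (tagged i).2.
Let bI (l : L) (s t : cd_std l) : I := Tagged (fun l => (cd_std l * cd_std l)%type) (s, t).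

Definition cell_ideal (G : pred L) : lsubspace B :=
  lspan (fun x => exists l (p q : cd_std l), G l /\ x = cd_c p q).

Arguments cell_ideal : simpl never.

Definition upset (G : pred L) : Prop := forall l l', (l <= l')%O -> G l -> G l'.

Lemma cell_coord_exists : exists co : I -> B -> R,
  [/\ forall i, linear (co i : B -> R^o),
      forall x, x = \sum_i co i x *: bas i
    & forall a : I -> R, forall i, co i (\sum_j a j *: bas j) = a i].
Proof.
have [hb _ _] := hD.
have [c cP] := choice (fun x => hb x).
have cE x : x = \sum_i c x i *: bas i by case: (cP x).
have cU x (a : I -> R) : x = \sum_i a i *: bas i -> forall i, c x i = a i.
  move=> e i; have [_ u] := cP x.
  rewrite (u [ffun i => a i]) ?ffunE //.
  by rewrite [LHS]e; apply: eq_bigr => j _; rewrite ffunE.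
exists (fun i x => c x i); split=> //; last by move=> a i; apply: cU.
move=> i a x y; apply: (cU (a *: x + y) (fun i => a * c x i + c y i)).
rewrite [in LHS](cE x) [in LHS](cE y) scaler_sumr -big_split /=.
by apply: eq_bigr => j _; rewrite scalerDl scalerA.
Qed.

Lemma cell_ideal_sub (G G' : pred L) x : (forall l, G l -> G' l) ->
  cell_ideal G x -> cell_ideal G' x.
Proof.
move=> h; apply: lspan_sub => {}x [l [p [q [gl ->]]]].
by apply: lspan_gen; exists l, p, q; split=> //; apply: h.
Qed.

Lemma cell_ideal_coord (co : I -> B -> R) (G : pred L) x :
  (forall i, linear (co i : B -> R^o)) ->
  (forall a : I -> R, forall i, co i (\sum_j a j *: bas j) = a i) ->
  cell_ideal G x -> forall i : I, ~~ G (tag i) -> co i x = 0.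
Proof.
move=> hl hu hx i gi; move: x hx; apply: lspan_elim.
- exact: (lin0 (hl i)).
- by move=> a x y hx hy; rewrite hl hx hy addr0 scaler0.
move=> _ [l [p [q [gl ->]]]] /=.
have -> : cd_c p q = \sum_j (j == bI p q)%:R *: bas j.
  rewrite (bigD1 (bI p q)) //= eqxx scale1r big1 ?addr0 // => j /negPf ->.
  by rewrite scale0r.
rewrite hu; case: eqP => // e; move: gi; rewrite e /= gl //.
Qed.

Lemma cell_ideal_mulr (G : pred L) x y : upset G ->
  cell_ideal G x -> cell_ideal G (x *a y).
Proof.
move=> hG; move: x; apply: (@lspan_morph _ _ _ (fun x => x *a y)).
  exact: amul_linl.
move=> _ [l [p [q [gl ->]]]].
have [_ hm _] := hD; have [r hr] := hm l q y.
rewrite -[cd_c p q *a y](subrK (\sum_v r v *: cd_c p v)).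
apply: ssD; last first.
  by apply: ss_sum => v _; apply/ssZ/lspan_gen; exists l, p, v.
apply: cell_ideal_sub (hr p) => l' ll'; exact: hG (ltW ll') gl.
Qed.

Lemma cell_ideal_star (G : pred L) x : cell_ideal G x -> cell_ideal G (star x).
Proof.
apply: lspan_morph star_lin _ _ => _ [l [p [q [gl ->]]]].
by have [_ _ ->] := hD; apply: lspan_gen; exists l, q, p.
Qed.

(** The multiplication rule only speaks of products on the right; the
    involution carries it to the left. *)
Lemma cell_ideal_mull (G : pred L) x y : upset G ->
  cell_ideal G x -> cell_ideal G (y *a x).
Proof.
move=> hG hx; rewrite -[_ *a _]star_inv star_mul.
by apply/cell_ideal_star/cell_ideal_mulr => //; apply: cell_ideal_star.
Qed.

Hypothesis hss : split_semisimple (ext B).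

(** The identity of the extended cell ideal, with its denominator cleared. *)
Lemma cell_ideal_unit (G : pred L) : upset G ->
  exists r eps, [/\ r != 0, cell_ideal G eps, forall x, eps *a x = x *a eps
                  & forall x, cell_ideal G x -> x *a eps = r *: x].
Proof.
move=> hG.
(* The ideal of the extended algebra, by common denominators. *)
pose J : set (ext B) := fun z => exists (x : B) (c : R),
  [/\ c != 0, cell_ideal G x & z = epure x (tofrac c)^-1].
have JP : is_lsubspace J.
  split; first by exists 0, 1; split; rewrite ?oner_neq0 ?epure0 //; exact: ss0.
  move=> a _ _ [x [c [c0 hx ->]]] [y [d [d0 hy ->]]].
  have [n [e [e0 ->]]] := fraction_repr a.
  exists (n * d *: x + c * e *: y), (c * e * d); split.
  - by rewrite !mulf_neq0.
  - by apply: ssD; apply: ssZ.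
  have [c0' d0' e0'] : [/\ tofrac c != 0, tofrac d != 0 & tofrac e != 0].
    by rewrite !tofrac_eq0.
  rewrite ext_scale_pure epureD !epureZ !tofracM.
  by rewrite (common_denominator _ c0' d0' e0').1 (common_denominator _ c0' d0' e0').2.
have hJR x y : J x -> J (x *a y).
  move=> [x' [c [c0 hx ->]]]; have [y' [d [d0 ->]]] := ext_common_denom y.
  exists (x' *a y'), (c * d); split; first exact: mulf_neq0.
    exact: cell_ideal_mulr.
  by rewrite ext_mulE tofracM invfM.
have hJL x y : J x -> J (y *a x).
  move=> [x' [c [c0 hx ->]]]; have [y' [d [d0 ->]]] := ext_common_denom y.
  exists (y' *a x'), (d * c); split; first exact: mulf_neq0.
    exact: cell_ideal_mull.
  by rewrite ext_mulE tofracM invfM.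
have [co [co_lin coE coU]] := cell_coord_exists.
have inj (x : B) a : a != 0 -> epure x a = 0 -> x = 0.
  move=> a0 h; rewrite (coE x) big1 // => i _.
  by rewrite (epure_eq0 (co_lin i) a0 h) scale0r.
have injB (x y : B) a : a != 0 -> epure x a = epure y a -> x = y.
  move=> a0 h; apply/eqP; rewrite -subr_eq0; apply/eqP; apply: inj a0 _.
  by rewrite epureD h -epureD subrr epure0.
have [_ [[eps [r [r0 he ->]]] ec ex]] :=
  @split_semisimple_ideal _ _ (LSubspace JP) hss hJR hJL.
have r0' : (tofrac r)^-1 != 0 by rewrite invr_eq0 tofrac_eq0.
exists r, eps; split=> //.
  move=> x; have := ec (epure x 1); rewrite !ext_mulE mul1r mulr1.
  exact: injB.
move=> x hx; have /ex : J (epure x 1).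
  by exists x, 1; split; rewrite ?oner_neq0 ?tofrac1 ?invr1.
rewrite ext_mulE mul1r => e; apply: (injB _ _ _ r0'); rewrite e.
by rewrite epureZ mulfV // tofrac_eq0.
Qed.
End CellIdeals.
Arguments cell_ideal : simpl never.

(** * Cellular bases of the form d_s u_t *)

Section Factored.
Variables (R : idomainType) (B : ualgType R) (D : cell_datum B) (star : B -> B).
Hypothesis hD : is_cellular D star.
Hypothesis star_lin : linear star.
Hypothesis star_mul : forall x y, star (x *a y) = star y *a star x.
Hypothesis star_inv : involutive star.
Hypothesis hss : split_semisimple (ext B).

Local Notation L := (cd_lam D).
Local Notation gt l := (fun l' : L => (l < l')%O).
Local Notation ge l := (fun l' : L => (l <= l')%O).

Variables d u : forall l : L, cd_std l -> B.
Hypothesis cE : forall l (p q : cd_std l), cd_c p q = d p *a u q.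
Hypothesis u_stable : forall l (t : cd_std l) b, exists a : cd_std l -> R,
  cell_ideal (gt l) (u t *a b - \sum_v a v *: u v).
Hypothesis u_ge : forall l (t : cd_std l), cell_ideal (ge l) (u t).
Hypothesis u_free : forall l (a : cd_std l -> R),
  cell_ideal (gt l) (\sum_t a t *: u t) -> forall t, a t = 0.

Lemma upset_gt (l : L) : upset (gt l).
Proof. by move=> l1 l2 h1 h2; exact: lt_le_trans h2 h1. Qed.
Lemma upset_ge (l : L) : upset (ge l).
Proof. by move=> l1 l2 h1 h2; exact: le_trans h2 h1. Qed.

Let I : finType := {l : L & (cd_std l * cd_std l)%type}.
Let bas (i : I) : B := cd_c (tagged i).1 (tagged i).2.
Let bI (l : L) (s t : cd_std l) : I := Tagged (fun l => (cd_std l * cd_std l)%type) (s, t).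

Let bI_eq l (s t s' t' : cd_std l) : (bI s t == bI s' t') = (s == s') && (t == t').
Proof. by rewrite -tag_eqE /tag_eq eqxx tagged_asE. Qed.

Let bas_sum (i : I) : bas i = \sum_j (j == i)%:R *: bas j.
Proof.
rewrite (bigD1 i) //= eqxx scale1r big1 ?addr0 // => j /negPf ->.
by rewrite scale0r.
Qed.

(** Multiplying u_t x by d_t on the left lands in the ideal of G, so its
    coordinates at l vanish; these are the coordinates of u_t x in the cell
    module of l, which is therefore annihilated by x. *)
Lemma cell_ideal_kill (G : pred L) l (t : cd_std l) x : upset G -> ~~ G l ->
  cell_ideal G x -> cell_ideal (gt l) (u t *a x).
Proof.
move=> hG nG hx; have [a ha] := u_stable t x.
have [co [co_lin coE coU]] := cell_coord_exists hD.
suff a0 v : a v = 0.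
  by move: ha; rewrite big1 ?subr0 // => v _; rewrite a0 scale0r.
have h1 : co (bI t v) (d t *a (u t *a x)) = 0.
  apply: (cell_ideal_coord co_lin coU _ nG).
  by do 2!apply: (cell_ideal_mull hD star_lin star_mul star_inv _ hG).
have := cell_ideal_mull hD star_lin star_mul star_inv (d t) (@upset_gt l) ha.
move/(cell_ideal_coord co_lin coU)/(_ (bI t v)); rewrite /= ltxx => /(_ isT).
rewrite amulBr (linD (co_lin _)) h1 (linN (co_lin _)) add0r amul_sumr.
rewrite (lin_sum _ _ (co_lin _)) (bigD1 v) //= big1 ?addr0; last first.
  move=> w wv; rewrite amulZr -cE (linZ (co_lin _)).
  by rewrite [cd_c t w](bas_sum (bI t w)) coU bI_eq eqxx /= eq_sym (negPf wv) scaler0.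
rewrite amulZr -cE (linZ (co_lin _)) [cd_c t v](bas_sum (bI t v)) coU eqxx.
by move/eqP; rewrite oppr_eq0 [_ == _]mulf_eq0 oner_eq0 orbF => /eqP.
Qed.

Lemma cell_ideal_ge_split l x : cell_ideal (ge l) x ->
  exists e : cd_std l -> cd_std l -> R,
    cell_ideal (gt l) (x - \sum_p \sum_q e p q *: cd_c p q).
Proof.
move: x; apply: lspan_elim.
- exists (fun _ _ => 0); rewrite big1 ?subr0; first exact: ss0.
  by move=> p _; rewrite big1 // => q _; rewrite scale0r.
- move=> a x y [e he] [e' he']; exists (fun p q => a * e p q + e' p q).
  rewrite (_ : _ - _ = a *: (x - \sum_p \sum_q e p q *: cd_c p q) +
    (y - \sum_p \sum_q e' p q *: cd_c p q)).
    by apply: ssD => //; apply: ssZ.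
  rewrite scalerBr addrACA -opprD scaler_sumr -big_split; congr (_ - _).
  apply: eq_bigr => p _; rewrite scaler_sumr -big_split; apply: eq_bigr => q _.
  by rewrite scalerDl scalerA.
move=> _ [l' [p [q [ll' ->]]]].
have [e|ne] := eqVneq l l'.
  subst l'; exists (fun p' q' => ((p' == p) && (q' == q))%:R).
  rewrite (bigD1 p) //= [X in _ - (_ + X)]big1 ?addr0; last first.
    by move=> p' /negPf ->; rewrite big1 // => q' _; rewrite scale0r.
  rewrite (bigD1 q) //= big1 ?addr0 ?eqxx ?scale1r ?subrr; first exact: (ss0 (cell_ideal (gt l))).
  by move=> q' /negPf ->; rewrite /= scale0r.
exists (fun _ _ => 0); rewrite big1 ?subr0.
  by apply: lspan_gen; exists l', p, q; split; rewrite // lt_neqAle ne.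
by move=> p' _; rewrite big1 // => q' _; rewrite scale0r.
Qed.

(** The bilinear form of the cell module. After multiplication by d_s, the
    coefficients of u_t c_pq are those of c_st c_pq. Computed from the right
    they do not depend on s; computed through the involution from the left,
    they do not depend on q and only c_sq occurs. *)
Lemma cell_form l : exists g : cd_std l -> cd_std l -> R,
  forall t p q, cell_ideal (gt l) (u t *a cd_c p q - g t p *: u q).
Proof.
have [t0 _|c0] := pickP (@predT (cd_std l)); last first.
  by exists (fun _ _ => 0) => t; have := c0 t.
have [co [co_lin coE coU]] := cell_coord_exists hD.
have ex (x : B * cd_std l) : exists a : cd_std l -> R,
  cell_ideal (gt l) (u x.2 *a x.1 - \sum_v a v *: u v) by exact: u_stable.
have [rr rrP] := choice ex.
(* The structure constants do not depend on the first index s. *)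
have rE s t b v : co (bI s v) (cd_c s t *a b) = rr (b, t) v.
  have := cell_ideal_mull hD star_lin star_mul star_inv (d s) (@upset_gt l) (rrP (b, t)).
  move/(cell_ideal_coord co_lin coU)/(_ (bI s v)); rewrite /= ltxx => /(_ isT).
  rewrite amulBr amulA -cE (linD (co_lin _)) (linN (co_lin _)) => /eqP.
  rewrite subr_eq0 => /eqP ->; rewrite amul_sumr.
  rewrite (lin_sum _ _ (co_lin _)) (bigD1 v) //= big1 ?addr0; last first.
    move=> w wv; rewrite amulZr -cE (linZ (co_lin _)).
    by rewrite [cd_c s w](bas_sum (bI s w)) coU bI_eq eqxx /= eq_sym (negPf wv) scaler0.
  rewrite amulZr -cE (linZ (co_lin _)) [cd_c s v](bas_sum (bI s v)) coU eqxx.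
  exact: mulr1.
have coS s t x : co (bI s t) (star x) = co (bI t s) x.
  have [_ _ hst] := hD.
  pose tr (i : I) : I := bI (tagged i).2 (tagged i).1.
  have trK : involutive tr by case=> k [p q].
  rewrite [in LHS](coE x) (lin_sum _ _ star_lin).
  rewrite (eq_bigr (fun i => co i x *: bas (tr i))); last first.
    by move=> i _; rewrite (linZ star_lin) /bas hst.
  rewrite (reindex_inj (inv_inj trK)) /=.
  by under eq_bigr => i _ do rewrite trK; rewrite coU.
(* Compute c_st c_pq once from the right and once, by the involution, from the
   left. *)
have key t p q v : rr (cd_c p q, t) v = (v == q)%:R * rr (cd_c t t0, p) t0.
  have [_ _ hst] := hD.
  rewrite -(rE t0) -[_ *a _]star_inv coS star_mul !hst.
  have := cell_ideal_mull hD star_lin star_mul star_inv (d q) (@upset_gt l) (rrP (cd_c t t0, p)).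
  move/(cell_ideal_coord co_lin coU)/(_ (bI v t0)); rewrite /= ltxx => /(_ isT).
  rewrite amulBr amulA -cE (linD (co_lin _)) (linN (co_lin _)) => /eqP.
  rewrite subr_eq0 => /eqP ->; rewrite amul_sumr.
  rewrite (lin_sum _ _ (co_lin _)) (bigD1 t0) //= big1 ?addr0; last first.
    move=> w wv; rewrite amulZr -cE (linZ (co_lin _)).
    by rewrite [cd_c q w](bas_sum (bI q w)) coU bI_eq [t0 == w]eq_sym (negPf wv) andbF scaler0.
  rewrite amulZr -cE (linZ (co_lin _)) [cd_c q t0](bas_sum (bI q t0)) coU bI_eq eqxx andbT.
  exact: mulrC.
exists (fun t p => rr (cd_c t t0, p) t0) => t p q.
have := rrP (cd_c p q, t); rewrite /= (bigD1 q) //= big1 ?addr0.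
  by rewrite key eqxx mul1r.
by move=> v vq; rewrite key (negPf vq) mul0r scale0r.
Qed.

(** Since the extended algebra is semisimple, the form is nondegenerate; in
    other words, the cell ideal acts on the cell module by all the matrix
    units, up to a common denominator r. *)
Lemma cell_matrix_units l (t0 : cd_std l) : exists r eps (a : cd_std l -> B),
  [/\ r != 0, cell_ideal (ge l) eps, forall x, eps *a x = x *a eps,
      forall x, cell_ideal (ge l) x -> x *a eps = r *: x
    & (forall q, cell_ideal (ge l) (a q)) /\
      forall t q, cell_ideal (gt l) (u t *a a q - (t == t0)%:R * r *: u q)].
Proof.
have [r [eps [r0 he ec ex]]] :=
  cell_ideal_unit hD star_lin star_mul star_inv hss (@upset_ge l).
have [e hse] := cell_ideal_ge_split he.
have [g hg] := cell_form l.
(* The coefficients e of the unit form r times the inverse of the Gram matrix. *)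
have ge_eq t q : \sum_p e p q * g t p = (t == q)%:R * r.
  apply/eqP; rewrite -subr_eq0; apply/eqP; move: q.
  apply: (u_free (a := fun q => \sum_p e p q * g t p - (t == q)%:R * r)).
  have h1 : \sum_q ((t == q)%:R * r) *: u q = u t *a eps.
    rewrite ex //.
    rewrite (bigD1 t) //= eqxx mul1r big1 ?addr0 // => q.
    by rewrite eq_sym => /negPf ->; rewrite mul0r scale0r.
  under eq_bigr => q _ do rewrite scalerBl.
  rewrite big_split /= sumrN h1 -opprB -[X in - (X - _)](subrK
    (u t *a (\sum_p \sum_q e p q *: cd_c p q))) -amulBr -addrA.
  apply/ssN/ssD; first exact: (cell_ideal_mull hD star_lin star_mul star_inv _ (@upset_gt l)).
  rewrite amul_sumr; under [X in _ - X]eq_bigr => q _ do rewrite scaler_suml.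
  rewrite exchange_big /= -sumrB; apply: ss_sum => p _.
  rewrite amul_sumr -sumrB; apply: ss_sum => q _.
  by rewrite amulZr -scalerA -scalerBr; apply/ssZ/hg.
exists r, eps, (fun q => \sum_p e p t0 *: cd_c p q); split=> //; split.
  by move=> q; apply: ss_sum => p _; apply/ssZ/lspan_gen; exists l, p, q.
move=> t q; rewrite -ge_eq scaler_suml amul_sumr -sumrB; apply: ss_sum => p _.
by rewrite amulZr -scalerA -scalerBr; apply/ssZ/hg.
Qed.
End Factored.

(** * Lattices spanned by part of a basis *)

Section PartialSpan.
Variables (R : idomainType) (V : lmodType R) (I : finType) (U : I -> V).
Variable K : lsubspace V.

(** K plays the role of the zero of a quotient in which the U i form a basis;
    staying above the quotient avoids choosing representatives. *)
Definition pspan_set (P : pred I) : set V := fun y =>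
  exists a : I -> R, K (y - \sum_(i | P i) a i *: U i).

Fact pspan_subproof P : is_lsubspace (pspan_set P).
Proof.
split=> [|c x y [a ha] [b hb]].
  exists (fun=> 0); rewrite big1 ?subr0; first exact: ss0.
  by move=> i _; rewrite scale0r.
exists (fun i => c * a i + b i).
rewrite (_ : _ - _ = c *: (x - \sum_(i | P i) a i *: U i) +
  (y - \sum_(i | P i) b i *: U i)); first by apply: ssD => //; apply: ssZ.
rewrite scalerBr addrACA -opprD scaler_sumr -big_split; congr (_ - _).
by apply: eq_bigr => i _; rewrite scalerDl scalerA.
Qed.
Definition pspan P : lsubspace V := LSubspace (pspan_subproof P).

Lemma pspanK P x : K x -> pspan P x.
Proof.
move=> hx; exists (fun=> 0); rewrite big1 ?subr0 // => i _.
by rewrite scale0r.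
Qed.

Lemma pspan_gen (P : pred I) i : P i -> pspan P (U i).
Proof.
move=> hi; exists (fun j => (j == i)%:R).
rewrite (bigD1 i) //= eqxx scale1r big1 ?addr0 ?subrr; first exact: ss0.
by move=> j /andP[_ /negPf ->]; rewrite scale0r.
Qed.

Lemma pspan_min (P : pred I) (X : lsubspace V) : (forall x, K x -> X x) ->
  (forall i, P i -> X (U i)) -> forall x, pspan P x -> X x.
Proof.
move=> hK hU x [a ha]; rewrite -[x](subrK (\sum_(i | P i) a i *: U i)).
by apply: ssD; [exact: hK|apply: ss_sum => i hi; apply/ssZ/hU].
Qed.

Lemma pspan_sub (P Q : pred I) x : (forall i, P i -> Q i) ->
  pspan P x -> pspan Q x.
Proof.
move=> h; apply: pspan_min => [{}x|i hi]; first exact: pspanK.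
by apply: pspan_gen; apply: h.
Qed.

Lemma pspan0 x : pspan pred0 x -> K x.
Proof. by apply: pspan_min. Qed.

Hypothesis free : forall a : I -> R, K (\sum_i a i *: U i) -> forall i, a i = 0.

(** Freeness makes these lattices saturated. This is what brings arguments
    over the field of fractions back to R: an element known to lie in such a
    lattice after multiplication by a nonzero scalar lies in it. *)
Lemma pspan_sat (P : pred I) c v : c != 0 -> pspan predT v ->
  pspan P (c *: v) -> pspan P v.
Proof.
move=> c0 [a ha] [b hb].
have h : K (\sum_i (c * a i - (if P i then b i else 0)) *: U i).
  rewrite (_ : \sum_i _ = (c *: v - \sum_(i | P i) b i *: U i) -
    c *: (v - \sum_i a i *: U i)); first by apply: ssB => //; apply: ssZ.
  rewrite scalerBr opprB [RHS]addrC addrA subrK scaler_sumr [X in _ - X]big_mkcond /= -sumrB.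
  apply: eq_bigr => i _; rewrite scalerBl scalerA; congr (_ - _).
  by case: ifP => // _; rewrite scale0r.
exists a; move: ha; rewrite (bigID P) /= [\sum_(i | ~~ P i) _]big1 ?addr0 //.
move=> i nP; have /eqP := free h i; rewrite (negPf nP) subr0 mulf_eq0 (negPf c0).
by move=> /eqP ->; rewrite scale0r.
Qed.

Lemma pspan_satK c v : c != 0 -> pspan predT v -> K (c *: v) -> K v.
Proof.
move=> c0 hv hc; apply: pspan0; apply: pspan_sat c0 hv _; exact: pspanK.
Qed.
End PartialSpan.

(** * The skew cell module as a module of homomorphisms *)

(** The situation of the skew cell module with the towers stripped off. Bm, Bs
    and Br are the algebras of levels m, s and s + m, and f and g the inclusions
    of the two tensor factors. The U i are the Murphy basis elements of the cell
    module of nu modulo the ideal K; the path i starts with a path whose element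
    is ut i, and tr i is that path if it ends at la. The u j are the elements of
    the paths to la, Jm is the ideal of the labels above la, and e0 is its unit
    multiplied by r0. The element e1 is likewise the unit of the ideal of the
    labels greater than or equal to la, multiplied by r, and the a q are r
    times the matrix units of the cell module of la out of t0. The predicates P0 and P1
    select the paths whose vertex on level m is above la, strictly or weakly. *)
Section SkewCore.
Variables (R : idomainType) (Bm Bs Br : ualgType R).
Variables (f : algHom Bm Br) (g : algHom Bs Br).
Hypothesis fgC : forall b c, f b *a g c = g c *a f b.

Variables (I : finType) (U : I -> Br) (K : lsubspace Br).
Local Notation path_span P := (pspan U K P).
Hypothesis K_right : forall x b, K x -> K (x *a b).
Hypothesis V_right : forall x b, path_span predT x -> path_span predT (x *a b).
Hypothesis U_free : forall a : I -> R, K (\sum_i a i *: U i) -> forall i, a i = 0.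

Variables (J : finType) (u : J -> Bm) (Jm : lsubspace Bm).
Hypothesis Jm_right : forall x b, Jm x -> Jm (x *a b).

Variables (r0 : R) (e0 : Bm).
Hypothesis r0_neq0 : r0 != 0.
Hypothesis e0_in : Jm e0.
Hypothesis e0_central : forall x, e0 *a x = x *a e0.
Hypothesis e0_unit : forall x, Jm x -> x *a e0 = r0 *: x.

Variables (r : R) (e1 : Bm) (a : J -> Bm) (t0 : J).
Hypothesis r_neq0 : r != 0.
Hypothesis a_unit : forall q, e1 *a a q = r *: a q.
Hypothesis a_mx : forall t q, Jm (u t *a a q - (t == t0)%:R * r *: u q).

Variables (P0 P1 : pred I) (usk : I -> Br) (ut : I -> Bm) (tr : I -> option J).
Hypothesis U_fact : forall i, U i = usk i *a f (ut i).
Hypothesis P0P : forall i, P0 i -> Jm (ut i).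
Hypothesis trP : forall i j, tr i = Some j -> ut i = u j.
Hypothesis P1P : forall i, P1 i -> P0 i \/ exists j, tr i = Some j.
Hypothesis V_e0 : forall v, path_span predT v -> path_span P0 (v *a f e0).
Hypothesis V_e1 : forall v, path_span predT v -> path_span P1 (v *a f e1).

Definition skew_pred : pred I := fun i => P0 i || (tr i == Some t0).
Local Notation PX := skew_pred.

Let uspT P x : path_span P x -> path_span predT x.
Proof. exact: pspan_sub. Qed.

Lemma low_e0 y : path_span P0 y -> K (y *a f e0 - r0 *: y).
Proof.
case=> b hb; rewrite -[y](subrK (\sum_(i | P0 i) b i *: U i)).
set x := y - _ in hb *; rewrite amulDl scalerDr opprD addrACA; apply: ssD.
  by apply: ssB; [exact: K_right|exact: ssZ].
rewrite amul_suml scaler_sumr -sumrB big1; first exact: ss0.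
move=> i hi; rewrite amulZl U_fact -amulA -ah_mul (e0_unit (P0P hi)).
by rewrite (linZ (ah_lin f)) amulZr scalerA mulrC -scalerA subrr.
Qed.

Lemma low_crit v : path_span predT v -> K (v *a f e0 - r0 *: v) -> path_span P0 v.
Proof.
move=> hv hK; apply: (pspan_sat U_free r0_neq0 hv).
rewrite -[_ *: _](subKr (v *a f e0)); apply: ssB; first exact: V_e0.
exact: pspanK.
Qed.

Lemma low_act v b : f e0 *a b = b *a f e0 -> path_span P0 v -> path_span P0 (v *a b).
Proof.
move=> eb hv; apply: low_crit; first by apply: V_right; apply: uspT hv.
by rewrite -amulA -eb amulA -amulZl -amulBl; apply/K_right/low_e0.
Qed.

Lemma e0_f x : f e0 *a f x = f x *a f e0.
Proof. by rewrite -!ah_mul e0_central. Qed.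

(** Used for skew products y = usk i, which by themselves need not lie in the
    span of the U i. *)
Lemma low_mul y x : Jm x -> path_span predT (y *a f x) -> path_span P0 (y *a f x).
Proof.
move=> hx hy; apply: low_crit => //.
rewrite -amulA -ah_mul e0_unit // (linZ (ah_lin f)) amulZr subrr.
exact: ss0.
Qed.

Let usp_U i : path_span predT (U i).
Proof. exact: pspan_gen. Qed.

(** U i is usk i * f (u j), and the product of u j and a t0 is known up to an
    element x of Jm; the error usk i * f x is controlled by low_mul. *)
Lemma unit_act i j : tr i = Some j ->
  path_span P0 (U i *a f (a t0) - (j == t0)%:R * r *: U i).
Proof.
move=> /trP e.
have hx : Jm (u j *a a t0 - (j == t0)%:R * r *: u j).
  have := a_mx j t0; case: eqP => [->//|_].
  by rewrite !mul0r !scale0r.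
have hE : U i *a f (a t0) - (j == t0)%:R * r *: U i =
    usk i *a f (u j *a a t0 - (j == t0)%:R * r *: u j).
  rewrite (linD (ah_lin f)) (linN (ah_lin f)) (linZ (ah_lin f)) ah_mul.
  by rewrite amulBr amulZr amulA U_fact e.
rewrite hE; apply: low_mul => //; rewrite -hE.
by apply: ssB; [apply: V_right|apply: ssZ]; exact: usp_U.
Qed.

Lemma low_skew x : path_span P0 x -> path_span PX x.
Proof. by apply: pspan_sub => i hi; rewrite /PX hi. Qed.

(** The factor a t0 lies in the ideal on which e1 is the scalar r, so v may be
    replaced by its image under e1, which is spanned by P1; there the action of
    a t0 is known. *)
Lemma unit_img v : path_span predT v -> path_span PX (v *a f (a t0)).
Proof.
move=> hv; apply: (pspan_sat U_free r_neq0); first exact: V_right.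
rewrite -amulZr -(linZ (ah_lin f)) -a_unit ah_mul amulA.
have [b hb] := V_e1 hv.
rewrite -[v *a f e1](subrK (\sum_(i | P1 i) b i *: U i)) amulDl.
apply: ssD; first by apply/pspanK/K_right.
rewrite amul_suml; apply: ss_sum => i hi; rewrite amulZl; apply: ssZ.
have [hi0|[j hj]] := P1P hi.
  by apply: low_skew; apply: low_act (e0_f _) _; apply: pspan_gen.
rewrite -[_ *a _](subrK ((j == t0)%:R * r *: U i)); apply: ssD.
  by apply: low_skew; apply: unit_act.
have [e|_] := eqVneq j t0; last by rewrite mul0r scale0r; apply: ss0.
by apply/ssZ/pspan_gen; rewrite /PX hj e eqxx orbT.
Qed.

Lemma e0_g b : f e0 *a g b = g b *a f e0.
Proof. exact: fgC. Qed.

Lemma low_right y b : path_span P0 y -> path_span P0 (y *a g b).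
Proof. by apply: low_act; apply: e0_g. Qed.

(** A path through t0 is, up to r, its own image under f (a t0), and f (a t0)
    commutes with g b; so U i * g b is an image under f (a t0) as well. *)
Lemma skew_right y b : path_span PX y -> path_span PX (y *a g b).
Proof.
case=> c hc; rewrite -[y](subrK (\sum_(i | PX i) c i *: U i)) amulDl.
apply: ssD; first by apply/pspanK/K_right.
rewrite amul_suml; apply: ss_sum => i; rewrite amulZl => hi; apply: ssZ.
have /orP[hi0|/eqP ht] := hi.
  by apply/low_skew/low_right/pspan_gen.
apply: (pspan_sat U_free r_neq0); first exact/V_right/usp_U.
rewrite -amulZl -[r *: _](subKr (U i *a f (a t0))) amulBl -amulA fgC amulA.
apply: ssB; first exact/unit_img/V_right/usp_U.
apply/low_skew/low_right; have := unit_act ht.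
by rewrite eqxx mul1r.
Qed.

(** Over the field of fractions and modulo K, right multiplication by e0 / r0 is
    idempotent with image the span of P0; so this is, up to the scalar r0, the
    projection onto a complement of that span. *)
Definition cut (y : Br) : Br := r0 *: y - y *a f e0.

Lemma cutP c x y : cut (c *: x + y) = c *: cut x + cut y.
Proof.
rewrite /cut scalerDr amulDl opprD addrACA scalerBr amulZl.
by rewrite !scalerA mulrC.
Qed.

Lemma cutB x y : cut (x - y) = cut x - cut y.
Proof. by rewrite addrC -scaleN1r cutP scaleN1r addrC. Qed.

Lemma cut_low y : path_span P0 y -> K (cut y).
Proof. by move=> hy; rewrite /cut -opprB; apply/ssN/low_e0. Qed.

Lemma cut_V y : path_span predT y -> path_span predT (cut y).
Proof. by move=> hy; apply: ssB; [apply: ssZ|apply: V_right]. Qed.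

Lemma cut_g y b : cut (y *a g b) = cut y *a g b.
Proof. by rewrite /cut amulBl amulZl -!amulA fgC. Qed.

(** The well-definedness of the pairing. For a path i that starts with t0, the product
    U i * f z is usk i * f (u_(t0) z), and u_(t0) z lies in the ideal Jm, on
    which e0 acts as the scalar r0; hence the cut of U i * f z vanishes. *)
Lemma cut_annihilated y z : Jm (u t0 *a z) -> path_span PX y -> K (cut y *a f z).
Proof.
move=> hz [c hc]; rewrite -[y](subrK (\sum_(i | PX i) c i *: U i)).
rewrite -[X in cut (X + _)]scale1r cutP scale1r amulDl; apply: ssD.
  by apply/K_right/cut_low/pspanK.
have -> : cut (\sum_(i | PX i) c i *: U i) = \sum_(i | PX i) c i *: cut (U i).
  elim/big_rec2: _ => [|i x' x _ <-]; last by rewrite cutP.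
  by rewrite /cut scaler0 amul0l subrr.
rewrite amul_suml; apply: ss_sum => i; rewrite amulZl => hi; apply: ssZ.
have /orP[hi0|/eqP ht] := hi; first exact/K_right/cut_low/pspan_gen.
rewrite /cut amulBl amulZl U_fact (trP ht) -!amulA -!ah_mul e0_central.
rewrite amulA e0_unit // (linZ (ah_lin f)) amulZr subrr; exact: ss0.
Qed.

Variables (X1 : lsubspace Bm) (M1 : rmod Bm) (p1 : Bm -> M1).
Hypothesis X1E : forall x, X1 x <-> pspan u Jm predT x.
Hypothesis X1_right : forall x b, X1 x -> X1 (x *a b).
Hypothesis hp1 : @presents _ _ (reg_rmod Bm) M1 X1 Jm p1.

Variables (M3 : rmod Br) (p3 : Br -> M3).
Hypothesis hp3 : @presents _ _ (reg_rmod Br) M3 (path_span predT) K p3.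

Variables (S : rmod Bs) (pS : Br -> S).
Hypothesis hpS : @presents _ _ (res_rmod g (reg_rmod Br)) S (path_span PX) (path_span P0) pS.

Let u_X1 t : X1 (u t).
Proof. by apply/X1E/pspan_gen. Qed.

(** The matrix units send u_(t0) to multiples of all the basis elements. *)
Lemma gen_exists z : exists b, p1 (u t0 *a b) = r *: z.
Proof.
have [v hv <-] := pres_surj hp1 z; have /X1E[c hc] := hv.
exists (\sum_j c j *: a j); rewrite -(presZ hp1) //.
apply/(pres_eq hp1); [exact: X1_right|exact: ssZ|].
rewrite -[v](subrK (\sum_j c j *: u j)) scalerDr opprD addrCA.
apply: ssD; first by apply/ssN/ssZ.
rewrite amul_sumr scaler_sumr -sumrB; apply: ss_sum => j _.
have := ssZ (c j) (a_mx t0 j); rewrite eqxx mul1r scalerBr amulZr.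
by rewrite !scalerA mulrC.
Qed.

(** The value theta q z is computed from a lift y of q and from b with
    u_(t0) b = r z: send the generator to the cut of y and extend. *)
Lemma skew_pairing : exists theta : S -> M1 -> M3,
  forall y q z b, path_span PX y -> pS y = q -> p1 (u t0 *a b) = r *: z ->
    theta q z = p3 (cut y *a f b).
Proof.
have [yf yfP] := choice (fun q => let: ex_intro2 y h1 h2 := pres_surj hpS q in
  ex_intro (fun y => path_span PX y /\ pS y = q) y (conj h1 h2)).
have [bf bfP] := choice gen_exists.
exists (fun q z => p3 (cut (yf q) *a f (bf z))) => y q z b hy ey eb.
have [hy' ey'] := yfP q; have eb' := bfP z.
apply/(pres_eq hp3); [exact/V_right/cut_V/uspT/hy'|exact/V_right/cut_V/uspT/hy|].
rewrite -[cut (yf q) *a _](subrK (cut y *a f (bf z))) -addrA; apply: ssD.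
  have -> : cut (yf q) *a f (bf z) - cut y *a f (bf z) =
      cut (yf q - y) *a f (bf z).
    by rewrite -amulBl cutB.
  apply/K_right/cut_low; apply/(pres_eq hpS) => //.
  by rewrite ey' ey.
rewrite -amulBr -(linN (ah_lin f)) -(linD (ah_lin f)).
apply: cut_annihilated hy; rewrite amulBr; apply/(pres_eq hp1).
- exact: X1_right.
- exact: X1_right.
by rewrite eb' eb.
Qed.

Lemma skew_hom_pairing :
  exists z0 theta, @hom_pairing _ _ _ _ f g M1 S M3 z0 theta.
Proof.
have [th thE] := skew_pairing.
have liftS q : exists2 y, path_span PX y & pS y = q by exact: (pres_surj hpS).
have eb0 : p1 (u t0 *a (r *: aone Bm)) = r *: p1 (u t0).
  by rewrite amulZr amul1r (presZ hp1).
have cV y b : path_span PX y -> path_span predT (cut y *a b).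
  by move=> hy; apply/V_right/cut_V/uspT/hy.
have th0 y q : path_span PX y -> pS y = q -> th q (p1 (u t0)) = r *: p3 (cut y).
  move=> hy ey; rewrite (thE y q _ _ hy ey eb0) (linZ (ah_lin f)) ah_one.
  by rewrite amulZr amul1r (presZ hp3) //; apply/cut_V/uspT/hy.
exists (p1 (u t0)), th; split.
- split=> [z c q q'|q c z z'].
    have [b hb] := gen_exists z; have [y hy ey] := liftS q.
    have [y' hy' ey'] := liftS q'.
    rewrite (thE _ _ _ _ hy ey hb) (thE _ _ _ _ hy' ey' hb).
    rewrite (thE (c *: y + y') _ _ b _ _ hb).
    + by rewrite cutP amulDl amulZl (presP hp3) //; exact: cV.
    + exact: (ss_P (path_span PX)).2.
    + by rewrite (presP hpS) // ey ey'.
  have [y hy ey] := liftS q.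
  have [b hb] := gen_exists z; have [b' hb'] := gen_exists z'.
  rewrite (thE _ _ _ _ hy ey hb) (thE _ _ _ _ hy ey hb').
  rewrite (thE _ _ _ (c *: b + b') hy ey).
    rewrite (linD (ah_lin f)) (linZ (ah_lin f)) amulDr amulZr.
    by rewrite (presP hp3) //; exact: cV.
  rewrite amulDr amulZr (presP hp1) ?hb ?hb'; [|exact: X1_right..].
  by rewrite scalerDr !scalerA mulrC.
- move=> q z b; have [y hy ey] := liftS q; have [bz hb] := gen_exists z.
  rewrite (thE _ _ _ _ hy ey hb) (thE _ _ _ (bz *a b) hy ey).
    by rewrite ah_mul amulA (pres_act hp3) //; exact: cV.
  by rewrite amulA (pres_act hp1) ?hb ?ractZl //; exact: X1_right.
- move=> q z c; have [y hy ey] := liftS q; have [bz hb] := gen_exists z.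
  rewrite (thE _ _ _ _ hy ey hb) (thE (y *a g c) _ _ _ _ _ hb).
  + by rewrite cut_g -amulA -fgC amulA (pres_act hp3) //; exact: cV.
  + exact: skew_right.
  + by have := pres_act hpS c hy; rewrite ey => <-.
- move=> q; have [y hy ey] := liftS q; rewrite (th0 y) // => h.
  rewrite -ey; apply/(pres_ker hpS) => //; apply: low_crit; first exact: uspT hy.
  rewrite -opprB; apply: ssN.
  apply: (pspan_satK U_free r_neq0); first exact/cut_V/uspT/hy.
  apply/(pres_ker hp3); first exact/ssZ/cut_V/uspT/hy.
  by rewrite (presZ hp3) //; apply/cut_V/uspT/hy.
- move=> z; have [b hb] := gen_exists z; exists b, r; split=> //.
  by rewrite -(pres_act hp1).
- move=> w hw; have [v hv ev] := pres_surj hp3 w.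
  have rel b : Jm (u t0 *a b) -> K (v *a f b).
    move=> hb; apply/(pres_ker hp3); first exact: V_right.
    rewrite (pres_act hp3) // ev; apply: hw; rewrite -(pres_act hp1) //.
    by apply/(pres_ker hp1) => //; exact: X1_right.
  have h0 : K (v *a f e0).
    by apply: rel; rewrite -e0_central; apply: Jm_right.
  have h1 : K (v *a f (a t0) - r *: v).
    have := rel (a t0 - r *: aone Bm).
    rewrite amulBr amulZr amul1r (linD (ah_lin f)) (linN (ah_lin f)).
    rewrite (linZ (ah_lin f)) ah_one amulBr amulZr amul1r; apply.
    by have := a_mx t0 t0; rewrite eqxx mul1r.
  have hx := unit_img hv.
  exists (pS (v *a f (a t0))), (r * (r0 * r)); split; first by rewrite !mulf_neq0.
  rewrite (th0 (v *a f (a t0))) // -ev -scalerA -[RHS](_ : r *: p3 (r0 * r *: v) = _); last first.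
    by rewrite (presZ hp3).
  congr (_ *: _); apply/(pres_eq hp3); [exact/cut_V/uspT/hx|exact: ssZ|].
  rewrite /cut -amulA -e0_f amulA addrAC -scalerA -scalerBr; apply: ssB.
    exact: ssZ.
  exact: K_right.
move=> w hw.
have ex y : exists c : I -> R, p3 (\sum_i c i *: U i) = y.
  have [v [c hc] <-] := pres_surj hp3 y; exists c.
  have hS : path_span predT (\sum_i c i *: U i).
    by apply: ss_sum => i _; apply/ssZ/usp_U.
  have hv : path_span predT v by exists c.
  by symmetry; apply/(pres_eq hp3).
have [co coE] := choice ex.
have hS (c : I -> R) : path_span predT (\sum_i c i *: U i).
  by apply: ss_sum => i _; apply/ssZ/usp_U.
have col i : linear ((fun y => co y i) : M3 -> R^o).
  move=> c y y'; apply/eqP; rewrite -subr_eq0; apply/eqP.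
  apply: (U_free (a := fun i => co (c *: y + y') i - (c * co y i + co y' i))).
  have -> : \sum_i (co (c *: y + y') i - (c * co y i + co y' i)) *: U i =
      \sum_i co (c *: y + y') i *: U i -
      (c *: (\sum_i co y i *: U i) + \sum_i co y' i *: U i).
    rewrite scaler_sumr -big_split -sumrB; apply: eq_bigr => j _ /=.
    by rewrite scalerBl scalerDl scalerA.
  apply/(pres_eq hp3) => //; first exact: (ss_P (path_span predT)).2.
  by rewrite (presP hp3) // !coE.
rewrite -(coE w) big1 ?(pres0 hp3) // => i _.
by rewrite (hw _ (col i)) scale0r.
Qed.
End SkewCore.

(** * Splitting paths at a level *)

Lemma vseq_irr (dX : nat -> Order.disp_t)
    (X : forall k, finPOrderType (dX k)) n (t : vseq X n) k (p q : (k < n.+1)%N) :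
  t (Ordinal p) = t (Ordinal q).
Proof. by rewrite (bool_irrelevance p q). Qed.

Section PathWeights.
Variables (dX : nat -> Order.disp_t) (X : forall k, finPOrderType (dX k)).
Variables (E : forall k, X k -> X k.+1 -> bool) (n : nat).
Implicit Types t : vseq X n.

Lemma vsrcE t k (i : (k < n)%N) (p : (k < n.+1)%N) :
  vsrc t (Ordinal i) = t (Ordinal p).
Proof. exact (vseq_irr t _ p). Qed.

Lemma vtgtE t k (i : (k < n)%N) : vtgt t (Ordinal i) = t (Ordinal (i : (k.+1 < n.+1)%N)).
Proof. exact (vseq_irr t _ _). Qed.

Lemma is_pathP t : reflect
  (forall k (p : (k < n.+1)%N) (q : (k.+1 < n.+1)%N), E (t (Ordinal p)) (t (Ordinal q)))
  (is_path E t).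
Proof.
apply: (iffP forallP) => h.
  by move=> k p q; have := h (Ordinal (q : (k < n)%N)); rewrite (vsrcE _ _ p) vtgtE.
by case=> k i; rewrite (vsrcE _ _ (leqW i)) vtgtE; exact: h.
Qed.

Variables (S : pzRingType) (w : forall k, X k -> X k.+1 -> S).

(** Weights indexed by all natural numbers, with value 1 past the end of the
    path, so that a product along a path splits with the interval of indices. *)
Definition edge_weight t (k : nat) : S :=
  match insub k : option 'I_n with
  | Some i => w (vsrc t i) (vtgt t i)
  | None => 1
  end.

Lemma edge_weightE t k (p : (k < n.+1)%N) (q : (k.+1 < n.+1)%N) :
  edge_weight t k = w (t (Ordinal p)) (t (Ordinal q)).
Proof.
rewrite /edge_weight (insubT (fun k => k < n)%N (q : (k < n)%N)).
by rewrite (vsrcE _ _ p) vtgtE.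
Qed.

Lemma prod_downE t :
  prod_down X w t = \prod_(k <- rev (iota 0 n)) edge_weight t k.
Proof.
rewrite /prod_down -val_enum_ord -map_rev big_map; apply: eq_bigr => i _.
by rewrite /edge_weight valK.
Qed.
End PathWeights.

Section PathSplitting.
Variables (dX : nat -> Order.disp_t) (X : forall k, finPOrderType (dX k)).

Fact vskew_lt m s (i : 'I_s.+1) : (i + m < (s + m).+1)%N.
Proof. by rewrite ltnS leq_add2r -ltnS. Qed.
Fact vtrunc_lt m s (i : 'I_m.+1) : (i < (s + m).+1)%N.
Proof. by apply: leq_trans (ltn_ord i) _; rewrite ltnS leq_addl. Qed.

Definition vtrunc m s (t : vseq X (s + m)) : vseq X m :=
  @finfun 'I_m.+1 (fun i => X i) (fun i => t (Ordinal (vtrunc_lt s i))).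
Definition vskew m s (t : vseq X (s + m)) : vseq (fun k => X (k + m)) s :=
  @finfun 'I_s.+1 (fun i => X (i + m)) (fun i => t (Ordinal (vskew_lt m i))).

Lemma vtruncE m s (t : vseq X (s + m)) k (p : (k < m.+1)%N) q :
  vtrunc t (Ordinal p) = t (Ordinal (q : (k < (s + m).+1)%N)).
Proof. by rewrite ffunE; exact (vseq_irr t _ q). Qed.

Lemma vskewE m s (t : vseq X (s + m)) k (p : (k < s.+1)%N) q :
  vskew t (Ordinal p) = t (Ordinal (q : (k + m < (s + m).+1)%N)).
Proof. by rewrite ffunE; exact (vseq_irr t _ q). Qed.

Lemma vsplit_inj m s (t t' : vseq X (s + m)) :
  vtrunc t = vtrunc t' -> vskew t = vskew t' -> t = t'.
Proof.
move=> e1 e2; apply/ffunP => -[k p].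
have [km|mk] := ltnP k m.+1.
  by rewrite -(vtruncE t km) e1 vtruncE.
have E := subnK (ltnW mk); move: p; rewrite -E => p.
have q : (k - m < s.+1)%N by move: p; rewrite !ltnS leq_add2r.
by rewrite -(vskewE t q) e2 vskewE.
Qed.

(** Concatenation is only needed up to its two segments, which determine it
    by vsplit_inj; this confines the transport along k - m + m = k to the
    proof. *)
Lemma vcat_exists m s (t : vseq X m) (u : vseq (fun k => X (k + m)) s) :
  t ord_max = u ord0 -> exists v : vseq X (s + m), vtrunc v = t /\ vskew v = u.
Proof.
move=> tu.
have lt k : (k < (s + m).+1)%N -> ~ (k < m.+1)%N -> (k - m < s.+1)%N.
  by move=> h1 _; rewrite ltnS leq_subLR addnC -ltnS.
have eqk k : ~ (k < m.+1)%N -> (k - m + m = k)%N.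
  by move/negP; rewrite -leqNgt => /ltnW/subnK.
pose v0 (i : 'I_(s + m).+1) : X i :=
  match pselect (i < m.+1)%N with
  | left h => t (Ordinal h)
  | right h => eq_rect _ (fun k => X k)
      (u (Ordinal (lt i (ltn_ord i) h))) _ (eqk i h)
  end.
exists (@finfun 'I_(s + m).+1 (fun i => X i) v0); split; apply/ffunP => -[k p].
  rewrite (vtruncE _ _ (vtrunc_lt s (Ordinal p))) ffunE /v0.
  case: pselect => h; last by case: h.
  exact (vseq_irr t h p).
have q : (k + m < (s + m).+1)%N := vskew_lt m (Ordinal p).
rewrite (vskewE _ _ q) ffunE /v0.
case: pselect => h.
  have k0 : k = 0%N.
    by move: h; rewrite /= -[in X in (_ < X)%N](add0n m) ltnS leq_add2r leqn0 => /eqP.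
  subst k; apply: etrans (vseq_irr u (ltn0Sn s) p).
  exact (etrans (vseq_irr t h (ltnSn m)) tu).
move: (lt _ _ _) (eqk _ _) => /=; rewrite addnK => p' e.
by rewrite (eq_axiomK e) /=; exact: vseq_irr.
Qed.

Lemma is_path_split (E : forall k, X k -> X k.+1 -> bool) m s (t : vseq X (s + m)) :
  is_path E t = is_path (fun k => E (k + m)%N) (vskew t) && is_path E (vtrunc t).
Proof.
apply/is_pathP/andP => [h|[/is_pathP h1 /is_pathP h2] k p q].
  split; apply/is_pathP => k p q.
    have p' := vskew_lt m (Ordinal p); have q' := vskew_lt m (Ordinal q).
    by rewrite (vskewE _ _ p') (vskewE _ _ q'); exact: h.
  have p' := vtrunc_lt s (Ordinal p); have q' := vtrunc_lt s (Ordinal q).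
  by rewrite (vtruncE _ _ p') (vtruncE _ _ q'); exact: h.
have [km|mk] := ltnP k m.
  rewrite -(vtruncE t (leqW km : (k < m.+1)%N) p).
  by rewrite -(vtruncE t (km : (k.+1 < m.+1)%N) q); exact: h2.
have e := subnK mk; move: p q; rewrite -e => p q.
have p' : (k - m < s.+1)%N by move: p; rewrite !ltnS leq_add2r.
have q' : ((k - m).+1 < s.+1)%N by move: q; rewrite -addSn !ltnS leq_add2r.
by rewrite -(vskewE t p' p) -(vskewE t q' q); exact: h1.
Qed.

Lemma prod_down_split (S : pzRingType) (w : forall k, X k -> X k.+1 -> S) m s
    (t : vseq X (s + m)) :
  prod_down X w t =
    prod_down (fun k => X (k + m)%N) (fun k => w (k + m)%N) (vskew t) *
    prod_down X w (vtrunc t).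
Proof.
rewrite !prod_downE (_ : iota 0 (s + m) = iota 0 m ++ iota m s); last first.
  by rewrite addnC iotaD.
rewrite rev_cat big_cat; congr (_ * _).
  rewrite -[m in iota m s]addn0 iotaDl -map_rev big_map; apply: eq_big_seq => k.
  rewrite mem_rev mem_iota add0n => /andP[_ ks]; rewrite [(m + k)%N]addnC.
  have p : (k < s.+1)%N := leqW ks; have q : (k.+1 < s.+1)%N := ks.
  have p' := vskew_lt m (Ordinal p); have q' := vskew_lt m (Ordinal q).
  rewrite (edge_weightE _ _ p q) (vskewE _ _ p') (vskewE _ _ q').
  exact: edge_weightE.
apply: eq_big_seq => k; rewrite mem_rev mem_iota add0n => /andP[_ km].
have p : (k < m.+1)%N := leqW km; have q : (k.+1 < m.+1)%N := km.
have p' := vtrunc_lt s (Ordinal p); have q' := vtrunc_lt s (Ordinal q).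
rewrite (edge_weightE _ _ p q) (vtruncE _ _ p') (vtruncE _ _ q').
exact: edge_weightE.
Qed.
End PathSplitting.

(** * Counting paths *)

(** One more vector than the size of a spanning set: the coefficient matrix,
    made square by a zero column, has zero determinant, and over an integral
    domain this already produces a relation with coefficients in it. *)
Lemma linear_dependence (R : idomainType) (M : lmodType R) (I : finType)
    (G : pred I) (w v : I -> M) (v0 : M) :
  let spanned x := exists (c : R) (a : I -> R),
    c != 0 /\ c *: x = \sum_(j | G j) a j *: w j in
  (forall i, G i -> spanned (v i)) -> spanned v0 ->
  exists (b0 : R) (b : I -> R), (b0 != 0 \/ exists2 i, G i & b i != 0) /\
    b0 *: v0 + \sum_(i | G i) b i *: v i = 0.
Proof.
move=> spanned hv hv0; pose n := #|G|.
pose e (i : 'I_n) : I := enum_val i.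
pose f (k : 'I_n.+1) : M := if unlift ord0 k is Some i then v (e i) else v0.
have hf k : exists ca : R * (I -> R),
    ca.1 != 0 /\ ca.1 *: f k = \sum_(j | G j) ca.2 j *: w j.
  rewrite /f; case: unliftP => [i _|_].
    by have [c [a h]] := hv (e i) (enum_valP i); exists (c, a).
  by have [c [a h]] := hv0; exists (c, a).
have [ca caP] := choice hf.
(* The zero column makes the coefficient matrix square. *)
pose A : 'M[R]_n.+1 := \matrix_(k, l)
  if unlift ord0 l is Some j then (ca k).2 (e j) else 0.
have dA : \det A == 0.
  rewrite -det_tr; apply/det0P; exists (delta_mx 0 0).
    by apply/eqP => /matrixP/(_ 0 0)/eqP; rewrite !mxE !eqxx oner_eq0.
  apply/matrixP => i j; rewrite !mxE (bigD1 0) //= big1 ?addr0.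
    by rewrite !mxE unlift_none mulr0.
  by move=> k k0; rewrite !mxE (negPf k0) andbF mul0r.
have [x x0 xA] := elimT det0P dA.
pose y k := x 0 k * (ca k).1.
have sy : \sum_k y k *: f k = 0.
  rewrite (eq_bigr (fun k => \sum_(j < n) (x 0 k * A k (lift ord0 j)) *: w (e j))).
    rewrite exchange_big big1 //= => j _; rewrite -scaler_suml.
    by have /matrixP/(_ 0 (lift ord0 j)) := xA; rewrite !mxE => ->; rewrite scale0r.
  move=> k _; rewrite /y -scalerA (caP k).2.
  rewrite (big_enum_val (fun j => (ca k).2 j *: w j)) scaler_sumr.
  by apply: eq_bigr => j _; rewrite scalerA !mxE liftK.
pose b i : R := if [pick k : 'I_n | e k == i] is Some k then y (lift ord0 k) else 0.
have bE k : b (e k) = y (lift ord0 k).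
  rewrite /b; case: pickP => [k' /eqP/enum_val_inj ->//|/(_ k)].
  by rewrite eqxx.
exists (y ord0), b; split; last first.
  rewrite -[RHS]sy big_ord_recl /f unlift_none; congr (_ + _).
  rewrite (big_enum_val (fun i => b i *: v i)); apply: eq_bigr => k _.
  by rewrite bE liftK.
have [k xk] : exists k, x 0 k != 0.
  apply: contrapT => h; move/eqP: x0; apply; apply/matrixP => i k.
  rewrite ord1 mxE; apply/eqP; apply: contrapT => /negP hk.
  by apply: h; exists k.
have yk : y k != 0 by rewrite mulf_neq0 // (caP k).1.
case: (unliftP ord0 k) yk => [j|] -> yk; last by left.
by right; exists (e j); [exact: enum_valP|rewrite bE].
Qed.

Section Extensions.
Variables (dX : nat -> Order.disp_t) (X : forall k, finPOrderType (dX k)).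
Variable E : forall k, X k -> X k.+1 -> bool.

(** The sequences underlying standard tableaux of shape nu. Their type does not
    mention nu, so sums over paths to different vertices can be compared. *)
Definition path_to n (nu : X n) (t : vseq X n) : bool :=
  is_path E t && (t ord_max == nu).

Definition vertex_at m s (t : vseq X (s + m)) : X m := t (Ordinal (level_lt m s)).

Lemma vtrunc_max m s (t : vseq X (s + m)) : vtrunc t ord_max = vertex_at t.
Proof. exact (vtruncE t (ltnSn m) (level_lt m s)). Qed.

Lemma vskew_max m s (t : vseq X (s + m)) : vskew t ord_max = t ord_max.
Proof. exact (vskewE t (ltnSn s) (ltnSn (s + m))). Qed.

Lemma vskew_min m s (t : vseq X (s + m)) : vskew t ord0 = vertex_at t.
Proof. exact (vskewE t (ltn0Sn s) (level_lt m s)). Qed.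

Lemma path_toS k (nu : X k.+1) (t : vseq X k.+1) :
  path_to nu t = [&& path_to (@vertex_at k 1 t) (@vtrunc _ _ k 1 t),
                     E (@vertex_at k 1 t) nu & t ord_max == nu].
Proof.
rewrite /path_to (@is_path_split _ _ E k 1 t) vtrunc_max eqxx andbT.
rewrite [X in X && _]andbC -andbA; congr (_ && _).
case: (t ord_max =P nu) => e; last by rewrite !andbF.
rewrite !andbT; apply/is_pathP/idP => [h|h].
  have := h 0%N isT isT.
  rewrite (@vskewE _ X k 1 t 0 _ (level_lt k 1)) (@vskewE _ X k 1 t 1 _ (ltnSn k.+1)).
  by rewrite [t (Ordinal (ltnSn k.+1))]e.
case=> [|j] p q //; rewrite (@vskewE _ X k 1 t 0 _ (level_lt k 1)) (@vskewE _ X k 1 t 1 _ (ltnSn k.+1)).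
by rewrite [t (Ordinal (ltnSn k.+1))]e.
Qed.

Lemma path_extend k (ka : X k) (nu : X k.+1) (t' : vseq X k) : E ka nu ->
  path_to ka t' -> exists t : vseq X k.+1, path_to nu t /\ @vtrunc _ _ k 1 t = t'.
Proof.
move=> hE ht'; have /andP[_ /eqP e'] := ht'.
pose g (j : nat) : (j < 2)%N -> X (j + k)%N :=
  match j return (j < 2)%N -> X (j + k)%N with
  | 0 => fun _ => ka
  | 1 => fun _ => nu
  | j.+2 => fun p => False_rect _ (notF p)
  end.
pose u : vseq (fun j => X (j + k)%N) 1 :=
  @finfun 'I_2 (fun i => X (i + k)%N) (fun i => g i (ltn_ord i)).
have u0 : u ord0 = ka by rewrite ffunE.
have u1 : u ord_max = nu by rewrite ffunE.
have [t [et eu]] := vcat_exists (etrans e' (esym u0)).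
exists t; split=> //.
have atE : @vertex_at k 1 t = ka by rewrite -vtrunc_max et.
rewrite path_toS atE et ht' hE /=.
by have := @vskew_max k 1 t; rewrite eu u1 => <-.
Qed.

(** Removing the last edge is a bijection from the paths to nu through ka onto
    the paths to ka. *)
Lemma sum_path_extend (V : nmodType) k (ka : X k) (nu : X k.+1) (P : pred (vseq X k))
    (F : vseq X k -> V) : E ka nu ->
  \sum_(t : vseq X k.+1 | [&& path_to nu t, P (@vtrunc _ _ k 1 t) & @vertex_at k 1 t == ka])
     F (@vtrunc _ _ k 1 t) =
  \sum_(t' | path_to ka t' && P t') F t'.
Proof.
move=> hE.
have vt (t : vseq X k.+1) : path_to nu t -> @vertex_at k 1 t = ka ->
    path_to ka (@vtrunc _ _ k 1 t).
  by rewrite path_toS => /and3P[h _ _] <-.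
have [[t0 ht0]|none] := pselect (exists t', path_to ka t'); last first.
  rewrite !big_pred0 // => t; apply/negbTE/negP.
    by case/andP=> ht _; apply: none; exists t.
  by case/and3P=> h1 _ /eqP h2; apply: none; eexists; exact: vt h1 h2.
(* A default value for the inverse bijection outside its domain. *)
have [d0 _] := path_extend hE ht0.
have ex t' : exists t : vseq X k.+1,
    path_to ka t' -> path_to nu t /\ @vtrunc _ _ k 1 t = t'.
  have [h|h] := boolP (path_to ka t'); last by exists d0.
  by have [t ht] := path_extend hE h; exists t.
have [h hP] := choice ex.
rewrite (reindex_onto h (@vtrunc _ _ k 1)) /=.
  apply: eq_big => [t'|t' /andP[_ /eqP ->] //].
  apply/andP/andP => [[/and3P[h1 h2 /eqP h3] /eqP h4]|[h1 h2]].
    by rewrite -h4 h2 (vt _ h1 h3).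
  have [h3 h4] := hP _ h1; rewrite h3 h4 h2 eqxx /=; split=> //.
  by rewrite -vtrunc_max h4; case/andP: h1.
move=> t /and3P[h1 h2 /eqP h3]; have [h4 h5] := hP _ (vt _ h1 h3).
apply: (@vsplit_inj _ X k 1) => //; apply/ffunP => -[[|[|j]] p] //.
  rewrite !(@vskewE _ X k 1 _ 0 _ (level_lt k 1)).
  by rewrite -[LHS](@vtrunc_max k 1) h5 vtrunc_max.
rewrite !(@vskewE _ X k 1 _ 1 _ (ltnSn k.+1)).
by case/andP: h1 => _ /eqP h1; case/andP: h4 => _ /eqP h4; exact (etrans h4 (esym h1)).
Qed.
End Extensions.

(** * The levels of a tower *)

Section Levels.
Variables (R : idomainType) (A : tower R).

Lemma tw_lev_le j k (x : A) : (j <= k)%N -> tw_lev j x -> tw_lev k x.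
Proof.
move/subnK <-; elim: (k - j)%N => [//|n ih] hx.
by rewrite addSn; apply: tw_inc; apply: ih.
Qed.

Lemma to_levK k (x : A) : tw_lev k x -> val (to_lev k x) = x.
Proof. by move=> hx; apply: insubdK; apply/asboolP. Qed.

Lemma lev_in k (x : lev A k) : tw_lev k (val x).
Proof. exact/asboolP/(valP x). Qed.

Lemma lev_mulE k (x y : lev A k) : val (x *a y) = val x * val y.
Proof. by []. Qed.

Lemma lev_star_linear k : linear (@lev_star R A k).
Proof.
move=> a x y; apply: val_inj.
have hs (z : lev A k) : val (lev_star z) = tw_star (val z).
  by apply: to_levK; apply/tw_star_lev/lev_in.
transitivity (a *: val (lev_star x) + val (lev_star y)) => //.
by rewrite !hs -tw_star_linear.
Qed.

Lemma val_lev_star k (x : lev A k) : val (lev_star x) = tw_star (val x).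
Proof. by apply: to_levK; apply/tw_star_lev/lev_in. Qed.

Lemma lev_star_mul k (x y : lev A k) :
  lev_star (x *a y) = lev_star y *a lev_star x.
Proof. by apply: val_inj; rewrite lev_mulE !val_lev_star tw_starM. Qed.

Lemma lev_starK k : involutive (@lev_star R A k).
Proof. by move=> x; apply: val_inj; rewrite !val_lev_star tw_starK. Qed.
End Levels.

Section Murphy.
Variables (R : idomainType) (A : tower R) (C : forall k, cell_datum (lev A k)).
Variables (d u : coeffs C).
Hypothesis hdu : is_murphy d u.
Hypothesis hss : forall k, split_semisimple (ext (lev A k)).

Local Notation X := (fun k => cd_lam (C k)).
Local Notation E := (@branch R A C).
Local Notation D k := (murphy_datum d u k).

Definition u_prod n (t : vseq X n) : A :=
  prod_down X (fun k l l' => val (@u k l l')) t.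

Lemma u_prod_lev n (t : vseq X n) : tw_lev n (u_prod t).
Proof.
rewrite /u_prod /prod_down; apply: big_ind => [||i _].
- exact: tw_1.
- by move=> x y; exact: tw_mul.
- by apply: tw_lev_le (lev_in _).
Qed.

Lemma d_path_lev n (nu : cd_lam (C n)) (t : Std nu) : tw_lev n (d_path d t).
Proof.
rewrite /d_path /prod_up; apply: big_ind => [||i _].
- exact: tw_1.
- by move=> x y; exact: tw_mul.
- by apply: tw_lev_le (lev_in _).
Qed.

Definition u_lev n (t : vseq X n) : lev A n := to_lev n (u_prod t).

Lemma val_u_lev n (t : vseq X n) : val (u_lev t) = u_prod t.
Proof. exact/to_levK/u_prod_lev. Qed.

Lemma Std_path n (nu : X n) (t : vseq X n) : path_to E nu t <->
  exists t' : Std nu, val t' = t.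
Proof.
split=> [h|[[t' h] <-]]; last exact: h.
by exists (Sub t h).
Qed.

Definition u_std n (nu : X n) (t : Std nu) : lev A n := u_lev (val t).
Definition d_std n (nu : X n) (t : Std nu) : lev A n := to_lev n (d_path d t).

Definition level_ideal k (G : pred (X k)) : lsubspace (lev A k) :=
  @cell_ideal R (lev A k) (D k) G.
Definition level_ideal_gt k (nu : X k) : lsubspace (lev A k) :=
  level_ideal (fun l => nu < l)%O.

Lemma murphy_fact k (nu : X k) (p q : Std nu) :
  @cd_c _ _ (D k) nu p q = d_std p *a u_std q.
Proof.
apply: val_inj; rewrite lev_mulE val_u_lev /= !to_levK //.
- exact: d_path_lev.
- by apply: tw_mul; [exact: d_path_lev|exact: u_prod_lev].
Qed.

Definition path_span k (nu : X k) (P : pred (Std nu)) : lsubspace (lev A k) :=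
  pspan (@u_std k nu) (level_ideal_gt nu) P.
Arguments path_span {k} nu P.

Lemma path_span_gen k (nu : X k) (P : pred (Std nu)) t : P t -> path_span nu P (u_std t).
Proof. exact: (@pspan_gen _ _ _ (@u_std k nu) _ P t). Qed.

Lemma path_span_lspan k (nu : X k) x :
  lspan (@u_set R A C u k nu `|` @murphy_gt R A C d u k nu)%classic x <->
  path_span nu predT x.
Proof.
split.
  apply: (lspan_min (X := path_span nu predT)) => {}x [[t ->]|hx].
    exact: (@pspan_gen _ _ _ (@u_std k nu) _ predT t).
  exact/pspanK/lspan_gen.
apply: pspan_min => [{}x|t _].
  by apply: lspan_sub => {}x hx; apply: lspan_gen; right.
by apply: lspan_gen; left; exists t.
Qed.

Lemma path_span_right k (nu : X k) x b : path_span nu predT x -> path_span nu predT (x *a b).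
Proof.
by move=> /path_span_lspan hx; apply/path_span_lspan; apply: (mu_stable hdu nu).1.2.
Qed.

Lemma u_std_free k (nu : X k) (a : Std nu -> R) :
  level_ideal_gt nu (\sum_t a t *: u_std t) -> forall t, a t = 0.
Proof. exact: (mu_free hdu). Qed.

Lemma u_std_stable k (nu : X k) (t : Std nu) b : exists a : Std nu -> R,
  level_ideal_gt nu (u_std t *a b - \sum_v a v *: u_std v).
Proof.
have [a ha] : path_span nu predT (u_std t *a b).
  by apply: path_span_right; exact: (@pspan_gen _ _ _ (@u_std k nu) _ predT t).
by exists a.
Qed.

Lemma u_std_ge k (nu : X k) (t : Std nu) : level_ideal (fun l => nu <= l)%O (u_std t).
Proof. exact: (mu_ge hdu). Qed.

Local Notation ups G := (@upset R _ (D _) G).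

Lemma level_ideal_right k (G : pred (X k)) x b : ups G -> level_ideal G x -> level_ideal G (x *a b).
Proof. exact: (cell_ideal_mulr (mu_cellular hdu k)). Qed.

Lemma ups_gt k (nu : X k) : ups (fun l => nu < l)%O.
Proof. exact: upset_gt. Qed.
Lemma ups_ge k (nu : X k) : ups (fun l => nu <= l)%O.
Proof. exact: upset_ge. Qed.

Lemma level_ideal_unit k (G : pred (X k)) : ups G ->
  exists r eps, [/\ r != 0, level_ideal G eps, forall x, eps *a x = x *a eps
                  & forall x, level_ideal G x -> x *a eps = r *: x].
Proof.
exact: (cell_ideal_unit (mu_cellular hdu k) (@lev_star_linear _ _ k)
  (@lev_star_mul _ _ k) (@lev_starK _ _ k) (hss k)).
Qed.

Lemma level_ideal_kill k (G : pred (X k)) (nu : X k) x y : ups G -> ~~ G nu ->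
  path_span nu predT x -> level_ideal G y -> level_ideal_gt nu (x *a y).
Proof.
move=> hG nG [a ha] hy; rewrite -[x](subrK (\sum_t a t *: u_std t)) amulDl.
apply: ssD; first by apply: level_ideal_right ha; exact: ups_gt.
rewrite amul_suml; apply: ss_sum => t _; rewrite amulZl; apply: ssZ.
exact: (cell_ideal_kill (mu_cellular hdu k) (@lev_star_linear _ _ k)
  (@lev_star_mul _ _ k) (@lev_starK _ _ k) (@murphy_fact k) (@u_std_stable k)
  t hG nG hy).
Qed.

Lemma matrix_units k (la : X k) (t0 : Std la) : exists r eps (a : Std la -> lev A k),
  [/\ r != 0, level_ideal (fun l => la <= l)%O eps, forall x, eps *a x = x *a eps,
      forall x, level_ideal (fun l => la <= l)%O x -> x *a eps = r *: x
    & (forall q, level_ideal (fun l => la <= l)%O (a q)) /\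
      forall t q, level_ideal_gt la (u_std t *a a q - (t == t0)%:R * r *: u_std q)].
Proof.
exact: (cell_matrix_units (mu_cellular hdu k) (@lev_star_linear _ _ k)
  (@lev_star_mul _ _ k) (@lev_starK _ _ k) (hss k) (@murphy_fact k)
  (@u_std_stable k) (@u_std_ge k) (@u_std_free k)).
Qed.

Lemma cell_presents k (nu : X k) : exists p : lev A k -> cell_mod nu,
  @presents _ _ (reg_rmod (lev A k)) (cell_mod nu) (path_span nu predT) (level_ideal_gt nu) p.
Proof.
have [p hp] := span_quo_presents (mu_stable hdu nu).
have [q hq] := presents_iso hp (rmod_iso_sym (mu_iso hdu nu)).
exists q; case: hq => q1 q2 q3 q4; split.
- by move=> a x y /path_span_lspan hx /path_span_lspan hy; apply: q1.
- by move=> x b /path_span_lspan hx; apply: q2.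
- by move=> z; have [x /path_span_lspan hx ex] := q3 z; exists x.
- by move=> x /path_span_lspan hx; apply: q4.
Qed.

End Murphy.
Arguments path_span {R A C} d u {k} nu P.

(** * Ranks of the images of cell ideals *)

Section Ranks.
Variables (R : idomainType) (A : tower R) (C : forall k, cell_datum (lev A k)).
Variables (d u : coeffs C).
Hypothesis hdu : is_murphy d u.
Hypothesis hss : forall k, split_semisimple (ext (lev A k)).
Hypothesis hC : strongly_coherent C.

Local Notation X := (fun k => cd_lam (C k)).
Local Notation E := (@branch R A C).
Local Notation D k := (murphy_datum d u k).

Definition raise m s (x : lev A m) : lev A (s + m)%N := to_lev (s + m)%N (val x).

Lemma val_raise m s (x : lev A m) : val (raise s x) = val x.
Proof. by apply/to_levK/(tw_lev_le (leq_addl s m))/lev_in. Qed.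

Lemma raise_incl m s (x : lev A m) : lev_incl A (s + m)%N (raise s x) = raise s.+1 x.
Proof. by apply: val_inj; rewrite [RHS]val_raise /= val_raise. Qed.

Lemma raise0 m (x : lev A m) : raise 0 x = x.
Proof. by apply: val_inj; rewrite val_raise. Qed.

Variables (m : nat) (G : pred (X m)).
Hypothesis hG : @upset R _ (D m) G.
Variables (r : R) (eps : lev A m).
Hypothesis r_neq0 : r != 0.
Hypothesis eps_in : level_ideal d u G eps.
Hypothesis eps_unit : forall x, level_ideal d u G x -> x *a eps = r *: x.

Lemma raise_eps2 s : raise s eps *a raise s eps = r *: raise s eps.
Proof.
apply: val_inj; rewrite lev_mulE val_raise -lev_mulE eps_unit //.
by transitivity (r *: val (raise s eps)); rewrite // val_raise.
Qed.

(** Up to denominators, eps maps Y into the span of a family indexed by P. This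
    bounds the rank of the image by the number of paths in P without any
    reference to a basis of M or to vector spaces. *)
Definition rank_bound (s : nat) (M : rmod (lev A (s + m)%N)) (Y : M -> Prop)
    (P : pred (vseq X (s + m)%N)) : Prop :=
  exists w : vseq X (s + m)%N -> M, forall x, Y x ->
    exists c (a : vseq X (s + m)%N -> R), c != 0 /\
      c *: (x *r raise s eps) = \sum_(t | P t) a t *: w t.

Definition path_meeting s (nu : X (s + m)%N) (t : vseq X (s + m)%N) : bool :=
  path_to E nu t && G (vertex_at t).

(** On its own level eps acts on the cell module of nu by r if nu is in G and
    by 0 otherwise. *)
Lemma rank_cell0 (nu : X m) : @rank_bound 0 (cell_mod nu) (fun _ => True) (@path_meeting 0 nu).
Proof.
have [p hp] := cell_presents hdu nu.
have surj x := pres_surj hp x.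
have [Gnu|nGnu] := boolP (G nu); last first.
  exists (fun=> 0) => x _; exists 1, (fun=> 0); rewrite oner_neq0; split=> //.
  rewrite scale1r big1; last by move=> t _; rewrite scaler0.
  have [v hv <-] := surj x; rewrite raise0 -(pres_act hp) //.
  apply/(pres_ker hp); first exact: path_span_right.
  exact: (level_ideal_kill hdu hG nGnu hv eps_in).
exists (fun t => p (u_lev u t)) => x _.
have [v [a ha] ev] := surj (x *r raise 0 eps).
exists 1; exists (fun t => if insub t is Some t' then a (t' : Std nu) else 0).
rewrite oner_neq0 scale1r; split=> //; rewrite -ev.
have hu (t : Std nu) : path_span d u nu predT (u_std u t).
  exact: path_span_gen.
have -> : p v = \sum_(t : Std nu) a t *: p (u_std u t).
  transitivity (p (\sum_t a t *: u_std u t)).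
    apply/(pres_eq hp) => //; first by exists a.
    by apply: ss_sum => t _; apply: ssZ.
  rewrite (pres_sum hp) => [|t _]; last exact: ssZ.
  by apply: eq_bigr => t _; rewrite (presZ hp).
transitivity (\sum_(t | path_to E nu t)
   (if insub t is Some t' then a (t' : Std nu) else 0) *: p (u_lev u t)).
  rewrite [RHS]big_sub /=; apply: eq_bigr => t _.
  by rewrite valK.
apply: eq_bigl => t; rewrite /path_meeting andbC.
have [h|] := boolP (path_to E nu t); last by rewrite andbF.
rewrite andbT; have /andP[_ /eqP e] := h.
have -> : @vertex_at _ X m 0 t = nu by rewrite -e; exact (vseq_irr t _ _).
by rewrite Gnu.
Qed.

Lemma rank_bound_sub s (M : rmod (lev A (s + m)%N)) (Y : M -> Prop)
    (P Q : pred (vseq X (s + m)%N)) :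
  (forall t, P t -> Q t) -> rank_bound Y P -> rank_bound Y Q.
Proof.
move=> PQ [w hw]; exists w => x /hw [c [a [c0 e]]].
exists c, (fun t => if P t then a t else 0); split=> //; rewrite e.
rewrite big_mkcond [RHS]big_mkcond; apply: eq_bigr => t _.
case: ifP => [/PQ -> //|_]; by case: ifP; rewrite ?scale0r.
Qed.

(** The restriction of the cell module of nu is filtered by cell modules of
    pairwise distinct neighbours of nu. Along the filtration the bounds add up:
    the image of eps on a step is spanned, modulo the image on the previous
    one, by lifts of a family for the subquotient. Each label of the filtration
    contributes the paths that reach nu through it. *)
Lemma rank_cellS s :
  (forall ka : X (s + m)%N,
     rank_bound (fun _ : cell_mod ka => True) (path_meeting ka)) ->
  forall nu : X (s.+1 + m)%N,
     @rank_bound s.+1 (cell_mod nu) (fun _ => True) (@path_meeting s.+1 nu).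
Proof.
move=> IH nu; pose k := (s + m)%N; pose M : rmod (lev A k.+1) := cell_mod nu.
have [_ _ _ hres] := hC; have [ls hls] := hres k nu.
have [Xf [X0 Xtop _ Xiso Xsort]] := hls.
have uls : uniq ls.
  by apply: sorted_uniq Xsort => [x y z h1 h2|x]; [exact: lt_trans h2 h1|exact: ltxx].
pose at' (t : vseq X k.+1) : X k := @vertex_at _ X k 1 t.
pose P i (t : vseq X k.+1) := @path_meeting s.+1 nu t && (at' t \in take i ls).
suff claim i : (i <= size ls)%N -> @rank_bound s.+1 M (Xf i) (P i).
  have [w hw] := claim _ (leqnn _).
  apply: (@rank_bound_sub s.+1 _ _ (P (size ls))) => [t /andP[] //|].
  by exists w => x _; apply: hw; exact: Xtop.
elim: i => [_|i ih hi].
  exists (fun=> 0) => x /X0 ->; exists 1, (fun=> 0); rewrite oner_neq0.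
  split=> //; rewrite ract0l scaler0 big1 // => t _; exact: scale0r.
have [w hw] := ih (ltnW hi).
pose ka : X k := tnth (in_tuple ls) (Ordinal hi).
have kaE x0 : ka = nth x0 ls i by rewrite /ka (tnth_nth x0).
have hbr : E ka nu by apply/asboolP; exists ls => //; exact: mem_tnth.
have [p0 hp0] := subquo_presents (Xf i.+1) (Xf i).
have [p hp] := presents_iso hp0 (Xiso (Ordinal hi)).
pose L1 := sm_space (Xf i.+1); pose L0 := sm_space (Xf i).
have hp' : @presents _ _ _ (cell_mod ka) L1 L0 p := hp.
have [w' hw'] := IH ka.
have [y hy] := choice (fun t' => let: ex_intro2 y h1 h2 := pres_surj hp' (w' t') in
  ex_intro (fun y => L1 y /\ p y = w' t') y (conj h1 h2)).
pose eS : lev A k.+1 := raise s.+1 eps.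
(* Lifts are multiplied by eps because only their images are controlled on the
   previous step of the filtration; eps is idempotent up to r. *)
exists (fun t => if at' t == ka then (y (@vtrunc _ X k 1 t) : M) *r eS else w t).
move=> x hx.
have [c [a [c0 ea]]] := hw' (p x) I.
pose z : M := \sum_(t' | path_meeting ka t') a t' *: y t'.
have hact (v : M) : v *r eS = (v : res_rmod (lev_incl A k) M) *r raise s eps.
  by rewrite /eS -raise_incl.
have hz : L1 z by apply: ss_sum => t' _; apply: ssZ; have [] := hy t'.
have hxe : L1 (x *r eS) by rewrite hact; apply: (sm_P (Xf i.+1)).2.
have hx' : L0 (c *: (x *r eS) - z).
  apply/(pres_ker hp'); first by apply: ssB => //; apply: ssZ.
  rewrite (presB hp') //; last exact: ssZ.
  rewrite (presZ hp') // {1}hact (pres_act hp') // ea /z (pres_sum hp'); last first.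
    by move=> t' _; apply: ssZ; have [] := hy t'.
  apply/eqP; rewrite subr_eq0; apply/eqP; apply: eq_bigr => t' _.
  by have [h1 h2] := hy t'; rewrite (presZ hp') // h2.
have [c' [a' [c0' ea']]] := hw _ hx'.
exists (c' * (c * r)), (fun t => if at' t == ka then c' * a (@vtrunc _ X k 1 t) else a' t).
split; first by rewrite !mulf_neq0.
have -> : (c' * (c * r)) *: (x *r eS) = c' *: (z *r eS) + \sum_(t | P i t) a' t *: w t.
  rewrite -ea' -scalerDr -ractDl addrC subrK ractZl -ractM.
  by rewrite (raise_eps2 s.+1) ractZr !scalerA.
rewrite [RHS](bigID (fun t => at' t == ka)) /=; congr (_ + _).
  rewrite ract_suml scaler_sumr.
  rewrite -(sum_path_extend (fun t' => G (vertex_at t'))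
    (fun t' => c' *: ((a t' *: y t' : M) *r eS)) hbr).
  apply: eq_big => [t|t /and3P[_ _ /eqP e]]; last first.
    by rewrite {1 2}/at' e eqxx ractZl scalerA.
  have -> : vertex_at (@vtrunc _ X k 1 t) = @vertex_at _ X m s.+1 t.
    exact (@vtruncE _ X k 1 t m (level_lt m s) (level_lt m s.+1)).
  rewrite /P /path_meeting -!andbA; congr (_ && (_ && _)).
  rewrite /at'; case: eqP => [->|_]; last by rewrite !andbF.
  by rewrite (take_nth ka hi) -kaE mem_rcons inE eqxx.
have hP t : P i t = P i.+1 t && (at' t != ka); last first.
  by apply: eq_big => [//|t]; rewrite hP => /andP[_ /negPf ->].
rewrite /P -andbA; congr (_ && _).
rewrite (take_nth ka hi) -kaE mem_rcons inE.
case: eqP => [->|_] //=; last by rewrite andbT.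
have := uls; rewrite -{1}(cat_take_drop i ls) cat_uniq => /and3P[_ /hasPn h _].
apply/negbTE/negP => hk; have := h ka.
rewrite hk (drop_nth ka hi) inE -kaE eqxx => /(_ isT) //.
Qed.

Lemma rank_cell s (nu : X (s + m)%N) :
  rank_bound (fun _ : cell_mod nu => True) (path_meeting nu).
Proof.
elim: s nu => [nu|s IH nu]; first exact: rank_cell0.
exact: rank_cellS.
Qed.
End Ranks.

(** * Triangularity of the Murphy basis *)

Section Images.
Variables (R : idomainType) (A : tower R) (C : forall k, cell_datum (lev A k)).
Variables (d u : coeffs C).
Hypothesis hdu : is_murphy d u.
Hypothesis hss : forall k, split_semisimple (ext (lev A k)).
Hypothesis hC : strongly_coherent C.

Local Notation X := (fun k => cd_lam (C k)).
Local Notation E := (@branch R A C).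
Local Notation D k := (murphy_datum d u k).

Definition skew_prod m s (t : vseq (fun k => X (k + m)%N) s) : A :=
  prod_down (fun k => X (k + m)%N) (fun k l l' => val (@u (k + m)%N l l')) t.

Lemma skew_prod_lev m s (t : vseq (fun k => X (k + m)%N) s) :
  tw_lev (s + m) (skew_prod t).
Proof.
rewrite /skew_prod /prod_down; apply: big_ind => [||i _].
- exact: tw_1.
- by move=> x y; exact: tw_mul.
- by apply: tw_lev_le (lev_in _); rewrite -addSn leq_add2r.
Qed.

Definition skew_lev m s (t : vseq (fun k => X (k + m)%N) s) : lev A (s + m)%N :=
  to_lev (s + m)%N (skew_prod t).

Lemma u_lev_split m s (t : vseq X (s + m)%N) :
  u_lev u t = skew_lev (vskew t) *a raise s (u_lev u (vtrunc t)).
Proof.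
apply: val_inj; rewrite lev_mulE val_raise !val_u_lev to_levK.
  exact: prod_down_split.
exact: skew_prod_lev.
Qed.

Lemma path_to_trunc m s (nu : X (s + m)%N) (t : vseq X (s + m)%N) :
  path_to E nu t -> path_to E (vertex_at t) (vtrunc t).
Proof.
by case/andP; rewrite is_path_split => /andP[_ h] _; rewrite /path_to h vtrunc_max eqxx.
Qed.

Lemma u_trunc_ge m s (nu : X (s + m)%N) (t : vseq X (s + m)%N) :
  path_to E nu t -> level_ideal d u (fun l => vertex_at t <= l)%O (u_lev u (vtrunc t)).
Proof.
by move=> /path_to_trunc/Std_path[t' <-]; exact: (u_std_ge hdu t').
Qed.

Lemma raiseM m s (x y : lev A m) : raise s (x *a y) = raise s x *a raise s y.
Proof. by apply: val_inj; rewrite lev_mulE !val_raise. Qed.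

Lemma raiseZ m s a (x : lev A m) : raise s (a *: x) = a *: raise s x.
Proof.
apply: val_inj; rewrite val_raise.
by transitivity (a *: val (raise s x)); rewrite // val_raise.
Qed.

Variables (m : nat) (G : pred (X m)).
Hypothesis hG : @upset R _ (D m) G.
Variables (r : R) (eps : lev A m).
Hypothesis r_neq0 : r != 0.
Hypothesis eps_in : level_ideal d u G eps.
Hypothesis eps_unit : forall x, level_ideal d u G x -> x *a eps = r *: x.

Lemma u_trunc_in s (nu : X (s + m)%N) (t : vseq X (s + m)%N) :
  path_to E nu t -> G (vertex_at t) -> level_ideal d u G (u_lev u (vtrunc t)).
Proof.
move=> /u_trunc_ge h Gt; apply: cell_ideal_sub h => l hl.
exact: hG hl Gt.
Qed.

(** The triangularity of the Murphy basis. The u_t whose path meets G on level m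
    are eigenvectors of eps, because u_t is a left multiple of the element of
    its initial segment, which lies in the ideal of G. They are independent and
    as many as the rank bound permits, so they span the image of eps up to
    denominators. *)
Lemma ideal_image s (nu : X (s + m)%N) v : path_span d u nu predT v ->
  path_span d u nu (fun t => G (vertex_at (val t))) (v *a raise s eps).
Proof.
move=> hv; have [p hp] := cell_presents hdu nu.
have [w hw] := rank_cell hdu hC hG r_neq0 eps_in eps_unit nu.
have hve : path_span d u nu predT (v *a raise s eps) by exact: path_span_right.
have [c hc] := hve.
have hu t : path_to E nu t -> path_span d u nu predT (u_lev u t).
  by move=> /Std_path[t' <-]; exact: (@path_span_gen _ _ _ d u _ nu predT t').
have [] := @linear_dependence R _ _ (path_meeting G nu) w (fun t => p (u_lev u t))
  (p (v *a raise s eps)).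
- move=> t /andP[ht Gt]; have [b [a [b0 e]]] := hw (p (u_lev u t)) I.
  exists (b * r), a; split; first exact: mulf_neq0.
  rewrite -e -(pres_act hp _ (hu t ht)) -scalerA -(presZ hp r (hu t ht)).
  rewrite [ract _ _](_ : _ = r *: u_lev u t) //.
  rewrite /= u_lev_split -amulA -raiseM eps_unit ?raiseZ ?amulZr //.
  exact: u_trunc_in ht Gt.
- by have [b [a [b0 e]]] := hw (p v) I; exists b, a; rewrite (pres_act hp).
move=> b0 [b [bn0 e]].
have hK : level_ideal_gt d u nu (\sum_(t : Std nu)
    (b0 * c t + (if G (vertex_at (val t)) then b (val t) else 0)) *: u_std u t).
  have -> : \sum_(t : Std nu)
      (b0 * c t + (if G (vertex_at (val t)) then b (val t) else 0)) *: u_std u t =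
    (b0 *: (v *a raise s eps) + \sum_(t | path_meeting G nu t) b t *: u_lev u t) -
    b0 *: (v *a raise s eps - \sum_t c t *: u_std u t).
    rewrite scalerBr opprB addrC addrA subrK scaler_sumr.
    rewrite [\sum_(t | path_meeting G nu t) _](big_sub_cond (path_to E nu) (fun t => G (vertex_at t))).
    rewrite [X in _ + X]big_mkcond -big_split; apply: eq_bigr => t _ /=.
    by rewrite scalerDl scalerA; congr (_ + _); case: ifP; rewrite ?scale0r.
  apply: ssB; last exact: ssZ.
  have hs : path_span d u nu predT (\sum_(t | path_meeting G nu t) b t *: u_lev u t).
    by apply: ss_sum => t /andP[ht _]; apply/ssZ/hu.
  apply/(pres_ker hp); first by apply: ssD => //; apply: ssZ.
  rewrite (presP hp) // -[RHS]e; congr (_ + _).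
  rewrite (pres_sum hp) => [|t /andP[ht _]]; last exact/ssZ/hu/ht.
  by apply: eq_bigr => t /andP[ht _]; rewrite (presZ hp) //; exact: hu.
have cz := u_std_free hdu hK.
(* A coefficient off G would make v eps independent of the u_t that meet G. *)
have off t : ~~ G (vertex_at (val t)) -> c t = 0.
  move=> nG; have := cz t; rewrite (negPf nG) addr0 => /eqP.
  rewrite mulf_eq0 => /orP[/eqP b00|/eqP //].
  case: bn0 => [/eqP //|[t' /andP[ht' Gt'] /eqP bt']].
  have [t2 e2] := (Std_path _ _).1 ht'.
  by have := cz t2; rewrite e2 Gt' b00 mul0r add0r => /bt'.
exists c; move: hc; rewrite (bigID (fun t => G (vertex_at (val t)))) /=.
rewrite [\sum_(t | ~~ _) _]big1 ?addr0 // => t /off ->.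
exact: scale0r.
Qed.
End Images.

(** * The skew cell module of a tower *)

Section SkewModule.
Variables (R : idomainType) (A : tower R) (C : forall k, cell_datum (lev A k)).
Variables (d u : coeffs C).
Hypothesis hdu : is_murphy d u.
Hypothesis hss : forall k, split_semisimple (ext (lev A k)).
Hypothesis hC : strongly_coherent C.
Variables (rho : tensor_embedding A) (m s : nat).
Variables (la : cd_lam (C m)) (nu : cd_lam (C (s + m)%N)) (tla : Std la).

Local Notation X := (fun k => cd_lam (C k)).
Local Notation E := (@branch R A C).
Local Notation f := (te_left rho m s).
Local Notation g := (te_right rho m s).

Lemma te_left_raise x : f x = raise s x.
Proof. by apply: val_inj; rewrite val_raise; exact: te_incl. Qed.

Definition above (t : Std nu) : bool := (la < @vertex_at _ X m s (val t))%O.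
Definition meets (t : Std nu) : option (Std la) := insub (@vtrunc _ X m s (val t)).
Definition in_skew : pred (Std nu) := skew_pred tla above meets.

Lemma meetsP (t : Std nu) (j : Std la) : meets t = Some j <-> val j = @vtrunc _ X m s (val t).
Proof.
rewrite /meets; split=> [|<-]; last exact: valK.
by case: insubP => // j' _ e [<-].
Qed.

Lemma lspan_skew_gt x :
  lspan (@skew_gt R A C d u m s la nu) x <-> path_span d u nu above x.
Proof.
split.
  apply: (lspan_min (X := path_span d u nu above)) => {}x [hx|[t [ht ->]]].
    exact/pspanK/lspan_gen.
  exact: (@path_span_gen _ _ _ d u _ nu above t ht).
apply: pspan_min => [{}x|t ht].
  by apply: lspan_sub => {}x hx; apply: lspan_gen; left.
by apply: lspan_gen; right; exists t.
Qed.

(** Concatenation with tla turns the generators of the skew cell module into the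
    basis elements of the paths to nu that start with tla. *)
Lemma lspan_skew x :
  lspan ((fun x => exists t : sStd la nu,
            x = to_lev (s + m)%N (u_skew u t * u_path u tla)) `|`
         @skew_gt R A C d u m s la nu)%classic x <-> path_span d u nu in_skew x.
Proof.
have /andP[hp /eqP hl] := valP tla.
split.
  apply: (lspan_min (X := path_span d u nu in_skew)) => {}x [[t ->]|hx]; last first.
    have /lspan_skew_gt : lspan (@skew_gt R A C d u m s la nu) x by exact: lspan_gen.
    by apply: pspan_sub => t ht; rewrite /in_skew /skew_pred ht.
  have /and3P[h1 /eqP h2 /eqP h3] := valP t.
  have [v [e1 e2]] := @vcat_exists _ X m s (val tla) (val t) (etrans hl (esym h2)).
  have hv : path_to E nu v.
    by rewrite /path_to is_path_split e1 e2 hp h1 -vskew_max e2 h3 eqxx.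
  have [v' ev] := (Std_path _ _).1 hv.
  have -> : to_lev (s + m)%N (u_skew u t * u_path u tla) = u_std u v'.
    rewrite /u_std ev /u_lev; congr (to_lev _ _).
    by rewrite /u_prod prod_down_split e1 e2.
  apply: path_span_gen; apply/orP; right; apply/eqP/meetsP.
  by rewrite ev e1.
apply: pspan_min => [{}x|t /orP[ht|/eqP/meetsP ht]].
- by apply: lspan_sub => {}x hx; apply: lspan_gen; right; left.
- by apply: lspan_gen; right; right; exists t.
apply: lspan_gen; left.
have /andP[h1 /eqP h2] := valP t.
have /andP[h3 h4] : is_path (fun k => @branch R A C (k + m)%N) (@vskew _ X m s (val t)) &&
    is_path E (@vtrunc _ X m s (val t)) by rewrite -is_path_split.
have hs : [&& is_path (fun k => @branch R A C (k + m)%N) (@vskew _ X m s (val t)),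
    @vskew _ X m s (val t) ord0 == la & @vskew _ X m s (val t) ord_max == nu].
  by rewrite h3 vskew_max h2 eqxx andbT vskew_min -vtrunc_max -ht hl eqxx.
exists (Sub (@vskew _ X m s (val t)) hs); rewrite /u_std /u_lev; congr (to_lev _ _).
by rewrite /u_prod prod_down_split -ht.
Qed.

(** The two ideals used are those of the labels above la, strictly and weakly;
    triangularity holds for both. In particular the spans that define the skew
    cell module are stable under the right factor. *)
Theorem skew_mod_pairing : exists z0 theta,
  @hom_pairing _ _ _ _ f g (cell_mod la) (skew_mod d u rho nu tla) (cell_mod nu)
    z0 theta.
Proof.
have [r0 [e0 [r00 e0_in e0C e0U]]] := level_ideal_unit hdu hss (@ups_gt _ _ _ d u m la).
have [r [e1 [a [rn0 e1_in e1C e1U [a_in a_mx]]]]] := matrix_units hdu hss tla.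
pose below (t : Std nu) : bool := (la <= @vertex_at _ X m s (val t))%O.
pose usk (t : Std nu) : lev A (s + m)%N := skew_lev u (@vskew _ X m s (val t)).
pose ut (t : Std nu) : lev A m := u_lev u (@vtrunc _ X m s (val t)).
have KR x b : level_ideal_gt d u nu x -> level_ideal_gt d u nu (x *a b).
  by apply: (level_ideal_right hdu); exact: ups_gt.
have VR x b : path_span d u nu predT x -> path_span d u nu predT (x *a b).
  exact: (path_span_right hdu).
have JR x b : level_ideal_gt d u la x -> level_ideal_gt d u la (x *a b).
  by apply: (level_ideal_right hdu); exact: ups_gt.
have X1R x b : path_span d u la predT x -> path_span d u la predT (x *a b).
  exact: (path_span_right hdu).
have a_unit q : e1 *a a q = r *: a q by rewrite e1C e1U.
have U_fact (t : Std nu) : u_std u t = usk t *a f (ut t).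
  by rewrite te_left_raise; exact: u_lev_split.
have P0P (t : Std nu) : above t -> level_ideal_gt d u la (ut t).
  apply: (u_trunc_in hdu _ (valP t)); exact: ups_gt.
have trP (t : Std nu) j : meets t = Some j -> ut t = u_std u j.
  by move/meetsP => e; rewrite /u_std e.
have P1P (t : Std nu) : below t -> above t \/ exists j, meets t = Some j.
  rewrite /below le_eqVlt => /orP[/eqP e|]; last by left.
  right; have ht := path_to_trunc (valP t); rewrite -e in ht.
  have [j ej] := (Std_path _ _).1 ht.
  by exists j; apply/meetsP.
have V0 v : path_span d u nu predT v -> path_span d u nu above (v *a f e0).
  rewrite te_left_raise.
  exact: (ideal_image hdu hC (@ups_gt _ _ _ d u m la) r00 e0_in e0U).
have V1 v : path_span d u nu predT v -> path_span d u nu below (v *a f e1).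
  rewrite te_left_raise.
  exact: (ideal_image hdu hC (@ups_ge _ _ _ d u m la) rn0 e1_in e1U).
have [p1 hp1] := cell_presents hdu la.
have [p3 hp3] := cell_presents hdu nu.
have fgC := te_comm rho (m := m) (s := s).
have stX x b : path_span d u nu in_skew x -> path_span d u nu in_skew (x *a g b).
  exact: (skew_right fgC KR VR (@u_std_free _ _ _ _ _ hdu _ nu) r00 e0C e0U rn0 a_unit
    a_mx U_fact P0P trP P1P V0 V1).
have st0 x b : path_span d u nu above x -> path_span d u nu above (x *a g b).
  exact: (low_right fgC KR VR (@u_std_free _ _ _ _ _ hdu _ nu) r00 e0U U_fact P0P V0).
have [pS hpS] : exists pS : lev A (s + m)%N -> skew_mod d u rho nu tla,
    @presents _ _ (res_rmod g (reg_rmod (lev A (s + m)%N)))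
      (skew_mod d u rho nu tla) (path_span d u nu in_skew) (path_span d u nu above) pS.
  have [|p hp] := @span_quo_presents _ _ (res_rmod g (reg_rmod (lev A (s + m)%N)))
    (fun x => exists t : sStd la nu, x = to_lev (s + m)%N (u_skew u t * u_path u tla))
    (@skew_gt R A C d u m s la nu).
    split; split; try exact: ss_P.
      by move=> x b /lspan_skew hx; apply/lspan_skew/stX.
    by move=> x b /lspan_skew_gt hx; apply/lspan_skew_gt/st0.
  exists p; case: hp => q1 q2 q3 q4; split.
  - by move=> c x y /lspan_skew hx /lspan_skew hy; apply: q1.
  - by move=> x b /lspan_skew hx; apply: q2.
  - by move=> z; have [x /lspan_skew hx ex] := q3 z; exists x.
  - by move=> x /lspan_skew hx; rewrite q4 // lspan_skew_gt.
exact: (skew_hom_pairing fgC KR VR (@u_std_free _ _ _ _ _ hdu _ nu) JR r00 e0_in e0C e0U rn0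
  a_unit a_mx U_fact P0P trP P1P V0 V1 (fun _ => iff_refl _) X1R hp1 hp3 hpS).
Qed.
End SkewModule.

Theorem theorem4p4
  (R : idomainType)
  (A H : tower R) (e : nat -> A) (hA : diagram_tower H e)
  (C : forall k, cell_datum (lev A k)) (hC : strongly_coherent C)
  (L : nat -> A) (hL : JM_family C L)
  (rho : tensor_embedding A)
  (d u : coeffs C) (hdu : is_murphy d u)
  (m s : nat)
  (la : cd_lam (C m)) (mu : cd_lam (C s)) (nu : cd_lam (C (s + m)%N))
  (tla : Std la) (htla : maximal_path tla) :
  exists f : {linear
      rhom (box_rmod (ext_rmod (cell_mod la)) (ext_rmod (cell_mod mu)))
           (res_rmod (te_ext rho m s) (ext_rmod (cell_mod nu)))
      -> rhom (ext_rmod (cell_mod mu)) (ext_rmod (skew_mod d u rho nu tla))},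
    bijective f.
Proof.
have [z0 [theta hp]] := skew_mod_pairing hdu (dt_split hA) hC rho nu tla.
exact: (hom_box_iso (te_comm rho (m := m) (s := s)) _ hp).
Qed.
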